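(* Every Floquet exponent $\omega\in\mathbb C$ of the time-modulated system with homogeneous Neumann boundary condition satisfies $$|\operatorname{Im}\omega|\le C_\kappa',\qquad\text{where}\quad C_\kappa'=\frac2T\int_0^T\left\|\frac{\kappa'(s)_+}{\kappa(s)}\right\|_{L^\infty(D)}\mathrm ds .$$
   Context: $D\subset\mathbb R^d$ is a bounded Lipschitz domain, and $T>0$. The real-valued coefficient $\kappa=\kappa(x,t)$ satisfies $\kappa\in C^1_{\mathrm{per}}(0,T;L^\infty(D))$ (continuously differentiable and $T$-periodic in time with values in $L^\infty(D)$) and $$0<\operatorname*{ess\,inf}_{x\in D,\,t\in[0,T]}\kappa(x,t)\le\operatorname*{ess\,sup}_{x\in D,\,t\in[0,T]}\kappa(x,t)<\infty .$$ $\kappa'=\partial_t\kappa$ and $\kappa'_+=\max(\kappa',0)$. A number $\omega\in\mathbb C$ is a Floquet exponent of the system with homogeneous Neumann boundary condition if there is a complex-valued $T$-periodic $u^\omega\in H^1_{\mathrm{per}}(0,T;H^1(D))$ (functions of time that are locally $H^1$ and $T$-periodic, with values in $H^1(D)$) such that $u(t)=\operatorname{Re}\big(e^{-i\omega t}u^\omega(t)\big)$ is a nontrivial solution, without excitation, of the weak formulation: for $t\ge0$ and all $v\in H^1(D)$, $$(v,\partial_t^2u(t))_{L^2(D)}+(\nabla v,\kappa(t)\nabla u(t))_{L^2(D)}=0,$$ where $\partial_t^2u$ is understood in the weak sense in time. *)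

(* Defs.v *)
From HB Require Import structures.
From mathcomp Require Import all_boot all_order all_algebra.
From mathcomp Require Import all_classical all_reals all_analysis.
From mathcomp Require Import ess_sup_inf complex.

Set Implicit Arguments.
Unset Strict Implicit.
Unset Printing Implicit Defensive.

Import Order.TTheory GRing.Theory Num.Theory.
Import numFieldTopology.Exports numFieldNormedType.Exports.

Local Open Scope classical_set_scope.
Local Open Scope ring_scope.

(* R^d is 'rV[R]_d, with the product sigma-algebra generated by the coordinate
   projections, which is the Borel sigma-algebra. *)

Definition rV_display : measure_display -> measure_display.
Proof. exact. Qed.

Section measurable_rV.
Context {R : realType} (n : nat).

Definition rV_measurable : set (set 'rV[R]_n) :=
  g_sigma_preimage (fun (i : 'I_n) (x : 'rV[R]_n) => (x 0 i : measurableTypeR R)).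

Let rV_set0 : rV_measurable set0.
Proof. exact: sigma_algebra0. Qed.

Let rV_setC A : rV_measurable A -> rV_measurable (~` A).
Proof. exact: sigma_algebraC. Qed.

Let rV_bigcup (F : (set 'rV[R]_n)^nat) :
  (forall i, rV_measurable (F i)) -> rV_measurable (\bigcup_i (F i)).
Proof. exact: sigma_algebra_bigcup. Qed.

HB.instance Definition _ := @isMeasurable.Build
  (rV_display R.-ocitv.-measurable.-sigma) 'rV[R]_n
  rV_measurable rV_set0 rV_setC rV_bigcup.

End measurable_rV.

Section lebesgue_rV.
Context {R : realType}.

Definition rV_cons n (p : 'rV[R]_n * measurableTypeR R) : 'rV[R]_n.+1 :=
  row_mx (const_mx p.2 : 'rV[R]_1) p.1.

Lemma measurable_coord n (i : 'I_n) :
  measurable_fun [set: 'rV[R]_n] (fun x => (x 0 i : measurableTypeR R)).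
Proof.
move=> _ Y mY; rewrite setTI; apply: sub_sigma_algebra => /=.
rewrite -bigcup_seq/=; exists i => /=; first by rewrite mem_index_enum.
by exists Y => //; rewrite setTI.
Qed.

Lemma measurable_rV_cons n : measurable_fun setT (@rV_cons n).
Proof.
move=> _ A; rewrite setTI => mA.
suff H : preimage_set_system setT (@rV_cons n) (@measurable _ 'rV[R]_n.+1)
    `<=` measurable.
  by rewrite -[_ @^-1` _]setTI; apply: H; exists A.
rewrite /measurable/= /rV_measurable -g_sigma_preimage_comp.
apply: smallest_sub; first exact: sigma_algebra_measurable.
rewrite -bigcup_seq; apply: bigcup_sub => i _ B [C mC <-].
have -> : (fun x : 'rV[R]_n.+1 => (x 0 i : measurableTypeR R)) \o @rV_cons n =
  match fintype.split (i : 'I_(1 + n)) with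
  | inl _ => fun p => p.2
  | inr j => fun p => p.1 0 j : measurableTypeR R
  end.
  apply/funext => p /=; rewrite /rV_cons mxE.
  by case: (fintype.split _) => j /=; rewrite ?mxE.
case: (fintype.split _) => j.
  by apply: measurable_snd.
have mj : measurable_fun [set: 'rV[R]_n * measurableTypeR R]
    (fun p => (p.1 0 j : measurableTypeR R)).
  by apply: (measurableT_comp (measurable_coord j)); exact: measurable_fst.
exact: mj.
Qed.

Fixpoint lebesgue_rV n : set 'rV[R]_n -> \bar R :=
  match n return set 'rV[R]_n -> \bar R with
  | 0 => dirac (0 : 'rV[R]_0)
  | n'.+1 => pushforward (lebesgue_rV (n := n') \x (@lebesgue_measure R))%E
               (@rV_cons n')
  end.

Lemma lebesgue_rV_measure n :
  exists m : {measure set 'rV[R]_n -> \bar R}, lebesgue_rV (n := n) = m.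
Proof.
elim: n => [|n [m IH]] /=; first by eexists.
rewrite IH.
by eexists (measure_function_pushforward__canonical__measure_function_Measure
  (m \x lebesgue_measure)%E (measurable_rV_cons (n := n))).
Qed.

Let lebesgue_rV0 n : lebesgue_rV (n := n) set0 = 0%E.
Proof. by have [m ->] := lebesgue_rV_measure n; exact: measure0. Qed.

Let lebesgue_rV_ge0 n (A : set 'rV[R]_n) : (0 <= lebesgue_rV A)%E.
Proof. by have [m ->] := lebesgue_rV_measure n; exact: measure_ge0. Qed.

Let lebesgue_rV_sigma_additive n : semi_sigma_additive (lebesgue_rV (n := n)).
Proof.
by have [m ->] := lebesgue_rV_measure n; exact: measure_semi_sigma_additive.
Qed.

HB.instance Definition _ n := isMeasure.Build _ _ _ (lebesgue_rV (n := n))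
  (@lebesgue_rV0 n) (@lebesgue_rV_ge0 n) (@lebesgue_rV_sigma_additive n).

End lebesgue_rV.
Arguments lebesgue_rV {R n}.

Section lipschitz_domain.
Context {R : realType} {d : nat}.
Implicit Types (D : set 'rV[R]_d) (x e : 'rV[R]_d).

Definition dotmul x e : R := \sum_i x 0 i * e 0 i.

(* Near each boundary point, D lies strictly above the graph, in the direction
   of the unit vector e, of a Lipschitz function of the component of x
   orthogonal to e.  The function g is only evaluated on the hyperplane
   orthogonal to e; a Lipschitz function on that hyperplane always extends. *)
Definition lipschitz_boundary D :=
  forall x0, closure D x0 -> ~ D x0 ->
  exists (e : 'rV[R]_d) (k : R) (g : 'rV[R]_d -> R),
    [/\ dotmul e e = 1, k.-lipschitz g
      & \forall x \near x0, D x <-> g (x - dotmul x e *: e) < dotmul x e].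

Definition bounded_lipschitz_domain D :=
  [/\ open D, connected D, D !=set0, bounded_set D & lipschitz_boundary D].

End lipschitz_domain.

Section test_functions.
Context {R : realType} {V : normedModType R}.

(* All iterated directional derivatives exist and are differentiable; for
   finite-dimensional V this is C^oo. *)
Definition smooth (f : V -> R) :=
  forall (s : seq V) (x : V), differentiable (foldr (fun v g => 'D_v g) f s) x.

Definition test_function (O : set V) (f : V -> R) :=
  smooth f /\ exists K : set V,
    [/\ compact K, K `<=` O & forall x, ~ K x -> f x = 0].

End test_functions.

Section spatial_spaces.
Context {R : realType} {d : nat} (D : set 'rV[R]_d).
Local Notation mu := (@lebesgue_rV R d).
Implicit Types f g : 'rV[R]_d -> R.

(* Elements of the spaces over D are represented by functions on R^d, of which
   only the values on D (up to null sets) matter. *)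
Definition ae_on (P : 'rV[R]_d -> Prop) := {ae mu, forall x, D x -> P x}.

Definition L2 f := f \_ D \in Lfun mu 2%:E.

Definition Linfty f := f \_ D \in Lfun mu +oo%E.

Definition Linfty_norm f : \bar R := 'N[mu]_+oo[EFin \o (f \_ D)].

Definition dotL2 f g : R := \int[mu]_(x in D) (f x * g x).

Definition weak_partial (i : 'I_d) f g :=
  forall phi, test_function D phi ->
  dotL2 f ('D_(delta_mx 0 i) phi) = - dotL2 g phi.

Definition H1 f := L2 f /\ forall i, exists2 g, L2 g & weak_partial i f g.

(* A chosen representative of the i-th weak derivative of f in L^2(D). *)
Definition wpartial (i : 'I_d) f : 'rV[R]_d -> R :=
  xget (cst 0) [set g | L2 g /\ weak_partial i f g].

Definition dotH1 f g : R :=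
  dotL2 f g + \sum_i dotL2 (wpartial i f) (wpartial i g).

Definition H1_norm f : R := Num.sqrt (dotH1 f f).

End spatial_spaces.

Section time_dependent.
Context {R : realType} {d : nat} (D : set 'rV[R]_d).
Local Notation mu := (@lebesgue_rV R d).
Local Notation leb := (@lebesgue_measure R).
Implicit Types u v : R -> 'rV[R]_d -> R.

(* Bochner measurability of u : R -> H^1(D): almost everywhere limit, in
   H^1(D), of measurable functions with finitely many values. *)
Definition strongly_measurable_H1 u :=
  exists s : nat -> R -> 'rV[R]_d -> R,
    [/\ forall n t, H1 D (s n t),
        forall n, finite_set (range (s n)),
        forall n f, measurable ((s n @^-1` [set f]) : set (measurableTypeR R))
      & {ae leb, forall t,
          (fun n => H1_norm D (fun x => s n t x - u t x)) @ \oo --> (0 : R)}].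

Definition L2loc_H1 u :=
  [/\ forall t, H1 D (u t), strongly_measurable_H1 u
    & forall a b : R,
        (\int[leb]_(t in `[a, b]) (H1_norm D (u t) ^+ 2)%:E < +oo)%E].

(* v is the weak time derivative of u: the identity between the Bochner
   integrals of phi' u and - phi v is tested against every w in H^1(D). *)
Definition weak_dt u v :=
  forall phi : R -> R, test_function setT phi -> forall w, H1 D w ->
  \int[leb]_t (derive1 phi t * dotH1 D w (u t)) =
  - \int[leb]_t (phi t * dotH1 D w (v t)).

Definition H1per_H1 (T : R) u :=
  [/\ forall t, ae_on D (fun x => u (t + T) x = u t x), L2loc_H1 u
    & exists2 v, L2loc_H1 v & weak_dt u v].

(* kappa' is the time derivative of kappa in the norm of L^oo(D). *)
Definition C1per_Linfty (T : R) (kappa kappa' : R -> 'rV[R]_d -> R) :=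
  [/\ forall t, Linfty D (kappa t) /\ Linfty D (kappa' t),
      forall t, ae_on D (fun x => kappa (t + T) x = kappa t x),
      forall t, (fun h : R => Linfty_norm D
         (fun x => h^-1 * (kappa (t + h) x - kappa t x) - kappa' t x))
           @ 0^' --> (0 : \bar R)
    & forall t, (fun s : R => Linfty_norm D (fun x => kappa' s x - kappa' t x))
           @ t --> (0 : \bar R)].

Local Open Scope ereal_scope.

(* Essential bounds over D x [0, T] for the product Lebesgue measure; outside
   of D x [0, T] the function is replaced by the neutral value. *)
Definition ess_inf_cylinder (T : R) (f : R -> 'rV[R]_d -> R) : \bar R :=
  ess_inf (mu \x leb) (patch (cst +oo) (D `*` `[0%R, T])
    (fun z : 'rV[R]_d * measurableTypeR R => (f z.2 z.1)%:E)).

Definition ess_sup_cylinder (T : R) (f : R -> 'rV[R]_d -> R) : \bar R :=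
  ess_sup (mu \x leb) (patch (cst -oo) (D `*` `[0%R, T])
    (fun z : 'rV[R]_d * measurableTypeR R => (f z.2 z.1)%:E)).

Local Close Scope ereal_scope.

(* The pairing (v, d_t^2 u(t)) + (grad v, kappa(t) grad u(t)) vanishes, for all
   v in H^1(D), as a distribution in t on (0, +oo).  Testing with the whole of
   H^1(D) encodes the homogeneous Neumann condition. *)
Definition neumann_solution (kappa u : R -> 'rV[R]_d -> R) :=
  forall v : 'rV[R]_d -> R, H1 D v ->
  forall phi : R -> R, test_function [set t : R | 0 < t] phi ->
  \int[leb]_(t in `[0, +oo[)
    (derive1n 2 phi t * dotL2 D v (u t) +
     phi t * \sum_i dotL2 D (wpartial D i v)
                            (fun x => kappa t x * wpartial D i (u t) x)) = 0.

Definition cexp (z : R[i]) : R[i] :=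
  ((expR (complex.Re z) * cos (complex.Im z)) +i*
   (expR (complex.Re z) * sin (complex.Im z)))%C.

Definition floquet_exponent (T : R) (kappa : R -> 'rV[R]_d -> R) (w : R[i]) :=
  exists uw : R -> 'rV[R]_d -> R[i],
    let u t x := complex.Re (cexp (- 'i%C * w * t%:C%C) * uw t x) in
    [/\ H1per_H1 T (fun t x => complex.Re (uw t x)),
        H1per_H1 T (fun t x => complex.Im (uw t x)),
        neumann_solution kappa u
      & ~ {ae leb, forall t, 0 <= t -> ae_on D (fun x => u t x = 0)}].

End time_dependent.

(* Main.v *)
(* Let g = Im w and lam = e^(-iwT), so that |lam|^2 = e^(2gT) and the complex
   solution z = e^(-iwt) uw satisfies z(t + T) = lam z(t).  The potential energies
   a_t(v, v) = (grad v, kappa(t) grad v) satisfy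
     a_t(v, v) <= e^(alpha(t) - alpha(r)) a_r(v, v)   for r <= t,
   where alpha' is the L^oo norm of kappa'_+ / kappa.  Hence, up to an error of
   order eta, the energy |z'|^2 + a_t(z, z) + eta^2 |z|^2 is multiplied over one
   period by at most e^(aT), aT = alpha(T) - alpha(0); it is also multiplied by
   e^(2gT), so 2gT <= aT.  A bound from below needs the dual energy
   |z|^2 + (z', A_t^-1 z'), A_t being the operator of a_t + eta^2 |.|^2: the
   inverse reverses the order, so this energy is divided by at most e^(aT) over
   one period, and - 2gT <= aT.
   Since z is only H^1 in time, both energies are replaced by discrete ones on
   the grids t0 + kT/n, with n going to infinity.  The discrete equation comes
   from testing with second differences of mollified ramps, at points t0 chosen
   such that all grid points are Lebesgue points, where increments of z are
   controlled by the integral of |z'|; in the dual energy A_t^-1 z' is replaced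
   by an approximate minimizer.  For nonreal lam the imaginary part of z is a
   combination of u and of its translate by T, hence also a solution; for real
   lam, u itself is multiplied by lam. *)

(* The form $a_t$ vanishes on constants, so it can neither be inverted nor bound $|z|$; the added
   $\eta^2|\cdot|^2$ cures both. The equation does not contain this shift, and by Young's inequality
   it costs a relative error $\eta h/2$ per step, hence a factor $e^{O(\eta T)}$ per period, which
   disappears when $\eta\to0$ after $n\to\infty$. All other errors of a step are quadratic in the
   increments of $z$ over a few cells of length $h=T/n$. Their squares are of order $h$ times
   $h+\int|z'|^2$ over these cells, so the errors add up to $O(1/n)$, whereas both energies stay
   above a positive constant because $z(t_0)\ne0$. The decay estimate cannot come from the first
   energy run backwards: $\kappa'_+$ controls how fast $a_t$ grows, but not how fast it drops. *)
Require Import Defs.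
From HB Require Import structures.
From mathcomp Require Import all_boot all_order all_algebra.
From mathcomp Require Import all_classical all_reals all_analysis.
From mathcomp Require Import ess_sup_inf complex.
From mathcomp Require Import measurable_realfun ring lra.

Set Implicit Arguments.
Unset Strict Implicit.
Unset Printing Implicit Defensive.

Import Order.TTheory GRing.Theory Num.Theory.
Import numFieldTopology.Exports numFieldNormedType.Exports.

Local Open Scope classical_set_scope.
Local Open Scope ring_scope.

(** * Smooth functions *)

Section smooth_theory.
Context {R : realType} {V : normedModType R}.
Implicit Types f g : V -> R.

(** Coinduction for [smooth]: later proofs exhibit a class stable under derivation instead of
    computing iterated derivatives. *)
Lemma smooth_class (C : (V -> R) -> Prop) :
  (forall f, C f -> forall x, differentiable f x) ->
  (forall f v, C f -> C ('D_v f)) -> forall f, C f -> smooth f.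
Proof.
move=> Cd CD f Cf s; suff : C (foldr (fun v g => 'D_v g) f s) by move/Cd.
by elim: s => //= v s; exact: CD.
Qed.

Lemma smooth_differentiable f x : smooth f -> differentiable f x.
Proof. by move=> /(_ [::] x). Qed.

Lemma smooth_derive f v : smooth f -> smooth ('D_v f).
Proof. by move=> sf s x; have := sf (rcons s v) x; rewrite foldr_rcons. Qed.

Lemma smoothP f : (forall x, differentiable f x) ->
  (forall v, smooth ('D_v f)) -> smooth f.
Proof.
move=> df sf; apply: (@smooth_class (fun g => g = f \/ smooth g)); last by left.
  by move=> g [->//|sg] x; exact: smooth_differentiable.
by move=> g v [->|sg]; right => //; exact: smooth_derive.
Qed.

Lemma smooth_cst (c : R) : smooth (cst c : V -> R).
Proof.
apply: (@smooth_class (fun g => exists c, g = cst c)); last by exists c.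
  by move=> g [k ->] x; exact: differentiable_cst.
move=> g v [k ->]; exists 0; apply/funext => x /=.
by rewrite derive_cst.
Qed.

Lemma smoothD f g : smooth f -> smooth g -> smooth (f \+ g).
Proof.
move=> sf sg.
apply: (@smooth_class (fun k => exists f g, [/\ smooth f, smooth g & k = f \+ g]));
  last by exists f, g.
- move=> _ [a [b [sa sb ->]]] x.
  by apply: differentiableD; exact: smooth_differentiable.
- move=> _ v [a [b [sa sb ->]]]; exists ('D_v a), ('D_v b).
  split; [exact: smooth_derive|exact: smooth_derive|].
  apply/funext => x /=.
  by apply: deriveD; apply: diff_derivable; exact: smooth_differentiable.
Qed.

(** Products alone are not stable under derivation; finite sums of products of smooth functions are,
    by the Leibniz rule. *)
Lemma smoothM f g : smooth f -> smooth g -> smooth (f \* g).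
Proof.
move=> sf sg.
pose C := fun k => exists s : seq ((V -> R) * (V -> R)),
  (forall p, p \in s -> smooth p.1 /\ smooth p.2) /\
  k = (fun x => \sum_(p <- s) p.1 x * p.2 x).
have dsum (s : seq ((V -> R) * (V -> R))) x :
    (forall p, p \in s -> smooth p.1 /\ smooth p.2) ->
    differentiable (fun x => \sum_(p <- s) p.1 x * p.2 x) x.
  elim: s => [_|p s IH ss].
    rewrite (_ : (fun y => _) = cst 0); first exact: differentiable_cst.
    by apply/funext => y; rewrite big_nil.
  rewrite (_ : (fun y => _) =
    (p.1 * p.2) + (fun y => \sum_(p <- s) p.1 y * p.2 y)); last first.
    by apply/funext => y; rewrite big_cons.
  have [p1 p2] : smooth p.1 /\ smooth p.2 by apply: ss; rewrite inE eqxx.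
  apply: differentiableD; last by apply: IH => r rs; apply: ss; rewrite inE rs orbT.
  by apply: differentiableM; exact: smooth_differentiable.
apply: (@smooth_class C); last first.
- exists [:: (f, g)]; split; first by move=> p; rewrite inE => /eqP ->.
  by apply/funext => x; rewrite big_seq1.
- move=> _ v [s [ss ->]].
  exists (map (fun p => ('D_v p.1, p.2)) s ++ map (fun p => (p.1, 'D_v p.2)) s).
  split.
    move=> p; rewrite mem_cat => /orP[] /mapP[q /ss[q1 q2] ->]; split=> //=;
    exact: smooth_derive.
  apply/funext => x; rewrite big_cat/= !big_map/= -big_split/=.
  elim: s ss => [|q s IH] ss.
    rewrite big_nil (_ : (fun y => _) = cst 0) ?derive_cst//.
    by apply/funext => y; rewrite big_nil.
  have [q1 q2] : smooth q.1 /\ smooth q.2 by apply: ss; rewrite inE eqxx.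
  have ss' : forall p, p \in s -> smooth p.1 /\ smooth p.2.
    by move=> p ps; apply: ss; rewrite inE ps orbT.
  rewrite big_cons -IH//.
  rewrite (_ : (fun y => _) =
    (q.1 * q.2) + (fun y => \sum_(p <- s) p.1 y * p.2 y)); last first.
    by apply/funext => y; rewrite big_cons.
  have d1 : derivable q.1 x v.
    by apply: diff_derivable; exact: smooth_differentiable.
  have d2 : derivable q.2 x v.
    by apply: diff_derivable; exact: smooth_differentiable.
  have dS : derivable (fun y => \sum_(p <- s) p.1 y * p.2 y) x v.
    apply: diff_derivable; apply: dsum => p ps; apply: ss.
    by rewrite inE ps orbT.
  have -> := deriveD (derivableM d1 d2) dS.
  have -> := deriveM d1 d2.
  by congr (_ + _); rewrite addrC; congr (_ + _); exact: mulrC.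
- by move=> _ [s [ss ->]] x; exact: dsum.
Qed.

Lemma smoothZ (c : R) f : smooth f -> smooth (fun x => c * f x).
Proof. by move=> sf; exact: (smoothM (smooth_cst c) sf). Qed.

Lemma smooth_prod n (F : 'I_n -> V -> R) :
  (forall i, smooth (F i)) -> smooth (fun x => \prod_i F i x).
Proof.
move=> sF.
rewrite (_ : (fun x => _) = \big[(fun f g => f \* g)/cst 1]_i F i); last first.
  apply/funext => x.
  by elim/big_ind2 : _ => //= a f b g -> ->.
elim/big_ind : _ => //; first exact: smooth_cst.
by move=> f g; exact: smoothM.
Qed.

End smooth_theory.

Section smooth_line.
Context {R : realType}.
Implicit Types f g : R -> R.

Lemma deriveR f (v x : R) : differentiable f x -> 'D_v f x = v * (derive1 f) x.
Proof.
move=> df; rewrite derive1E !deriveE// -{1}[v]mulr1.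
by rewrite linearZ.
Qed.

Lemma smooth_line_class (C : (R -> R) -> Prop) :
  (forall c f, C f -> C (fun x => c * f x)) ->
  (forall f, C f -> forall x, derivable f x 1 /\ C (derive1 f)) ->
  forall f, C f -> smooth f.
Proof.
move=> CZ CD; apply: smooth_class.
  by move=> f /CD df x; apply/derivable1_diffP; have [] := df x.
move=> f v Cf; rewrite (_ : 'D_v f = fun x => v * (derive1 f) x).
  by apply: CZ; have [] := CD _ Cf 0.
apply/funext => x; apply: deriveR.
by apply/derivable1_diffP; have [] := CD _ Cf x.
Qed.

Lemma smooth_derive1 f : smooth f -> smooth (derive1 f).
Proof.
move=> sf; rewrite (_ : (derive1 f) = 'D_1 f); first exact: smooth_derive.
by apply/funext => x; rewrite derive1E.
Qed.

Lemma smooth_lineP f : (forall x, derivable f x 1) -> smooth (derive1 f) -> smooth f.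
Proof.
move=> df sf; apply: smoothP => [x|v]; first exact/derivable1_diffP.
rewrite (_ : 'D_v f = fun x => v * (derive1 f) x); first exact: smoothZ.
by apply/funext => x; apply: deriveR; exact/derivable1_diffP.
Qed.

Lemma smooth_continuous f : smooth f -> continuous f.
Proof.
by move=> sf x; apply: differentiable_continuous; exact: smooth_differentiable.
Qed.

(* [l] is affine: its directional derivatives are constant. *)
Lemma smooth_comp_affine {V : normedModType R} (l : V -> R) f :
  (forall x, differentiable l x) ->
  (forall v, exists c : R, forall x, 'D_v l x = c) ->
  smooth f -> smooth (f \o l).
Proof.
move=> dl lc sf.
apply: (@smooth_class R V (fun g : V -> R => exists f c, smooth f /\ g = (fun x => c * f (l x)))).
- move=> _ [g [c [sg ->]]] x.
  apply: (@differentiableM _ _ (cst c) (g \o l)); first exact: differentiable_cst.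
  by apply: differentiable_comp => //; exact: smooth_differentiable.
- move=> _ v [g [c [sg ->]]]; have [k lk] := lc v.
  exists (derive1 g), (c * k); split; first exact: smooth_derive1.
  apply/funext => x.
  have dg : differentiable (g \o l) x.
    by apply: differentiable_comp => //; exact: smooth_differentiable.
  have -> : 'D_v (fun y => c * g (l y)) x = c * 'D_v (g \o l) x.
    by have := deriveZ c (diff_derivable dg : derivable (g \o l) x v).
  rewrite deriveE// diff_comp//; last exact: smooth_differentiable.
  rewrite /= -[X in ('d g _ X)]deriveE// lk -deriveE; last exact: smooth_differentiable.
  by rewrite deriveR; [rewrite mulrA|exact: smooth_differentiable].
- by exists f, 1; split=> //; apply/funext => x /=; rewrite mul1r.
Qed.

End smooth_line.

(** * Mollifiers *)

Section mollifier.
Context {R : realType}.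
Implicit Types (p : {poly R}) (f F : R -> R).

Let flat p (x : R) : R := if 0 < x then p.[x^-1] * expR (- x^-1) else 0.

(** Flatness at 0: with $y=1/x$, the bound $e^y\ge(y/(n+1))^{n+1}$ beats $y^n$ by one power, which
    leaves the factor $x$. *)
Lemma polyexp_bound p : exists C, forall x : R, 0 < x ->
  `|p.[x^-1] * expR (- x^-1)| <= C * x.
Proof.
have powexp n : exists C : R, forall x : R, 0 < x ->
    x^-1 ^+ n * expR (- x^-1) <= C * x.
  exists ((n.+1%:R) ^+ n.+1) => x x0.
  have N0 : 0 < n.+1%:R :> R by rewrite ltr0n.
  have y0 : 0 <= x^-1 / n.+1%:R by rewrite divr_ge0 ?invr_ge0 ?ltW.
  have : (x^-1 / n.+1%:R) ^+ n.+1 <= expR x^-1.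
    apply: le_trans (_ : expR (x^-1 / n.+1%:R) ^+ n.+1 <= _).
      rewrite lerXn2r ?nnegrE ?expR_ge0//.
      by apply: le_trans (expR_ge1Dx _); rewrite lerDr.
    by rewrite -expRM_natr divfK// gt_eqF.
  rewrite expRN ler_pdivrMr ?expR_gt0// expr_div_n ler_pdivrMr ?exprn_gt0//.
  rewrite exprS => H.
  have -> : x^-1 ^+ n = x * (x^-1 * x^-1 ^+ n) by rewrite mulrA mulfV ?mul1r// gt_eqF.
  by rewrite [leRHS](_ : _ = x * (expR x^-1 * n.+1%:R ^+ n.+1)) ?ler_pM2l//; ring.
(* The extra power $x^{-n}$ carries the induction on [p]: each step trades one factor ['X] for one
   more power. *)
suff H n : exists C : R, forall x : R, 0 < x ->
    `|p.[x^-1]| * (x^-1 ^+ n * expR (- x^-1)) <= C * x.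
  have [C HC] := H 0; exists C => x x0; rewrite normrM (ger0_norm (expR_ge0 _)).
  by apply: le_trans (HC x x0); rewrite expr0 mul1r.
elim/poly_ind: p n => [|p c IH] n.
  by exists 0 => x x0; rewrite horner0 normr0 !mul0r.
have [C1 H1] := IH n.+1; have [C2 H2] := powexp n.
exists (C1 + `|c| * C2) => x x0; rewrite hornerMXaddC [leRHS]mulrDl.
have E0 : 0 <= x^-1 ^+ n * expR (- x^-1).
  by rewrite mulr_ge0 ?expR_ge0 ?exprn_ge0 ?invr_ge0 ?ltW.
apply: le_trans (_ : (`|p.[x^-1]| * x^-1 + `|c|) * (x^-1 ^+ n * expR (- x^-1)) <= _).
  apply: ler_wpM2r => //; apply: le_trans (ler_normD _ _) _.
  by rewrite normrM (@ger0_norm _ x^-1) ?lexx// invr_ge0 ltW.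
rewrite mulrDl; apply: lerD.
  by apply: le_trans (H1 x x0); rewrite exprS !mulrA.
by rewrite -mulrA ler_wpM2l// H2.
Qed.

(** The functions $p(1/x)e^{-1/x}$, extended by 0, are stable under derivation: the chain rule turns
    $p$ into $(p-p')X^2$. *)
Lemma flat_derive p (x : R) :
  is_derive x 1 (flat p) (flat ((p - deriv p) * 'X ^+ 2) x).
Proof.
have [x0|x0|->] := ltgtP x 0.
- rewrite {2}/flat ltNge (ltW x0)/=.
  apply: (@near_eq_is_derive _ _ _ (cst 0)).
  near=> y; rewrite /flat ltNge (_ : y <= 0)//.
  by apply: ltW; near: y; exact: lt_nbhsl.
- rewrite {2}/flat x0.
  have xN : x != 0 by rewrite gt_eqF.
  have dV : is_derive x (1 : R) (fun y : R => y^-1) (- x ^- 2).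
    by have := @is_deriveV _ id x 1 1 xN (is_derive_id _ _); rewrite /GRing.scale/= mulr1.
  have dNV : is_derive x (1 : R) (fun y : R => - y^-1) (x ^- 2).
    by have := is_deriveN dV; rewrite opprK.
  have d1 : is_derive x (1 : R) (fun y : R => p.[y^-1]) ((deriv p).[x^-1] * - x ^- 2).
    exact: (@is_derive1_comp _ (horner p) (fun y => y^-1)).
  have d2 : is_derive x (1 : R) (fun y : R => expR (- y^-1)) (expR (- x^-1) * x ^- 2).
    exact: (@is_derive1_comp _ expR (fun y => - y^-1)).
  have dD : is_derive x (1 : R) (fun y : R => p.[y^-1] * expR (- y^-1))
      (((p - deriv p) * 'X^2).[x^-1] * expR (- x^-1)).
    apply: (@is_derive_eq _ _ _ _ x 1 _ _ (is_deriveM d1 d2)).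
    by rewrite /GRing.scale/= hornerM hornerXn hornerD hornerN -!exprVn; ring.
  apply: near_eq_is_derive dD.
  near=> y; rewrite /flat (_ : 0 < y)//.
  by near: y; exact: lt_nbhsr.
- rewrite {2}/flat ltxx.
  (* The additional factor ['X] absorbs the $h^{-1}$ of the difference quotient at 0. *)
  have [C HC] := polyexp_bound (p * 'X).
  have L : (fun h : R => h^-1 *: (flat p (h *: 1 + 0) - flat p 0)) @ 0^' --> (0 : R).
    apply/cvgr0Pnorm_lt => e e0.
    have C1 : 0 < `|C| + 1 by rewrite ltr_wpDl.
    near=> h; rewrite /flat ltxx subr0 /GRing.scale/= addr0 mulr1.
    case: ifPn => h0; last by rewrite mulr0 normr0.
    have := HC h h0; rewrite hornerMX [_ * h^-1]mulrC -mulrA => /le_lt_trans; apply.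
    apply: (@le_lt_trans _ _ ((`|C| + 1) * h)).
      by rewrite ler_pM2r//; apply: le_trans (ler_norm _) _; rewrite lerDl.
    rewrite mulrC -ltr_pdivlMr//; apply: le_lt_trans (ler_norm _) _.
    by near: h; apply: dnbhs0_lt; rewrite divr_gt0.
  apply: DeriveDef; first by apply/cvg_ex; exists 0.
  by apply: cvg_lim.
Unshelve. all: by end_near. Qed.

Lemma flat_smooth p : smooth (flat p).
Proof.
apply: (@smooth_line_class R (fun f => exists p, f = flat p)); last by exists p.
  move=> c _ [q ->]; exists (c *: q); apply/funext => x; rewrite /flat.
  by case: ifP => _; rewrite ?mulr0// hornerZ mulrA.
move=> _ [q ->] x; split; first by case: (flat_derive q x).
exists ((q - deriv q) * 'X ^+ 2); apply/funext => y.
by rewrite derive1E; case: (flat_derive q y).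
Qed.

Lemma continuous_integrable_itv (f : R -> R) (a b : R) : continuous f ->
  (@lebesgue_measure R).-integrable `[a, b] (EFin \o f).
Proof.
move=> cf; apply: continuous_compact_integrable; first exact: segment_compact.
exact: continuous_subspaceT.
Qed.

(** The integral starts at $-2$, strictly left of where [f] can be nonzero, so every $x\ge-1$ is an
    interior point for the fundamental theorem of calculus. *)
Lemma primitive_exists f : continuous f -> (forall x, x <= - 1 -> f x = 0) ->
  exists F : R -> R, (forall x : R, is_derive x (1:R) F (f x)) /\
    forall x, x <= - 1 -> F x = 0.
Proof.
move=> cf f0.
pose F := fun x : R => \int[@lebesgue_measure R]_(t in `[- 2, x]) f t.
have F0 x : x <= - 1 -> F x = 0.
  move=> x1; rewrite /F (@eq_Rintegral _ _ _ _ _ (cst 0)); first by rewrite Rintegral_cst// mul0r.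
  by move=> t; rewrite inE/= in_itv/= => /andP[_ tx]; apply: f0; exact: le_trans x1.
exists F; split=> // x; have [x1|x1] := ltP x (- 1).
  rewrite f0 ?ltW//; apply: (@near_eq_is_derive _ _ _ (cst 0)).
  near=> y; rewrite F0//; apply: ltW; near: y; exact: lt_nbhsl.
have [] := @continuous_FTC1_closed _ f (- 2) x (x + 1) _ _ _ (cf x).
- by rewrite ltrDl.
- exact: continuous_integrable_itv.
- by apply: lt_le_trans x1; lra.
by move=> d1 <-; rewrite derive1E; exact: DeriveDef.
Unshelve. all: by end_near. Qed.

(** A bump and its first two primitives: smoothed versions of the Dirac mass, the Heaviside step and
    the ramp. *)
Lemma mollifier_exists : exists rho S P : R -> R,
  [/\ [/\ smooth rho, smooth S & smooth P],
      [/\ (forall x : R, is_derive x (1:R) S (rho x)) & forall x : R, is_derive x (1:R) P (S x)],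
      (forall x, 0 <= rho x) /\ (forall x, 1 <= `|x| -> rho x = 0),
      [/\ (forall x, x <= - 1 -> S x = 0), (forall x, 1 <= x -> S x = 1)
        & forall x, 0 <= S x <= 1]
    & forall x, x <= - 1 -> P x = 0].
Proof.
pose r0 (x : R) := flat 1 (x + 1) * flat 1 (1 - x).
have flat1_ge0 x : 0 <= flat 1 x.
  by rewrite /flat; case: ifP => // _; rewrite hornerC mul1r expR_ge0.
have aff (a b : R) : smooth (fun x : R => flat 1 (a * x + b)).
  apply: (@smooth_comp_affine _ _ (fun x => a * x + b)); last exact: flat_smooth.
    by move=> x; apply/derivable1_diffP.
  move=> v; exists (v * a) => x; rewrite deriveR; last by apply/derivable1_diffP.
  by rewrite derive1E derive_val /GRing.scale/= mulr1 addr0.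
have sr0 : smooth r0.
  have := smoothM (aff 1 1) (aff (- 1) 1); congr smooth.
  by apply/funext => x /=; rewrite /r0 mul1r mulN1r [- x + 1]addrC.
have r0_ge0 x : 0 <= r0 x by rewrite mulr_ge0.
have r0_0 x : 1 <= `|x| -> r0 x = 0.
  rewrite ler_normr => /orP[x1|x1]; rewrite /r0 /flat.
    by rewrite [X in _ * X]ifF ?mulr0//; apply/negbTE; rewrite -leNgt subr_le0.
  by rewrite ifF ?mul0r//; apply/negbTE; rewrite -leNgt -lerBrDr sub0r lerNr.
have [S0 [dS0 S00]] : exists F : R -> R, (forall x : R, is_derive x (1:R) F (r0 x)) /\
    forall x, x <= - 1 -> F x = 0.
  apply: primitive_exists; first exact: smooth_continuous.
  by move=> x x1; apply: r0_0; rewrite ler_normr lerNr x1 orbT.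
have cS0 (a b : R) : {within `[a, b], continuous S0}.
  apply: continuous_subspaceT => z; apply/differentiable_continuous/derivable1_diffP.
  by case: (dS0 z).
have S0mono x y : x <= y -> S0 x <= S0 y.
  move=> xy; have [|c _ E] := @MVT_segment R S0 r0 x y xy.
  - exact: cS0.
  by rewrite -subr_ge0 E mulr_ge0// subr_ge0.
(* The total mass is positive because the bump is strictly positive on $]-1/2,1/2[$; dividing by it
   normalizes [S] to 1 on the right. *)
have S01 : 0 < S0 1.
  have [||c] := @MVT R S0 r0 (- 2^-1) 2^-1.
  - by rewrite (@lt_trans _ _ 0)// ?oppr_lt0 invr_gt0.
  - exact: cS0.
  rewrite in_itv/= => /andP[c1 c2] E.
  have : 0 < S0 2^-1 - S0 (- 2^-1).
    rewrite E mulr_gt0//.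
    by rewrite /r0 /flat !ifT ?hornerC ?mul1r ?mulr_gt0 ?expR_gt0//; lra.
  have h1 : S0 2^-1 <= S0 1 by apply: S0mono; lra.
  have h2 : 0 <= S0 (- 2^-1) by rewrite -(S00 (- 1))// S0mono//; lra.
  by lra.
pose k := (S0 1)^-1.
pose rho x := k * r0 x; pose S x := k * S0 x.
have k0 : 0 < k by rewrite invr_gt0.
have dS (x : R) : is_derive x (1:R) S (rho x).
  by have := @is_deriveZ _ _ _ S0 k x 1 (r0 x) (dS0 x).
have srho : smooth rho by exact: smoothZ.
have sS : smooth S.
  apply: smooth_lineP; first by move=> x; case: (dS x).
  by congr smooth: srho; apply/funext => x; rewrite derive1E; case: (dS x).
have SL x : x <= - 1 -> S x = 0 by move=> x1; rewrite /S S00// mulr0.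
have S0R x : 1 <= x -> S0 x = S0 1.
  move=> x1; have [|c + E] := @MVT_segment R S0 r0 1 x x1.
  - exact: cS0.
  rewrite in_itv/= => /andP[c1 _]; apply/eqP; rewrite -subr_eq0 E r0_0 ?mul0r//.
  by rewrite ler_normr c1.
have SR x : 1 <= x -> S x = 1 by move=> x1; rewrite /S S0R// /k mulVf ?gt_eqF.
have Smono x y : x <= y -> S x <= S y by move=> xy; rewrite ler_pM2l// S0mono.
have [P [dP P0]] : exists F : R -> R, (forall x : R, is_derive x (1:R) F (S x)) /\
    forall x, x <= - 1 -> F x = 0.
  by apply: primitive_exists => //; exact: smooth_continuous.
exists rho, S, P; split=> //.
- split=> //; apply: smooth_lineP; first by move=> x; case: (dP x).
  by congr smooth: sS; apply/funext => x; rewrite derive1E; case: (dP x).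
- split; first by move=> x; rewrite mulr_ge0// ltW.
  by move=> x x1; rewrite /rho r0_0// mulr0.
- split=> // x; apply/andP; split.
    have [x1|x1] := leP x (- 1); first by rewrite SL.
    by rewrite -(SL (- 1))// Smono// ltW.
  have [x1|x1] := leP 1 x; first by rewrite SR.
  by rewrite -(SR 1)// Smono// ltW.
Qed.

End mollifier.

(** * The fundamental lemma of the calculus of variations *)

Section boxes.
Context {R : realType}.

Definition box n (a b : 'rV[R]_n) : set 'rV[R]_n :=
  [set x | forall i, a 0 i < x 0 i < b 0 i].

Lemma measurable_coord_lt n (i : 'I_n) (a : R) :
  measurable [set x : 'rV[R]_n | a < x 0 i].
Proof.
have := @measurable_coord R n i measurableT `]a, +oo[%classic (measurable_itv _).
by rewrite setTI; congr measurable; apply/seteqP; split=> x /=; rewrite in_itv/= andbT.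
Qed.

Lemma measurable_coord_gt n (i : 'I_n) (a : R) :
  measurable [set x : 'rV[R]_n | x 0 i < a].
Proof.
have := @measurable_coord R n i measurableT `]-oo, a[%classic (measurable_itv _).
by rewrite setTI; congr measurable; apply/seteqP; split=> x /=; rewrite in_itv/=.
Qed.

Lemma measurable_forall d (T : measurableType d) n (P : 'I_n -> set T) :
  (forall i, measurable (P i)) -> measurable [set x | forall i, P i x].
Proof.
move=> mP; rewrite (_ : [set x | _] = \big[setI/setT]_i P i); last first.
  apply/seteqP; split=> x /=.
    by move=> Px; elim/big_ind : _ => // i _; exact: Px.
  by move=> + i; rewrite (bigD1 i)//= => -[].
by apply: bigsetI_measurable.
Qed.

Lemma measurable_box n (a b : 'rV[R]_n) : measurable (box a b).
Proof.
apply: measurable_forall => i.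
rewrite [X in measurable X](_ : _ = [set x : 'rV[R]_n | a 0 i < x 0 i] `&` [set x | x 0 i < b 0 i]).
  by apply: measurableI; [exact: measurable_coord_lt|exact: measurable_coord_gt].
by apply/seteqP; split=> x /=; [case/andP|move=> [? ?]; apply/andP].
Qed.

Lemma rV_consr n (p : 'rV[R]_n * measurableTypeR R) (j : 'I_n) :
  rV_cons p 0 (rshift 1 j : 'I_(1 + n)) = p.1 0 j.
Proof. exact: (@row_mxEr R 1 1 n). Qed.

Lemma rV_consl n (p : 'rV[R]_n * measurableTypeR R) (j : 'I_1) :
  rV_cons p 0 (lshift n j : 'I_(1 + n)) = p.2.
Proof. by apply: etrans (@row_mxEl R 1 1 n (const_mx p.2) p.1 0 j) _; rewrite mxE. Qed.

Lemma lebesgue_rV_box_fin n (a b : 'rV[R]_n) : (lebesgue_rV (box a b) < +oo)%E.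
Proof.
elim: n a b => [|n IH] a b.
  by rewrite /= diracE; case: (_ \in _); rewrite ltry.
rewrite /= /pushforward.
pose a' := \row_i a 0 (rshift 1 i); pose b' := \row_i b 0 (rshift 1 i).
rewrite (_ : _ @^-1` _ = box a' b' `*` `]a 0 0, b 0 0[%classic).
  rewrite product_measure1E; [|exact: measurable_box|exact: measurable_itv].
  have E : (@lebesgue_measure R `]a 0%R 0%R, b 0%R 0%R[%classic < +oo)%E.
    by rewrite lebesgue_measure_itv/=; case: ifP => _; rewrite ?ltry// -EFinD ltry.
  apply: lte_mul_pinfty; [exact: measure_ge0| |exact: E].
  by apply/fin_real; rewrite (IH a' b') (lt_le_trans _ (measure_ge0 _ _))// ltNyr.
apply/seteqP; split=> -[x y] /=.
  move=> H; split.
    by move=> i; have := H (rshift 1 i); rewrite rV_consr !mxE.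
  have := H (lshift n (0 : 'I_1) : 'I_(1 + n)); rewrite rV_consl in_itv/=.
  by rewrite (_ : (lshift n (0 : 'I_1) : 'I_(1 + n)) = 0)//; exact: val_inj.
move=> [/= H1]; rewrite in_itv/= => H2 i.
case: (@split_ordP 1 n i) => j ->; rewrite ?rV_consl ?rV_consr.
  by rewrite (ord1 j) (_ : (lshift n (0 : 'I_1) : 'I_(1 + n)) = 0)//; exact: val_inj.
by have := H1 j; rewrite !mxE.
Qed.

End boxes.

Section fundamental_lemma.
Context {R : realType} {n : nat}.
Local Notation mu := (@lebesgue_rV R n).
Implicit Types (a b : 'rV[R]_n).

Lemma lebesgue_rV_sigma_finite : sigma_finite [set: 'rV[R]_n] mu.
Proof.
exists (fun k : nat => box (const_mx (- k%:R)) (const_mx k%:R)).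
  apply/seteqP; split=> // x _.
  have : \forall k \near \oo, forall i, `|x 0 i| < k%:R.
    by apply: filter_forall => i; exact: nbhs_infty_gtr.
  move=> [k _ /(_ k (leqnn k)) H]; exists k => // i.
  by rewrite !mxE -ltr_norml.
by move=> k; split; [exact: measurable_box|exact: lebesgue_rV_box_fin].
Qed.

Lemma coord_smooth (f : R -> R) (i : 'I_n) (c e : R) : smooth f ->
  smooth (fun x : 'rV[R]_n => f (c * x 0 i + e)).
Proof.
move=> sf; apply: (smooth_comp_affine _ _ sf (l := fun x : 'rV[R]_n => c * x 0 i + e)).
  move=> x; apply: (@differentiableD _ _ _ (fun x : 'rV[R]_n => c * x 0 i) (cst e)); last exact: differentiable_cst.
  apply: (@differentiableM _ _ (cst c) (fun x : 'rV[R]_n => x 0 i)).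
    exact: differentiable_cst.
  exact: differentiable_coord.
move=> v; exists (c * v 0 i) => x.
apply: cvg_lim => //.
apply: cvg_near_cst; near=> h.
rewrite /= !mxE /GRing.scale/=.
have h0 : h != 0 by near: h; exact: nbhs_dnbhs_neq.
by apply: (mulfI h0); rewrite mulrA mulfV// mul1r; ring.
Unshelve. all: by end_near. Qed.

(** Products over the coordinates of steps rescaled by $k+1$. Since [S] vanishes up to $-1$, the
    offset $-1$ makes each cut-off vanish outside the open box; it equals 1 where all distances to
    the faces are at least $2/(k+1)$. *)
Lemma box_test a b : exists chi : nat -> 'rV[R]_n -> R,
  [/\ forall k, smooth (chi k) /\ measurable_fun [set: 'rV[R]_n] (chi k),
      forall k x, 0 <= chi k x <= 1,
      forall k x, ~ box a b x -> chi k x = 0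
    & forall x, box a b x -> \forall k \near \oo, chi k x = 1].
Proof.
have [_ [S [_ [[_ sS _] _ _ [S0 S1 S01] _]]]] := @mollifier_exists R.
pose l k i (x : 'rV[R]_n) := S (k.+1%:R * x 0 i + (- (k.+1%:R * a 0 i) - 1)).
pose r k i (x : 'rV[R]_n) := S (- k.+1%:R * x 0 i + (k.+1%:R * b 0 i - 1)).
exists (fun k x => \prod_i (l k i x * r k i x)); split.
- move=> k; split.
    by apply: smooth_prod => i; apply: smoothM; exact: coord_smooth.
  have mS (i : 'I_n) (c e : R) :
      measurable_fun [set: 'rV[R]_n] (fun x => S (c * x 0 i + e)).
    apply: (measurableT_comp (continuous_measurable_fun (smooth_continuous sS))).
    apply: measurable_funD => //; apply: measurable_funM => //.
    exact: measurable_coord.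
  by apply: measurable_prod => i _; apply: measurable_funM; exact: mS.
- move=> k x; elim/big_ind : _; first by rewrite ler01 lexx.
    by move=> u v /andP[? ?] /andP[? ?]; rewrite mulr_ge0//= mulr_ile1.
  move=> i _; have /andP[A1 B1] : 0 <= l k i x <= 1 by exact: S01.
  have /andP[A2 B2] : 0 <= r k i x <= 1 by exact: S01.
  by rewrite mulr_ge0//= mulr_ile1.
- move=> k x /existsNP[i /negP]; rewrite negb_and -!leNgt => H.
  rewrite (bigD1 i)//=.
  have k0 : 0 < k.+1%:R :> R by rewrite ltr0n.
  case/orP: H => H; rewrite /l /r.
    have {}H : k.+1%:R * (x 0 i - a 0 i) <= 0 by rewrite pmulr_rle0// subr_le0.
    by rewrite (S0 (_ + (_ - _)))// ?mul0r//; lra.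
  have {}H : k.+1%:R * (b 0 i - x 0 i) <= 0 by rewrite pmulr_rle0// subr_le0.
  by rewrite (S0 (- _ * _ + _)) ?mulr0 ?mul0r//; lra.
- move=> x xab.
  have : \forall k \near \oo, forall i,
      2 <= k.+1%:R * (x 0 i - a 0 i) /\ 2 <= k.+1%:R * (b 0 i - x 0 i).
    apply: filter_forall => i; have /andP[ai bi] := xab i.
    near=> k; split; rewrite -ler_pdivrMr ?subr_gt0//;
      apply: (@le_trans _ _ k%:R); rewrite ?ler_nat// ltW//;
      near: k; exact: nbhs_infty_gtr.
  apply: filterS => k H; apply: big1 => i _; rewrite /l /r.
  have [H1 H2] := H i.
  by rewrite !S1 ?mulr1//; lra.
Unshelve. all: by end_near. Qed.

Definition quad a : set 'rV[R]_n := [set x | forall i, a 0 i < x 0 i].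

Lemma quad_setI_closed : setI_closed (range quad).
Proof.
move=> _ _ [a _ <-] [b _ <-]; exists (\row_i Num.max (a 0 i) (b 0 i)) => //.
apply/seteqP; split=> x /=.
  by move=> H; split=> i; have := H i; rewrite mxE gt_max => /andP[].
by move=> [H1 H2] i; rewrite mxE gt_max H1 H2.
Qed.

Lemma measurable_quad a : measurable (quad a).
Proof. by apply: measurable_forall => i; exact: measurable_coord_lt. Qed.

Lemma quad_generates : @measurable _ 'rV[R]_n = <<s range quad>>.
Proof.
apply/seteqP; split; last first.
  apply: smallest_sub; first exact: sigma_algebra_measurable.
  by move=> _ [a _ <-]; exact: measurable_quad.
rewrite [X in X `<=` _]/measurable/= /rV_measurable.
apply: smallest_sub; first exact: smallest_sigma_algebra.
rewrite -bigcup_seq; apply: bigcup_sub => i _ B [C mC <-].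
have : measurable_fun [set: g_sigma_algebraType (range quad)]
    (fun x : 'rV[R]_n => x 0 i : measurableTypeR R).
  apply: (measurability _ (RGenOInfty.measurableE R)).
  move=> _ [_ [a ->] <-]; rewrite setTI.
  have -> : (fun x : 'rV[R]_n => x 0 i) @^-1` `]a, +oo[%classic =
     \bigcup_k quad (\row_j if j == i then a else - k%:R).
    apply/seteqP; split=> x /=.
      rewrite in_itv/= andbT => ax.
      have : \forall k \near \oo, forall j, `|x 0 j| < k%:R.
        by apply: filter_forall => j; exact: nbhs_infty_gtr.
      move=> [k _ /(_ k (leqnn k)) H]; exists k => // j; rewrite mxE.
      by case: eqP => [->//|_]; have := H j; rewrite ltr_norml => /andP[].
    by move=> [k _ /(_ i)]; rewrite mxE eqxx in_itv/= andbT.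
  apply: bigcup_measurable => k _.
  by apply: sub_sigma_algebra; exists (\row_j if j == i then a else - k%:R).
by move=> /(_ measurableT C mC).
Qed.

Lemma dotL2_box_eq0 (D : set 'rV[R]_n) (g : 'rV[R]_n -> R) a b :
  L2 D g -> (forall phi, test_function D phi -> dotL2 D g phi = 0) ->
  (forall x : 'rV[R]_n, (forall i, a 0 i <= x 0 i <= b 0 i) -> D x) ->
  mu.-integrable (box a b) (EFin \o (g \_ D)) /\
  (\int[mu]_(x in box a b) (g \_ D x)%:E = 0)%E.
Proof.
move=> gL2 g0 abD.
have mg : measurable_fun [set: 'rV[R]_n] (g \_ D).
  by have := sub_Lfun_mfun gL2; rewrite inE.
have mB := measurable_box a b.
have Bfin := lebesgue_rV_box_fin a b.
have iB : mu.-integrable (box a b) (EFin \o (g \_ D)).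
  (* On a set of finite measure, $|g|\le1+g^2$ turns square integrability into integrability. *)
  have i1 : mu.-integrable (box a b) (EFin \o (fun x => 1 + (g \_ D x) ^+ 2)).
    apply: (@eq_integrable _ _ _ _ _ mB (cst 1%:E \+ (EFin \o (fun x => (g \_ D x) ^+ 2)%R))%E) => //.
    apply: integrableD => //.
      apply: measurable_bounded_integrable => //.
      by exists 1; split=> // M M1 x _; rewrite /= normr1 ltW.
    apply: integrableS (Lfun2_integrable_sqr gL2) => //.
  apply: le_integrable i1 => //.
    by apply/measurable_EFinP; exact: measurable_funTS.
  move=> x _ /=; rewrite lee_fin [leRHS]ger0_norm ?addr_ge0 ?sqr_ge0//.
  have := sqr_ge0 (`|(g \_ D) x| - 1); have := normr_ge0 ((g \_ D) x).
  have := real_normK (num_real ((g \_ D) x)).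
  by set u := `|_|; set v := (g \_ D) x; nra.
split=> //.
have [chi [schi chi01 chi0 chi1]] := box_test a b.
have tchi k : test_function D (chi k).
  split; first by have [] := schi k.
  exists [set x : 'rV[R]_n | forall i, x 0 i \in `[a 0 i, b 0 i]]; split.
  - by apply: (@rV_compact R n (fun i => `[a 0 i, b 0 i]%classic)) => i; exact: segment_compact.
  - by move=> x /= H; apply: abD => i; have := H i; rewrite in_itv.
  - move=> x H; apply: chi0; apply: contra_not H => H i.
    by rewrite in_itv/=; have /andP[/ltW -> /ltW ->] := H i.
have ik k : mu.-integrable (box a b) (fun x => ((g \_ D x) * chi k x)%:E).
  apply: le_integrable iB => //.
    apply/measurable_EFinP; apply: measurable_funM; first exact: measurable_funTS.
    by apply: measurable_funTS; have [] := schi k.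
  move=> x _; rewrite /= lee_fin normrM ler_piMr//.
  by have /andP[c0 c1] := chi01 k x; rewrite ger0_norm.
have I0 k : (\int[mu]_(x in box a b) ((g \_ D x) * chi k x)%:E = 0)%E.
  have := g0 _ (tchi k); rewrite /dotL2 /Rintegral.
  have -> : (\int[mu]_(x in D) (g x * chi k x)%:E =
    \int[mu]_(x in box a b) ((g \_ D x) * chi k x)%:E)%E.
    rewrite [LHS]integral_mkcond [RHS]integral_mkcond; apply: eq_integral => x _.
    rewrite !patchE; case: ifPn => xD; case: ifPn => xB //.
      by rewrite chi0 ?mulr0//; move: xB; rewrite notin_setE.
    by rewrite mul0r.
  by move=> E; rewrite -(fineK (integrable_fin_num mB (ik k))) E.
have H : (\int[mu]_(x in box a b) ((g \_ D x) * chi k x)%:E @[k --> \oo] -->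
    \int[mu]_(x in box a b) (g \_ D x)%:E)%E.
  apply: (@dominated_cvg _ _ _ mu _ mB
    (fun k x => ((g \_ D x) * chi k x)%:E) (EFin \o (g \_ D)) (fun x => `|g \_ D x|%:E)).
  - by move=> k; case/integrableP: (ik k).
  - move=> x xB; apply: cvg_near_cst.
    by apply: filterS (chi1 x xB) => k /= ->; rewrite mulr1.
  - by [].
  - exact: (integrable_abse iB).
  - move=> k x _; rewrite /= lee_fin normrM ler_piMr//.
    by have /andP[c0 c1] := chi01 k x; rewrite ger0_norm.
move/cvg_lim : H => <- //.
by under eq_fun do rewrite I0; rewrite lim_cst.
Qed.

(** Dynkin's theorem: the orthants [quad] form a generating system stable under intersection, and
    they cut a box in a box. So the integral of [g] vanishes on all measurable parts of the box. *)
Lemma box_ae_eq0 (D : set 'rV[R]_n) (g : 'rV[R]_n -> R) a b :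
  L2 D g -> (forall phi, test_function D phi -> dotL2 D g phi = 0) ->
  (forall x : 'rV[R]_n, (forall i, a 0 i <= x 0 i <= b 0 i) -> D x) ->
  mu.-negligible (box a b `&` [set x | g x != 0]).
Proof.
move=> gL2 g0 abD.
have [iB B0] := dotL2_box_eq0 gL2 g0 abD.
have mB := measurable_box a b.
pose h := (EFin \o (g \_ D)) \_ (box a b).
have ih := (integrable_mkcond (EFin \o (g \_ D)) mB).1 iB.
have hI A : measurable A ->
    (\int[mu]_(x in A) h x = \int[mu]_(x in A `&` box a b) (g \_ D x)%:E)%E.
  by move=> mA; rewrite integral_mkcondr.
have h0 A : measurable A -> (\int[mu]_(x in A) h x = 0)%E.
  move=> mA; move: (mA); rewrite quad_generates => sA.
  apply: (dynkin_induction (G := range quad)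
    (P := fun A => (\int[mu]_(x in A) h x = 0)%E) quad_generates quad_setI_closed) sA.
  - by rewrite hI// setTI.
  - move=> _ [c _ <-]; rewrite hI; last exact: measurable_quad.
    rewrite (_ : _ `&` _ = box (\row_i Num.max (c 0 i) (a 0 i)) b).
      apply: (dotL2_box_eq0 gL2 g0 _).2 => x H; apply: abD => i.
      by have := H i; rewrite mxE ge_max -andbA => /and3P[_ -> ->].
    apply/seteqP; split=> x /=.
      by move=> [H1 H2] i; rewrite mxE gt_max H1; exact: H2.
    by move=> H; split=> i; have := H i; rewrite mxE gt_max -andbA => /and3P[? ? ?] //; apply/andP.
  - move=> S mS S0.
    have := @integral_setU _ _ _ mu S (~` S) h mS (measurableC mS).
    rewrite setUv S0 add0e => <-; last 2 first.
    + by case/integrableP: ih.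
    + by apply/disj_setPS; rewrite setICr.
    by rewrite hI// setTI.
  - move=> F mF tF F0.
    rewrite integral_bigcup//; last first.
      by apply: integrableS ih => //; exact: bigcup_measurable.
    by rewrite eseries0// => i _ _.
have : ae_eq mu setT h (cst 0%E).
  apply: integral_ae_eq => // E _ mE.
  by rewrite h0// integral0.
rewrite /ae_eq /almost_everywhere /=; apply: negligibleS => x /= [xB gx] /(_ I).
rewrite /h patchE mem_set//= patchE mem_set; last by apply: abD => i; have /andP[/ltW -> /ltW ->] := xB i.
by move=> [] /eqP; apply/negP.
Qed.

(** [D] is a countable union of boxes with rational corners and closure in [D], and [g] vanishes
    almost everywhere on each of them. *)
Lemma fundamental_lemma (D : set 'rV[R]_n) (g : 'rV[R]_n -> R) :
  open D -> L2 D g -> (forall phi, test_function D phi -> dotL2 D g phi = 0) ->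
  ae_on D (fun x => g x = 0).
Proof.
move=> oD gL2 g0.
pose ra (q : 'rV[rat]_n) : 'rV[R]_n := map_mx ratr q.
pose F (k : nat) := if unpickle k is Some (q, r) then
  if `[< forall x : 'rV[R]_n, (forall i, ra q 0 i <= x 0 i <= ra r 0 i) -> D x >]
  then box (ra q) (ra r) `&` [set x | g x != 0] else set0 else set0.
have nF k : mu.-negligible (F k).
  rewrite /F; case: unpickle => [[q r]|]; last exact: negligible_set0.
  case: asboolP => [H|_]; last exact: negligible_set0.
  exact: box_ae_eq0 gL2 g0 H.
apply: negligibleS (negligible_bigcup nF) => x /= /not_implyP[xD /eqP gx].
have /nbhs_ballP[e /= e0 xe] : nbhs x D by apply: open_nbhs_nbhs.
have /choice[q Hq] : forall i, exists q : rat, ratr q \in `]x 0 i - e, x 0 i[.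
  by move=> i; apply: rat_in_itvoo; rewrite ltrBlDr ltrDl.
have /choice[r Hr] : forall i, exists q : rat, ratr q \in `]x 0 i, x 0 i + e[.
  by move=> i; apply: rat_in_itvoo; rewrite ltrDl.
exists (pickle (\row_i q i, \row_i r i)) => //; rewrite /F pickleK.
case: asboolP => [_|[]].
  split=> // i; rewrite !mxE; have := Hq i; have := Hr i; rewrite !in_itv/=.
  by move=> /andP[-> _] /andP[_ ->].
move=> y Hy; apply: xe; split=> // i j; rewrite (ord1 i).
have := Hq j; have := Hr j; have := Hy j; rewrite !in_itv/= !mxE.
move=> /andP[? ?] /andP[? ?] /andP[? ?].
by rewrite /ball/= ltr_norml; apply/andP; split; lra.
Qed.

End fundamental_lemma.

(** * The spaces L^2 and H^1 *)

Section L2_generic.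
Context d {T : measurableType d} {R : realType} {mu : {measure set T -> \bar R}}.
Implicit Types f g h : T -> R.

Lemma Lfun2P f : f \in Lfun mu 2%:E <->
  measurable_fun setT f /\ mu.-integrable setT (EFin \o (fun x => f x ^+ 2)).
Proof.
split=> [Lf|[mf /integrableP[_ If]]].
  by split; [have := sub_Lfun_mfun Lf; rewrite inE|exact: Lfun2_integrable_sqr].
rewrite inE; apply/andP; split; first by rewrite inE.
rewrite inE/= /finite_norm unlock.
apply: poweR_lty; apply: le_lt_trans If.
rewrite le_eqVlt; apply/orP; left; apply/eqP; apply: eq_integral => x _ /=.
by rewrite powR_mulrn// real_normK ?num_real// ger0_norm ?sqr_ge0.
Qed.

Lemma Lfun2_lin (a : R) f g : f \in Lfun mu 2%:E -> g \in Lfun mu 2%:E ->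
  (fun x => a * f x + g x) \in Lfun mu 2%:E.
Proof.
move=> Lf Lg; have := (@Lfun_submod_closed _ _ _ mu 2%:E (lee1n 2)).2 a f g Lf Lg.
by [].
Qed.

Lemma Lfun2_mul_integrable f g : f \in Lfun mu 2%:E -> g \in Lfun mu 2%:E ->
  mu.-integrable setT (EFin \o (fun x => f x * g x)).
Proof. by move=> Lf Lg; apply/Lfun1_integrable; exact: Lfun2_mul_Lfun1. Qed.

Lemma Rintegral_lin (a : R) f g : mu.-integrable setT (EFin \o f) ->
  mu.-integrable setT (EFin \o g) ->
  \int[mu]_x (a * f x + g x) = a * \int[mu]_x f x + \int[mu]_x g x.
Proof.
move=> If Ig; rewrite RintegralD//; last first.
  exact: (integrableZl measurableT a If).
by rewrite RintegralZl.
Qed.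

Lemma Rintegral_ae f g : measurable_fun setT f -> measurable_fun setT g ->
  (\forall x \ae mu, f x = g x) -> \int[mu]_x f x = \int[mu]_x g x.
Proof.
move=> mf mg fg; congr fine; apply: ae_eq_integral => //.
- exact/measurable_EFinP.
- exact/measurable_EFinP.
by apply: filterS fg => x /= -> _.
Qed.

Lemma Lfun2_bounded_mul (k f : T -> R) (M : R) : measurable_fun setT k ->
  (\forall x \ae mu, `|k x| <= M) -> f \in Lfun mu 2%:E ->
  (fun x => k x * f x) \in Lfun mu 2%:E.
Proof.
move=> mk kM /Lfun2P[mf If]; apply/Lfun2P; split; first exact: measurable_funM.
have mkf : measurable_fun setT (fun x => (k x * f x) ^+ 2).
  by apply: measurable_funX; exact: measurable_funM.
apply/integrableP; split; first exact/measurable_EFinP.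
have /integrableP[_] := integrableZl measurableT (M ^+ 2) If.
apply: le_lt_trans; apply: ae_ge0_le_integral => //.
- by apply: measurableT_comp => //; exact/measurable_EFinP.
- apply: measurableT_comp => //; apply: measurable_funeM.
  by apply/measurable_EFinP; exact: measurable_funX.
apply: filterS kM => x kM _ /=; rewrite lee_fin ger0_norm ?sqr_ge0// ger0_norm; last first.
  by rewrite mulr_ge0 ?sqr_ge0.
rewrite exprMn ler_wpM2r ?sqr_ge0// -[leLHS]real_normK ?num_real//.
by rewrite lerXn2r// nnegrE// (le_trans _ kM).
Qed.

End L2_generic.

Section test_functions_L2.
Context {R : realType} {n : nat}.
Local Notation mu := (@lebesgue_rV R n).

Lemma open_measurable_rV (U : set 'rV[R]_n) : open U -> measurable U.
Proof.
move=> oU; pose ra (q : 'rV[rat]_n) : 'rV[R]_n := map_mx ratr q.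
pose F (k : nat) := if unpickle k is Some (q, r) then
  if `[< box (ra q) (ra r) `<=` U >] then box (ra q) (ra r) else set0 else set0.
rewrite (_ : U = \bigcup_k F k).
  apply: bigcup_measurable => k _; rewrite /F.
  case: unpickle => [[q r]|//]; case: asboolP => // _; exact: measurable_box.
apply/seteqP; split=> [x Ux|x [k _]]; last first.
  by rewrite /F; case: unpickle => [[q r]|//]; case: asboolP => // H /H.
have /nbhs_ballP[e /= e0 xe] : nbhs x U by apply: open_nbhs_nbhs.
have /choice[q Hq] : forall i, exists q : rat, ratr q \in `]x 0 i - e, x 0 i[.
  by move=> i; apply: rat_in_itvoo; rewrite ltrBlDr ltrDl.
have /choice[r Hr] : forall i, exists q : rat, ratr q \in `]x 0 i, x 0 i + e[.
  by move=> i; apply: rat_in_itvoo; rewrite ltrDl.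
exists (pickle (\row_i q i, \row_i r i)) => //; rewrite /F pickleK.
case: asboolP => [_|[]].
  move=> i; rewrite !mxE; have := Hq i; have := Hr i; rewrite !in_itv/=.
  by move=> /andP[-> _] /andP[_ ->].
move=> y Hy; apply: xe; split=> // i j; rewrite (ord1 i).
have := Hq j; have := Hr j; have := Hy j; rewrite !in_itv/= !mxE.
move=> /andP[? ?] /andP[? ?] /andP[? ?].
by rewrite /ball/= ltr_norml; apply/andP; split; lra.
Qed.

Lemma continuous_measurable_rV (f : 'rV[R]_n -> R) :
  continuous f -> measurable_fun setT f.
Proof.
move=> /continuousP cf; apply: (measurability _ (RGenOInfty.measurableE R)).
move=> _ [_ [a ->] <-]; rewrite setTI; apply: open_measurable_rV.
by apply: cf; exact: interval_open.
Qed.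

Context (D : set 'rV[R]_n).

Lemma test_function_L2 (phi : 'rV[R]_n -> R) : open D -> test_function D phi ->
  L2 D phi.
Proof.
move=> oD [sphi [K [cK KD K0]]].
have cphi : continuous phi.
  by move=> x; apply: differentiable_continuous; exact: smooth_differentiable.
have mphi := continuous_measurable_rV cphi.
rewrite /L2; have -> : phi \_ D = phi.
  apply/funext => x; rewrite patchE; case: ifPn => //; rewrite notin_setE => xD.
  by rewrite K0// => /KD.
apply/Lfun2P; split => //.
have bnd (f : 'rV[R]_n -> R) : continuous f ->
    exists2 N : R, 0 < N & forall x, K x -> `|f x| <= N.
  move=> cf; have : compact (f @` K).
    by apply: continuous_compact => //; exact: continuous_subspaceT.
  move=> /compact_bounded /pinfty_ex_gt0[N N0 HN]; exists N => // x Kx.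
  by apply: HN; exists x.
have /choice[M HM] : forall i : 'I_n, exists N : R, forall x, K x -> `|x 0 i| <= N.
  by move=> i; have [N _ HN] := bnd _ (@coord_continuous _ 1 n 0 i); exists N.
pose a : 'rV[R]_n := \row_i (- (M i + 1)); pose b : 'rV[R]_n := \row_i (M i + 1).
have Kab : K `<=` box a b.
  by move=> x Kx i; rewrite !mxE -ltr_norml (le_lt_trans (HM i x Kx))// ltrDl.
have [N N0 HN] := bnd _ cphi.
(* The function is bounded by [N] and its support lies in a box, so its square is dominated by $N^2$
   times the indicator of that box. *)
apply: (eq_integrable measurableT
  (fun x => ((N ^+ 2)%:E * (\1_(box a b) x * ((phi x / N) ^+ 2))%:E)%E)).
  move=> x _ /=; have [Kx|Kx] := pselect (K x); last first.
    by rewrite K0// mul0r !expr0n/= mulr0 mule0.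
  rewrite indicE mem_set; last exact: Kab.
  by rewrite mul1r -EFinM expr_div_n mulrC divfK// expf_neq0// gt_eqF.
apply: integrableZl => //.
apply: (@le_integrable _ _ _ _ _ measurableT _ (EFin \o \1_(box a b))).
- apply/measurable_EFinP; apply: measurable_funM.
    by apply: measurable_indic; exact: measurable_box.
  by apply: measurable_funX; apply: measurable_funM.
- move=> x _; rewrite /= lee_fin normrM; have [Kx|Kx] := pselect (K x); last first.
    by rewrite K0// mul0r expr0n/= normr0 mulr0.
  rewrite ler_piMr// ger0_norm ?sqr_ge0// expr_div_n ler_pdivrMr ?exprn_gt0// mul1r.
  by rewrite -[leLHS]real_normK ?num_real// lerXn2r ?nnegrE ?(ltW N0)// HN.
- apply/integrableP; split.
    by apply/measurable_EFinP; apply: measurable_indic; exact: measurable_box.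
  rewrite (eq_integral (fun x => (\1_(box a b) x)%:E)); last first.
    by move=> t _; rewrite gee0_abs// lee_fin.
  rewrite integral_indic//; last exact: measurable_box.
  by rewrite setIT; exact: lebesgue_rV_box_fin.
Qed.

Lemma test_function_derive (phi : 'rV[R]_n -> R) v : test_function D phi ->
  test_function D ('D_v phi).
Proof.
move=> [sphi [K [cK KD K0]]]; split; first exact: smooth_derive.
exists K; split=> // x Kx.
have cK' : closed K by apply: compact_closed => //; exact: norm_hausdorff.
rewrite (@near_eq_derive _ _ _ _ (cst 0) x v) ?derive_cst//.
near=> y; apply: K0; near: y.
by apply: open_nbhs_nbhs; split=> //; exact: closed_openC.
Unshelve. all: by end_near. Qed.

End test_functions_L2.

Section H1_structure.
Context {R : realType} {n : nat} (D : set 'rV[R]_n).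
Local Notation mu := (@lebesgue_rV R n).
Implicit Types f g h : 'rV[R]_n -> R.

Lemma restrict_lin (a : R) f g :
  (fun x => a * f x + g x) \_ D = (fun x => a * (f \_ D) x + (g \_ D) x).
Proof. by apply/funext => x; rewrite !patchE; case: ifP; rewrite ?mulr0 ?addr0. Qed.

Lemma restrict_mul f g : (fun x => f x * g x) \_ D = (fun x => (f \_ D) x * (g \_ D) x).
Proof. by apply/funext => x; rewrite !patchE; case: ifP; rewrite ?mulr0. Qed.

Lemma L2_lin (a : R) f g : L2 D f -> L2 D g -> L2 D (fun x => a * f x + g x).
Proof. by rewrite /L2 restrict_lin; exact: Lfun2_lin. Qed.

Lemma L2_0 : L2 D (cst 0).
Proof.
rewrite /L2; apply/Lfun2P; rewrite (_ : _ \_ _ = cst 0); last first.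
  by apply/funext => x; rewrite patchE; case: ifP.
split=> //; apply: (eq_integrable measurableT (cst 0%E)); last exact: integrable0.
by move=> x _ /=; rewrite expr0n.
Qed.

Lemma dotL2E f g : dotL2 D f g = \int[mu]_x ((f \_ D) x * (g \_ D) x).
Proof. by rewrite /dotL2 Rintegral_mkcond restrict_mul. Qed.

Lemma dotL2C f g : dotL2 D f g = dotL2 D g f.
Proof. by apply: eq_Rintegral => x _; rewrite mulrC. Qed.

Lemma dotL2_linl (a : R) f g h : L2 D f -> L2 D g -> L2 D h ->
  dotL2 D (fun x => a * f x + g x) h = a * dotL2 D f h + dotL2 D g h.
Proof.
move=> Lf Lg Lh; rewrite !dotL2E restrict_lin -Rintegral_lin;
  [|exact: Lfun2_mul_integrable..].
by apply: eq_Rintegral => x _; rewrite mulrDl mulrA.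
Qed.

Lemma dotL2_linr (a : R) f g h : L2 D f -> L2 D g -> L2 D h ->
  dotL2 D h (fun x => a * f x + g x) = a * dotL2 D h f + dotL2 D h g.
Proof. by move=> Lf Lg Lh; rewrite dotL2C dotL2_linl// ![dotL2 D h _]dotL2C. Qed.

Lemma L2_measurable f : L2 D f -> measurable_fun setT (f \_ D).
Proof. by move=> /Lfun2P[]. Qed.

Lemma ae_onS (P : 'rV[R]_n -> Prop) (Q : 'rV[R]_n -> Prop) :
  (forall x, (D x -> P x) -> Q x) -> ae_on D P -> \forall x \ae mu, Q x.
Proof. by move=> PQ; rewrite /ae_on; exact: filterS. Qed.

Lemma ae_onI (P : 'rV[R]_n -> Prop) (Q : 'rV[R]_n -> Prop) :
  (forall x, Q x -> D x -> P x) -> (\forall x \ae mu, Q x) -> ae_on D P.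
Proof. by move=> QP; rewrite /ae_on; exact: filterS. Qed.

Lemma ae_on_restrict f g : ae_on D (fun x => f x = g x) ->
  \forall x \ae mu, (f \_ D) x = (g \_ D) x.
Proof.
apply: ae_onS => x H; rewrite !patchE; case: ifPn => //; rewrite inE; exact: H.
Qed.

Lemma dotL2_ae f f' g : L2 D f -> L2 D f' -> L2 D g ->
  ae_on D (fun x => f x = f' x) -> dotL2 D f g = dotL2 D f' g.
Proof.
move=> Lf Lf' Lg /ae_on_restrict ff'; rewrite !dotL2E; apply: Rintegral_ae.
- by apply: measurable_funM; exact: L2_measurable.
- by apply: measurable_funM; exact: L2_measurable.
by apply: filterS ff' => x ->.
Qed.

Lemma dotL2_ge0 f : 0 <= dotL2 D f f.
Proof. by rewrite /dotL2; apply: Rintegral_ge0 => x _; rewrite -expr2 sqr_ge0. Qed.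

Lemma dotL2_eq0_ae f : L2 D f -> dotL2 D f f = 0 -> ae_on D (fun x => f x = 0).
Proof.
move=> Lf; rewrite dotL2E /Rintegral => f0.
have I := Lfun2_mul_integrable Lf Lf.
have : (\int[mu]_x `| ((f \_ D) x * (f \_ D) x)%:E| = 0)%E.
  rewrite (eq_integral (fun x => ((f \_ D) x * (f \_ D) x)%:E)); last first.
    by move=> x _; rewrite gee0_abs// lee_fin -expr2 sqr_ge0.
  by rewrite -(fineK (integrable_fin_num measurableT I)) f0.
move/ae_eq_integral_abs => /(_ measurableT).
have mf : measurable_fun setT (fun x => ((f \_ D) x * (f \_ D) x)%:E).
  by case/integrableP: I.
move=> /(_ mf); apply: filterS => x /(_ Logic.I) [] /eqP; rewrite mulf_eq0 orbb => /eqP + xD.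
by rewrite patchE mem_set.
Qed.

Hint Resolve L2_lin : core.

Lemma weak_partial_lin (a : R) (i : 'I_n) f f' g g' : open D ->
  L2 D f -> L2 D f' -> L2 D g -> L2 D g' ->
  weak_partial D i f f' -> weak_partial D i g g' ->
  weak_partial D i (fun x => a * f x + g x) (fun x => a * f' x + g' x).
Proof.
move=> oD Lf Lf' Lg Lg' Wf Wg phi tphi.
have Lphi := test_function_L2 oD tphi.
have Ld := test_function_L2 oD (test_function_derive (delta_mx 0 i) tphi).
by rewrite !dotL2_linl// Wf// Wg// mulrN opprD.
Qed.

Lemma weak_partial_unique (i : 'I_n) f g g' : open D -> L2 D g -> L2 D g' ->
  weak_partial D i f g -> weak_partial D i f g' -> ae_on D (fun x => g x = g' x).
Proof.
move=> oD Lg Lg' W W'.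
have : ae_on D (fun x => - 1 * g' x + g x = 0).
  apply: fundamental_lemma => //; first exact: L2_lin.
  move=> phi tphi; have Lphi := test_function_L2 oD tphi.
  rewrite dotL2_linl// mulN1r; have := W _ tphi; rewrite W'//.
  by move=> /oppr_inj ->; rewrite addNr.
apply: ae_onS => x H /H /eqP; rewrite mulN1r addrC subr_eq0 => /eqP; exact.
Qed.

Lemma wpartialP (i : 'I_n) f : H1 D f ->
  L2 D (wpartial D i f) /\ weak_partial D i f (wpartial D i f).
Proof.
move=> [_ /(_ i)[g Lg Wg]].
by apply: (@xgetPex _ _ [set g | L2 D g /\ weak_partial D i f g]); exists g.
Qed.

Lemma wpartial_L2 (i : 'I_n) f : H1 D f -> L2 D (wpartial D i f).
Proof. by move=> /(wpartialP i)[]. Qed.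

Lemma H1_L2 f : H1 D f -> L2 D f. Proof. by case. Qed.

Lemma H1_lin (a : R) f g : open D -> H1 D f -> H1 D g ->
  H1 D (fun x => a * f x + g x).
Proof.
move=> oD Hf Hg; split; first by apply: L2_lin; exact: H1_L2.
move=> i; have [Lf Wf] := wpartialP i Hf; have [Lg Wg] := wpartialP i Hg.
exists (fun x => a * wpartial D i f x + wpartial D i g x); first exact: L2_lin.
by apply: weak_partial_lin => //; exact: H1_L2.
Qed.

Lemma H1_0 : H1 D (cst 0).
Proof.
split=> [|i]; first exact: L2_0.
exists (cst 0); first exact: L2_0.
move=> phi _; rewrite /dotL2; under eq_Rintegral do rewrite mul0r.
under [in RHS]eq_Rintegral do rewrite mul0r.
by rewrite Rintegral_mkcond (_ : _ \_ _ = cst 0) ?oppr0 /Rintegral ?integral0 ?oppr0//;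
  apply/funext => x; rewrite patchE; case: ifP.
Qed.

(** [wpartial] picks an arbitrary representative, so linearity can only hold almost everywhere: both
    sides are weak derivatives of the same function, and these are unique. *)
Lemma wpartial_lin (i : 'I_n) (a : R) f g : open D -> H1 D f -> H1 D g ->
  ae_on D (fun x => wpartial D i (fun x => a * f x + g x) x =
                    a * wpartial D i f x + wpartial D i g x).
Proof.
move=> oD Hf Hg.
have [Lf Wf] := wpartialP i Hf; have [Lg Wg] := wpartialP i Hg.
have [L W] := wpartialP i (H1_lin a oD Hf Hg).
apply: (weak_partial_unique oD L (L2_lin a Lf Lg) W).
by apply: weak_partial_lin => //; exact: H1_L2.
Qed.

Lemma wpartial_ae (i : 'I_n) f g : open D -> H1 D f -> H1 D g ->
  ae_on D (fun x => f x = g x) ->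
  ae_on D (fun x => wpartial D i f x = wpartial D i g x).
Proof.
move=> oD Hf Hg fg; have [Lf Wf] := wpartialP i Hf; have [Lg Wg] := wpartialP i Hg.
apply: (weak_partial_unique oD Lf Lg Wf) => phi tphi.
rewrite -(Wg _ tphi); apply: dotL2_ae fg; [exact: H1_L2|exact: H1_L2|].
exact: test_function_L2 (test_function_derive _ tphi).
Qed.

Lemma Linfty_norm_ae (k : 'rV[R]_n -> R) :
  \forall x \ae mu, (`|(k \_ D) x|%:E <= Linfty_norm D k)%E.
Proof.
(* The norm is defined by cases on whether the whole space has positive measure; in the other case
   every property holds almost everywhere. *)
rewrite /Linfty_norm unlock; case: ifPn => mu0; first exact: ess_sup_ge.
exists setT; split=> //; apply/eqP; move: mu0.
by rewrite lt_neqAle measure_ge0 andbT negbK eq_sym.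
Qed.

Lemma Linfty_measurable (k : 'rV[R]_n -> R) : Linfty D k -> measurable_fun setT (k \_ D).
Proof. by move=> /sub_Lfun_mfun; rewrite inE. Qed.

Lemma Linfty_bound (k : 'rV[R]_n -> R) : Linfty D k ->
  exists M, \forall x \ae mu, `|(k \_ D) x| <= M.
Proof.
move=> /sub_Lfun_finLfun; rewrite inE/= => kfin.
have k0 : (0 <= Linfty_norm D k)%E by exact: Lnorm_ge0.
have kf : Linfty_norm D k \is a fin_num by rewrite ge0_fin_numE.
exists (fine (Linfty_norm D k)).
by apply: filterS (Linfty_norm_ae k) => x; rewrite -lee_fin fineK.
Qed.

Lemma L2_Linfty_mul (k f : 'rV[R]_n -> R) : Linfty D k -> L2 D f ->
  L2 D (fun x => k x * f x).
Proof.
move=> Lk Lf; rewrite /L2 restrict_mul; have [M kM] := Linfty_bound Lk.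
by apply: Lfun2_bounded_mul kM Lf; exact: Linfty_measurable.
Qed.

(** The form $(\nabla f,k\nabla g)_{L^2(D)}$ of the weak formulation. *)
Definition Aform (k f g : 'rV[R]_n -> R) : R :=
  \sum_i dotL2 D (wpartial D i f) (fun x => k x * wpartial D i g x).

Lemma AformC k f g : Aform k f g = Aform k g f.
Proof.
apply: eq_bigr => i _; apply: eq_Rintegral => x _; ring.
Qed.

Lemma Aform_lin (a : R) k f g h : open D -> Linfty D k ->
  H1 D f -> H1 D g -> H1 D h ->
  Aform k (fun x => a * f x + g x) h = a * Aform k f h + Aform k g h.
Proof.
move=> oD Lk Hf Hg Hh; rewrite /Aform mulr_sumr -big_split/=; apply: eq_bigr => i _.
have Lf := wpartial_L2 i Hf; have Lg := wpartial_L2 i Hg.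
have Lh := L2_Linfty_mul Lk (wpartial_L2 i Hh).
have <- := dotL2_linl a Lf Lg Lh.
refine (dotL2_ae _ _ Lh _).
- by apply: wpartial_L2; exact: H1_lin.
- exact: L2_lin.
- exact: wpartial_lin.
Qed.

Lemma Aform_linK (a : R) k k' f : Linfty D k -> Linfty D k' -> H1 D f -> forall g, H1 D g ->
  Aform (fun x => a * k x + k' x) f g = a * Aform k f g + Aform k' f g.
Proof.
move=> Lk Lk' Hf g Hg; rewrite /Aform mulr_sumr -big_split/=; apply: eq_bigr => i _.
have Lf := wpartial_L2 i Hf; have Lg := wpartial_L2 i Hg.
rewrite -dotL2_linr//; [|exact: L2_Linfty_mul..].
by apply: eq_Rintegral => x _; ring.
Qed.

Lemma dotL2_le f f' g g' : L2 D f -> L2 D f' -> L2 D g -> L2 D g' ->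
  ae_on D (fun x => f x * g x <= f' x * g' x) -> dotL2 D f g <= dotL2 D f' g'.
Proof.
move=> Lf Lf' Lg Lg' H; rewrite !dotL2E.
have I := Lfun2_mul_integrable Lf Lg; have I' := Lfun2_mul_integrable Lf' Lg'.
rewrite -subr_ge0 -RintegralB//.
pose k x := (f' \_ D) x * (g' \_ D) x - (f \_ D) x * (g \_ D) x.
have mk : measurable_fun setT k.
  by apply: measurable_funB; apply: measurable_funM; exact: L2_measurable.
(* The difference is nonnegative only almost everywhere; truncating it at 0 makes it so everywhere
   without changing the integral. *)
rewrite (@Rintegral_ae _ _ _ _ _ (fun x => Num.max (k x) 0))//.
- by apply: Rintegral_ge0 => x _; rewrite le_max lexx orbT.
- exact: measurable_maxr.
apply: ae_onS H => x H; rewrite /k !patchE; case: ifPn => [|_].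
  by rewrite inE => /H; rewrite -subr_ge0 => /max_idPl.
by rewrite !mul0r subrr maxxx.
Qed.

Lemma Aform_le k k' f : Linfty D k -> Linfty D k' -> H1 D f ->
  ae_on D (fun x => k x <= k' x) -> Aform k f f <= Aform k' f f.
Proof.
move=> Lk Lk' Hf kk'; apply: ler_sum => i _.
have Lf := wpartial_L2 i Hf.
apply: dotL2_le => //; [exact: L2_Linfty_mul..|].
apply: ae_onS kk' => x H /H kx.
by rewrite mulrCA [leRHS]mulrCA ler_wpM2r// -expr2 sqr_ge0.
Qed.

Lemma dotH1E f g : dotH1 D f g = dotL2 D f g + Aform (cst 1) f g.
Proof.
rewrite /dotH1; congr (_ + _); apply: eq_bigr => i _; apply: eq_Rintegral => x _.
by rewrite mul1r.
Qed.

Lemma Linfty_intro (k : 'rV[R]_n -> R) (M : R) : measurable_fun setT (k \_ D) ->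
  (\forall x \ae mu, `|(k \_ D) x| <= M) -> Linfty D k /\ (Linfty_norm D k <= (Num.max M 0)%:E)%E.
Proof.
move=> mk kM; have H : (Linfty_norm D k <= (Num.max M 0)%:E)%E.
  rewrite /Linfty_norm unlock; case: ifPn => _; last by rewrite lee_fin le_max lexx orbT.
  by apply/ess_supP; apply: filterS kM => x kx /=; rewrite lee_fin le_max kx.
split=> //; rewrite /Linfty inE; apply/andP; split; first by rewrite inE.
by rewrite inE/= /finite_norm; apply: le_lt_trans H _; rewrite ltry.
Qed.

Lemma Linfty_cst (c : R) : open D -> Linfty D (cst c).
Proof.
move=> oD.
have mc : measurable_fun setT ((cst c : 'rV[R]_n -> R) \_ D).
  by apply/(measurable_restrictT (cst c : 'rV[R]_n -> R) (open_measurable_rV oD)).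
apply: (Linfty_intro (M := `|c|) mc _).1.
by apply: nearW => x; rewrite patchE; case: ifP => //; rewrite normr0.
Qed.

Lemma Linfty_lin (a : R) (k k' : 'rV[R]_n -> R) :
  Linfty D k -> Linfty D k' -> Linfty D (fun x => a * k x + k' x).
Proof.
move=> Lk Lk'; have [M kM] := Linfty_bound Lk; have [M' kM'] := Linfty_bound Lk'.
have mk : measurable_fun setT ((fun x => a * k x + k' x) \_ D).
  rewrite restrict_lin; apply: measurable_funD; last exact: Linfty_measurable.
  by apply: measurable_funM => //; exact: Linfty_measurable.
apply: (Linfty_intro (M := `|a| * M + M') mk _).1; rewrite restrict_lin.
apply: filterS2 kM kM' => x H H'; apply: le_trans (ler_normD _ _) _.
by rewrite normrM lerD// ler_wpM2l.
Qed.

Lemma Aform_bound k f (M : R) : open D -> Linfty D k -> H1 D f ->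
  (Linfty_norm D k <= M%:E)%E -> `|Aform k f f| <= M * Aform (cst 1) f f.
Proof.
move=> oD Lk Hf kM.
have H : ae_on D (fun x => `|k x| <= M).
  apply: (ae_onI _ (Linfty_norm_ae k)) => x + xD; rewrite patchE mem_set// => kx.
  by rewrite -lee_fin (le_trans kx).
have E (c : R) : Aform (cst c) f f = c * Aform (cst 1) f f.
  rewrite /Aform mulr_sumr; apply: eq_bigr => i _; have Lf := wpartial_L2 i Hf.
  have := dotL2_linr c (L2_Linfty_mul (Linfty_cst 1 oD) Lf) L2_0 Lf.
  rewrite {2}/dotL2; under [X in _ + X]eq_Rintegral do rewrite mulr0.
  rewrite [X in _ + X]/Rintegral integral0 addr0 => <-.
  by apply: eq_Rintegral => x _ /=; ring.
rewrite ler_norml -mulNr -!E; apply/andP; split; apply: Aform_le => //;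
  try exact: Linfty_cst; apply: ae_onS H => x H /H; rewrite ler_norml => /andP[] //.
Qed.

End H1_structure.

(** * Discrete energy estimates *)

Section bilinear_forms.
Context {R : realType} {X : lmodType R}.
Implicit Types (b s m : X -> X -> R) (x y z w : X).

Definition bilin b := (forall x y, b x y = b y x) /\
  (forall (a : R) x y z, b (a *: x + y) z = a * b x z + b y z).

Lemma bilinC b x y : bilin b -> b x y = b y x. Proof. by move=> [bC _]. Qed.

Lemma bilinDl b x y z : bilin b -> b (x + y) z = b x z + b y z.
Proof. by move=> [_ bl]; rewrite -[x]scale1r bl mul1r scale1r. Qed.

Lemma bilin0l b z : bilin b -> b 0 z = 0.
Proof. by move=> bb; apply: (addrI (b 0 z)); rewrite -bilinDl// !addr0. Qed.

Lemma bilinZl b a x z : bilin b -> b (a *: x) z = a * b x z.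
Proof. by move=> bb; have [_ bl] := bb; rewrite -[a *: x]addr0 bl bilin0l// addr0. Qed.

Lemma bilinNl b x z : bilin b -> b (- x) z = - b x z.
Proof. by move=> bb; rewrite -scaleN1r bilinZl// mulN1r. Qed.

Lemma bilinBl b x y z : bilin b -> b (x - y) z = b x z - b y z.
Proof. by move=> bb; rewrite bilinDl// bilinNl. Qed.

Lemma bilinDr b x y z : bilin b -> b z (x + y) = b z x + b z y.
Proof. by move=> bb; rewrite bilinC// bilinDl// !(bilinC z). Qed.

Lemma bilinZr b a x z : bilin b -> b z (a *: x) = a * b z x.
Proof. by move=> bb; rewrite bilinC// bilinZl// !(bilinC z). Qed.

Lemma bilinNr b x z : bilin b -> b z (- x) = - b z x.
Proof. by move=> bb; rewrite bilinC// bilinNl// !(bilinC z). Qed.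

Lemma bilinBr b x y z : bilin b -> b z (x - y) = b z x - b z y.
Proof. by move=> bb; rewrite bilinDr// bilinNr. Qed.

Definition bilinE := (bilinDl, bilinDr, bilinNl, bilinNr, bilinZl, bilinZr).

Lemma bilin_lin (a : R) b b' : bilin b -> bilin b' -> bilin (fun x y => a * b x y + b' x y).
Proof.
move=> [bC bl] [bC' bl']; split=> [x y|k x y z]; first by rewrite bC bC'.
by rewrite bl bl'; ring.
Qed.

Lemma quad_nonneg_discr (A B C : R) : 0 <= A ->
  (forall t, 0 <= A * t ^+ 2 - 2 * B * t + C) -> B ^+ 2 <= A * C.
Proof.
move=> A0 H; have [A00|AN0] := eqVneq A 0.
  have [->|B0] := eqVneq B 0; first by rewrite A00 expr0n mul0r.
  (* With $A=0$ an affine function would be bounded below; at this point it takes the value $-1$. *)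
  have := H ((C + 1) / (2 * B)); rewrite A00 mul0r add0r.
  rewrite [2 * B * _](_ : _ = C + 1); last by field.
  by lra.
have {A0}A0 : 0 < A by rewrite lt_neqAle eq_sym AN0.
have := H (B / A); rewrite (_ : _ + C = C - B ^+ 2 / A); last by field.
by rewrite subr_ge0 ler_pdivrMr// mulrC.
Qed.

(** Only semidefinite: elements of the spaces are functions, not classes, so a form may vanish on a
    nonzero vector. *)
Variant psd s : Prop := Psd of bilin s & (forall x, 0 <= s x x).

Definition nrm s x : R := Num.sqrt (s x x).

Lemma nrm_ge0 s x : 0 <= nrm s x. Proof. exact: sqrtr_ge0. Qed.

Lemma sqr_nrm s x : psd s -> nrm s x ^+ 2 = s x x.
Proof. by move=> [_ s0]; rewrite sqr_sqrtr. Qed.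

Lemma nrmZ s a x : psd s -> nrm s (a *: x) = `|a| * nrm s x.
Proof.
move=> [bs s0]; rewrite /nrm bilinZl// bilinZr// mulrA -expr2 sqrtrM ?sqr_ge0//.
by rewrite sqrtr_sqr.
Qed.

Lemma nrmN s x : psd s -> nrm s (- x) = nrm s x.
Proof. by move=> [bs s0]; rewrite /nrm bilinNl// bilinNr// opprK. Qed.

(* Polarization: the quadratic bound self-improves to a bilinear one. *)
Lemma bilin_bound b s (M : R) x y : bilin b -> psd s -> 0 <= M ->
  (forall x, `|b x x| <= M * s x x) -> `|b x y| <= M * nrm s x * nrm s y.
Proof.
move=> bb [bs s0] M0 bM.
have H : b x y ^+ 2 <= (M * s x x) * (M * s y y).
  apply: quad_nonneg_discr; first by rewrite mulr_ge0.
  move=> t; have h1 := bM (- t *: x + y); have h2 := bM (t *: x + y).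
  move: h1 h2; rewrite !bilinE// !(bilinC y x)//; rewrite !ler_norml => /andP[h1 h1'] /andP[h2 h2'].
  by nra.
rewrite -(@ler_pXn2r _ 2)// ?nnegrE//; last by rewrite !mulr_ge0 ?nrm_ge0.
rewrite real_normK ?num_real//; apply: le_trans H _.
rewrite !exprMn !sqr_nrm//.
by rewrite le_eqVlt; apply/orP; left; apply/eqP; ring.
Qed.

Lemma psd_CS s x y : psd s -> `|s x y| <= nrm s x * nrm s y.
Proof.
move=> ps; have [bs s0] := ps; rewrite -[X in X * _]mul1r; apply: bilin_bound => // z.
by rewrite mul1r ger0_norm.
Qed.

Lemma nrmD s x y : psd s -> nrm s (x + y) <= nrm s x + nrm s y.
Proof.
move=> ps; have [bs s0] := ps.
rewrite -(@ler_pXn2r _ 2)// ?nnegrE ?addr_ge0 ?nrm_ge0//.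
rewrite sqr_nrm// !bilinE// (bilinC y x)//.
have := psd_CS x y ps; rewrite ler_norml => /andP[_ H].
by rewrite sqrrD !sqr_nrm//; lra.
Qed.

Lemma nrmB s x y : psd s -> nrm s (x - y) <= nrm s x + nrm s y.
Proof. by move=> ps; have := nrmD x (- y) ps; rewrite nrmN. Qed.

Lemma nrm_dom s m x : psd s -> psd m -> (forall x, m x x <= s x x) -> nrm m x <= nrm s x.
Proof. by move=> _ _ ms; rewrite /nrm ler_wsqrtr. Qed.

(* Almost minimizers of the energy functional almost represent the functional:
   unlike the Riesz theorem this needs no completeness. *)
Lemma approx_Riesz b s (ell : X -> R) (c K M e : R) :
  psd s -> bilin b -> 0 < c -> 0 <= K -> 0 < e ->
  (forall x, c * s x x <= b x x) -> (forall x, b x x <= K * s x x) ->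
  (forall a x y, ell (a *: x + y) = a * ell x + ell y) ->
  (forall x, `|ell x| <= M * nrm s x) ->
  exists phi, forall w, `|b phi w - ell w| <= e * nrm s w.
Proof.
move=> ps bb c0 K0 e0 bc bK ell_lin ellM.
have [bs s0] := ps.
pose J x := b x x - 2 * ell x.
have Jlow x : - (M ^+ 2 / c) <= J x.
  have h1 := bc x; have := ellM x; rewrite ler_norml => /andP[_ h2].
  rewrite /J; have := sqr_ge0 (c * nrm s x - M).
  rewrite sqrrB exprMn sqr_nrm// => h3.
  rewrite lerNl opprB -(ler_pM2l c0) mulrBr [c * (M ^+ 2 / c)]mulrCA mulfV ?gt_eqF// mulr1.
  by nra.
(* A point that minimizes [J] up to [z] satisfies the Euler equation up to $\sqrt{Kz}$ times the
   norm, which is at most [e] times the norm. *)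
pose z := e ^+ 2 / (K + 1).
have z0 : 0 < z by rewrite divr_gt0 ?exprn_gt0// ltr_wpDl.
have hinf : has_inf [set J x | x in [set: X]].
  split; first by exists (J 0); exists 0.
  by exists (- (M ^+ 2 / c)) => _ [x _ <-].
have [_ [phi _ <-] Jphi] := inf_adherent z0 hinf.
have Jinf x : inf [set J x | x in [set: X]] <= J x.
  by apply: ge_inf; [case: hinf|exists x].
exists phi => w.
have H : (b phi w - ell w) ^+ 2 <= (K * s w w) * z.
  apply: quad_nonneg_discr; first by rewrite mulr_ge0.
  move=> t; have := Jinf (- t *: w + phi); rewrite /J ell_lin !bilinE// (bilinC w phi)//.
  move: Jphi; rewrite /J => h1 h2.
  have h3 := bK w; have h4 : t ^+ 2 * b w w <= t ^+ 2 * (K * s w w) by rewrite ler_wpM2l ?sqr_ge0.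
  by nra.
rewrite -(@ler_pXn2r _ 2)// ?nnegrE//; last by rewrite mulr_ge0 ?nrm_ge0 ?ltW.
rewrite real_normK ?num_real//; apply: le_trans H _.
rewrite exprMn sqr_nrm// mulrAC [leRHS]mulrC [leLHS]mulrC ler_wpM2l//.
rewrite /z mulrA ler_pdivrMr ?ltr_wpDl//.
by rewrite mulrC ler_wpM2l ?sqr_ge0// lerDl.
Qed.

(** Testing the scheme with $x_2-x_0$ makes the squared velocities telescope. The potential part
    telescopes as well because it is the mixed term [b1 x2 x1], with consecutive points, instead of
    a square: this is the invariant of the leapfrog scheme when the form is constant. *)
Lemma step_energy s m b0 b1 (x0 x1 x2 : X) (K L U h th eta nu : R) :
  psd s -> psd m -> (forall x, m x x <= s x x) ->
  psd b0 -> psd b1 -> 0 <= K -> 0 <= L -> 0 <= U -> 0 < h -> h <= nu -> 0 <= eta ->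
  (forall x, eta ^+ 2 * m x x <= b0 x x) -> (forall x, eta ^+ 2 * m x x <= b1 x x) ->
  (forall x, b0 x x <= K * s x x) -> (forall x, b1 x x <= K * s x x) ->
  (forall x, `|b1 x x - b0 x x| <= L * h * s x x) ->
  (forall x, b1 x x <= (1 + th) * b0 x x) -> 0 <= th -> th <= L * h ->
  (forall w, `|m (x2 - x1 - (x1 - x0)) w + h ^+ 2 * (b1 w x1 - eta ^+ 2 * m w x1)|
     <= h ^+ 2 * (L * nu * nrm s w)) ->
  nrm s x0 <= U -> nrm s x1 <= U -> nrm s (x1 - x0) <= nu -> nrm s (x2 - x1) <= nu ->
  (1 - eta * h / 2) * (m (x2 - x1) (x2 - x1) / h ^+ 2 + b1 x2 x1) <=
  (1 + th + eta * h / 2) * (m (x1 - x0) (x1 - x0) / h ^+ 2 + b0 x1 x0) +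
  (2 * L + L * U + L * K * U + eta * K * U) * nu ^+ 2.
Proof.
move=> ps pm ms pb0 pb1 K0 L0 U0 h0 hnu eta0 em0 em1 bK0 bK1 bL bth th0 thL SD n0 n1 d1 d2.
have [bs s0] := ps; have [bm m0] := pm; have [bb0 b00] := pb0; have [bb1 b10] := pb1.
have nu0 : 0 <= nu by apply: le_trans hnu; exact: ltW.
have bnd0 x y := @bilin_bound b0 s K x y bb0 ps K0
  (fun x => le_trans (eq_ind_r (fun t => t <= _) (lexx _) (ger0_norm (b00 x))) (bK0 x)).
have bnd1 x y := @bilin_bound b1 s K x y bb1 ps K0
  (fun x => le_trans (eq_ind_r (fun t => t <= _) (lexx _) (ger0_norm (b10 x))) (bK1 x)).
have bdif x y : `|b1 x y - b0 x y| <= L * h * nrm s x * nrm s y.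
  have bd := bilin_lin (- 1) bb0 bb1.
  have := @bilin_bound _ s (L * h) x y bd ps (mulr_ge0 L0 (ltW h0)).
  rewrite mulN1r addrC; apply=> z; rewrite mulN1r addrC; exact: bL.
set e1 := m (x2 - x1) (x2 - x1) / h ^+ 2; set e0 := m (x1 - x0) (x1 - x0) / h ^+ 2.
set y := eta * h / 2.
have h2 : 0 < h ^+ 2 by rewrite exprn_gt0.
have e10 : 0 <= e1 by rewrite divr_ge0// ltW.
have e00 : 0 <= e0 by rewrite divr_ge0// ltW.
have y0 : 0 <= y by rewrite /y divr_ge0// mulr_ge0// ltW.
pose w := x2 - x0.
have wE : w = (x2 - x1) + (x1 - x0) by rewrite /w addrA subrK.
have nw : nrm s w <= 2 * nu.
  by rewrite wE; apply: le_trans (nrmD _ _ ps) _; rewrite mulr_natl mulr2n lerD.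
have A1 : e1 - e0 + b1 w x1 - eta ^+ 2 * m w x1 <= 2 * L * nu ^+ 2.
  have := SD w; rewrite ler_norml => /andP[_].
  rewrite {1}wE (_ : m (x2 - x1 - (x1 - x0)) (x2 - x1 + (x1 - x0)) = h ^+ 2 * (e1 - e0)); last first.
    rewrite mulrBr /e1 /e0 ![h ^+ 2 * (_ / _)]mulrC !divfK ?gt_eqF//.
    by move: (x2 - x1) (x1 - x0) => p q; rewrite !bilinE// (bilinC q p)//; ring.
  rewrite -mulrDr ler_pM2l// addrA => /le_trans; apply.
  rewrite [leRHS](_ : _ = L * nu * (2 * nu)); last by ring.
  by rewrite ler_wpM2l// mulr_ge0.
(* The one-sided comparison of [b1] with [b0] is available on the diagonal only. The mixed term is
   moved to the diagonal at [x0], and the remainder contains both an increment and the change of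
   form, hence is quadratic in [nu]. *)
have B1 : b1 x0 x1 - b0 x1 x0 <= th * (b0 x1 x0 + K * (nu * U)) + L * (nu * nu) * U.
  rewrite -[in X in X - _](bilinC x1 x0 bb1).
  have E1 : b1 x1 x0 - b0 x1 x0 = (b1 x0 x0 - b0 x0 x0) +
      (b1 (x1 - x0) x0 - b0 (x1 - x0) x0) by rewrite !bilinE//; ring.
  rewrite E1; apply: lerD.
    have := bth x0; rewrite mulrDl mul1r -lerBlDl => /le_trans; apply.
    rewrite ler_wpM2l//.
    have := bnd0 (x1 - x0) x0; rewrite ler_norml => /andP[+ _].
    rewrite bilinBl// lerNl => H.
    have : K * nrm s (x1 - x0) * nrm s x0 <= K * (nu * U).
      by rewrite -mulrA ler_wpM2l// ler_pM// nrm_ge0.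
by lra.
  apply: le_trans (ler_norm _) _; apply: le_trans (bdif _ _) _.
  rewrite -!mulrA ler_wpM2l//.
  have H1 : nrm s (x1 - x0) * nrm s x0 <= nu * U by rewrite ler_pM// nrm_ge0.
  by rewrite ler_pM ?(ltW h0)// mulr_ge0 ?nrm_ge0.
(* Young's inequality with the weight that turns [z] into a velocity [z / h]: the shift, absent from
   the scheme, is absorbed by the energy at rate [eta / 2]. *)
have amgm z : eta ^+ 2 * m z x1 <= y * (m z z / h ^+ 2 + eta ^+ 2 * m x1 x1).
  have := m0 (z - (eta * h) *: x1); rewrite !bilinE// (bilinC x1 z)// => H.
  rewrite /y -subr_ge0 (_ : _ - _ = eta / (2 * h) *
    (m z z - eta * h * m z x1 - (eta * h * m z x1 - eta * h * (eta * h * m x1 x1)))); last first.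
    by field; rewrite gt_eqF.
  apply: mulr_ge0; first by rewrite divr_ge0// mulr_ge0// ltW.
  by lra.
have C1 : eta ^+ 2 * m w x1 <= y * (e1 + e0 + 2 * (eta ^+ 2 * m x1 x1)).
  by rewrite wE bilinDl// mulrDr; have := amgm (x2 - x1); have := amgm (x1 - x0); rewrite -/e1 -/e0; lra.
have D1 : eta ^+ 2 * m x1 x1 <= b1 x2 x1 + K * (nu * U).
  apply: le_trans (em1 _) _; have := bnd1 (x2 - x1) x1; rewrite ler_norml => /andP[+ _].
  rewrite bilinBl// lerNl => H.
  have : K * nrm s (x2 - x1) * nrm s x1 <= K * (nu * U).
    by rewrite -mulrA ler_wpM2l// ler_pM// nrm_ge0.
  by lra.
have D0 : eta ^+ 2 * m x1 x1 <= b0 x1 x0 + K * (nu * U).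
  apply: le_trans (em0 _) _; have := bnd0 x1 (x1 - x0); rewrite ler_norml => /andP[_ +].
  rewrite bilinBr// => H.
  have : K * nrm s x1 * nrm s (x1 - x0) <= K * (nu * U).
    by rewrite -mulrA [nu * U]mulrC ler_wpM2l// ler_pM// nrm_ge0.
  by lra.
have thKU : th * (K * (nu * U)) <= L * K * U * nu ^+ 2.
  have : th * (K * (nu * U)) <= L * nu * (K * (nu * U)).
    rewrite ler_wpM2r ?mulr_ge0//; apply: le_trans thL _; by rewrite ler_wpM2l.
  by move=> /le_trans; apply; rewrite le_eqVlt; apply/orP; left; apply/eqP; ring.
have yKU : y * (2 * (K * (nu * U))) <= eta * K * U * nu ^+ 2.
  have : eta * h * (K * (nu * U)) <= eta * nu * (K * (nu * U)).
    by rewrite ler_wpM2r ?mulr_ge0// ler_wpM2l.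
  rewrite /y; nra.
have the0 : 0 <= th * e0 by rewrite mulr_ge0.
have wD : b1 w x1 = b1 x2 x1 - b1 x0 x1 by rewrite /w bilinBl.
have yD1 := ler_wpM2l y0 D1; have yD0 := ler_wpM2l y0 D0.
move: A1 B1 C1 thKU yKU the0 yD1 yD0; rewrite wD !expr2.
move: (b1 x2 x1) (b1 x0 x1) (b0 x1 x0) (eta * eta * m x1 x1) (eta * eta * m w x1) => u v z t q.
by clear; nra.
Qed.

Lemma psd_bound b s (K : R) x y : psd b -> psd s -> 0 <= K ->
  (forall x, b x x <= K * s x x) -> `|b x y| <= K * nrm s x * nrm s y.
Proof.
by move=> [bb b0] ps K0 bK; apply: bilin_bound => // z; rewrite ger0_norm.
Qed.

Lemma diff_bound b b' s (K : R) x y : bilin b -> bilin b' -> psd s -> 0 <= K ->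
  (forall x, `|b' x x - b x x| <= K * s x x) ->
  `|b' x y - b x y| <= K * nrm s x * nrm s y.
Proof.
move=> bb bb' ps K0 bL; have := @bilin_bound _ s K x y (bilin_lin (- 1) bb bb') ps K0.
by rewrite mulN1r addrC; apply=> z; rewrite mulN1r addrC; exact: bL.
Qed.

(* The energy dual to [step_energy]: [p] and [q] are approximate solutions of
   elliptic problems with the discrete velocities as right-hand sides. *)
Lemma step_dual_energy s m b1 b2 (x0 x1 x2 p q : X) (K L U c B B' h th eta nu : R) :
  psd s -> psd m -> (forall x, m x x <= s x x) ->
  psd b1 -> psd b2 -> 0 < c -> 0 <= K -> 0 <= L -> 0 <= U ->
  0 < h -> h <= nu -> h <= 1 -> 0 <= eta ->
  (forall x, eta ^+ 2 * m x x <= b1 x x) -> (forall x, eta ^+ 2 * m x x <= b2 x x) ->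
  (forall x, c * s x x <= b1 x x) -> (forall x, c * s x x <= b2 x x) ->
  (forall x, b1 x x <= K * s x x) ->
  (forall x, `|b2 x x - b1 x x| <= L * h * s x x) ->
  (forall x, b2 x x <= (1 + th) * b1 x x) -> 0 <= th -> th <= L * h ->
  (forall w, `|m (x2 - x1 - (x1 - x0)) w + h ^+ 2 * (b1 w x1 - eta ^+ 2 * m w x1)|
     <= h ^+ 2 * (L * nu * nrm s w)) ->
  nrm s x1 <= U -> nrm s (x1 - x0) <= nu -> nrm s (x2 - x1) <= nu ->
  (forall w, `|b1 p w - h^-1 * m (x1 - x0) w| <= h ^+ 2 * nrm s w) ->
  (forall w, `|b2 q w - h^-1 * m (x2 - x1) w| <= h ^+ 2 * nrm s w) ->
  B = 2 / c -> B' = (K * U + eta ^+ 2 * U + L + 2 + L * B) / c ->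
  (1 - eta * h / 2) * (b1 p p + m x1 x0) <=
  (1 + th + eta * h / 2) * (b2 q q + m x2 x1) +
  (4 * B + 2 * L * B + 2 * U + L * B * U + L * B * B' + eta * U + L * U) * nu ^+ 2.
Proof.
move=> ps pm ms pb1 pb2 c0 K0 L0 U0 h0 hnu h1 eta0 em1 em2 bc1 bc2 bK1 bL bth th0 thL
  SD n1 d1 d2 Hp Hq BE B'E.
have [bs s0] := ps; have [bm m0] := pm; have [bb1 b10] := pb1; have [bb2 b20] := pb2.
have nu0 : 0 < nu by apply: lt_le_trans hnu.
have hN : h != 0 by rewrite gt_eqF.
have B0 : 0 <= B by rewrite BE divr_ge0// ltW.
have B'0 : 0 <= B'.
  by rewrite B'E divr_ge0 ?(ltW c0)// !addr_ge0// ?mulr_ge0// sqr_ge0.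
have Lh0 : 0 <= L * h by rewrite mulr_ge0// ltW.
have bnd1 x y := psd_bound x y pb1 ps K0 bK1.
have bdif x y := diff_bound x y bb1 bb2 ps Lh0 bL.
have bndm x y : `|m x y| <= nrm s x * nrm s y.
  by have := psd_bound x y pm ps ler01; rewrite !mul1r; apply=> z; rewrite mul1r.
set y := eta * h / 2.
have y0 : 0 <= y by rewrite /y divr_ge0// mulr_ge0// ltW.
(* Both representers are of size [nu / h]. *)
have nB b z v : (forall x, c * s x x <= b x x) -> nrm s v <= nu ->
    (forall w, `|b z w - h^-1 * m v w| <= h ^+ 2 * nrm s w) -> h * nrm s z <= B * nu.
  move=> bc nv Hz; rewrite BE mulrAC ler_pdivlMr//.
  have [z0|z0] := eqVneq (nrm s z) 0.
    by rewrite z0 mulr0 mul0r mulr_ge0// ltW.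
  have zp : 0 < nrm s z by rewrite lt_neqAle eq_sym z0 nrm_ge0.
  rewrite -(ler_pM2l zp).
  have := Hz z; rewrite ler_norml => /andP[_ H].
  have H2 := bc z; rewrite -(sqr_nrm z ps) in H2.
  have := bndm v z; rewrite ler_norml => /andP[_ H3].
  have H4 : nrm s v * nrm s z <= nu * nrm s z by rewrite ler_wpM2r ?nrm_ge0.
  have H5 : h * (h^-1 * m v z) = m v z by rewrite mulrA mulfV// mul1r.
  have H6 : h * (c * nrm s z ^+ 2) <= m v z + h * (h ^+ 2 * nrm s z).
    by rewrite -H5 -mulrDr ler_pM2l//; clear -H H2; lra.
  have H7 : h * (h ^+ 2 * nrm s z) <= nu * nrm s z.
    rewrite mulrA ler_wpM2r ?nrm_ge0//; apply: le_trans hnu.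
    by rewrite -[leRHS]mulr1 ler_pM2l// expr_le1// ltW.
  rewrite expr2 in H6; clear -H3 H4 H6 H7; lra.
have np := nB _ _ _ bc1 d1 Hp; have nq := nB _ _ _ bc2 d2 Hq.
have SDn w : `|m (x2 - x1 - (x1 - x0)) w| <=
    h ^+ 2 * ((K * U + eta ^+ 2 * U + L * nu) * nrm s w).
  have nw := nrm_ge0 s w.
  have E1 := SD w; have E2 := bnd1 w x1; have E3 := bndm w x1.
  have E4 : K * nrm s w * nrm s x1 <= K * nrm s w * U.
    by rewrite ler_wpM2l// mulr_ge0.
  have E5 : nrm s w * nrm s x1 <= nrm s w * U by rewrite ler_wpM2l.
  have E6 : eta ^+ 2 * `|m w x1| <= eta ^+ 2 * (nrm s w * U).
    by rewrite ler_wpM2l ?sqr_ge0// (le_trans E3).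
  have T := ler_normB (m (x2 - x1 - (x1 - x0)) w + h ^+ 2 * (b1 w x1 - eta ^+ 2 * m w x1))
    (h ^+ 2 * (b1 w x1 - eta ^+ 2 * m w x1)).
  rewrite addrK in T; apply: le_trans T _.
  rewrite normrM (ger0_norm (sqr_ge0 h)).
  have T2 := ler_normB (b1 w x1) (eta ^+ 2 * m w x1).
  rewrite normrM (ger0_norm (sqr_ge0 eta)) in T2.
  apply: le_trans (lerD E1 (ler_wpM2l (sqr_ge0 h) T2)) _.
  by rewrite -mulrDr ler_wpM2l ?sqr_ge0//; clear -E2 E4 E6; lra.
have EM v : h^-1 * m (x2 - x1) v - h^-1 * m (x1 - x0) v =
    h^-1 * m (x2 - x1 - (x1 - x0)) v by rewrite [in RHS]bilinBl// mulrBr.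
(* Each representer is of size [nu / h], but their difference is of size [nu]: by the scheme the two
   increments differ by $O(h^2)$, and the change of form contributes [L * h] times the norm of
   [q]. *)
have npq : nrm s (q - p) <= B' * nu.
  have [z0|z0] := eqVneq (nrm s (q - p)) 0; first by rewrite z0 mulr_ge0// ltW.
  have zp : 0 < nrm s (q - p) by rewrite lt_neqAle eq_sym z0 nrm_ge0.
  rewrite B'E mulrAC ler_pdivlMr// -(ler_pM2l zp).
  set w := q - p.
  have H1 : c * (nrm s w * nrm s w) <= b1 q w - b1 p w.
    by rewrite -bilinBl// -expr2 sqr_nrm//.
  have := Hp w; rewrite ler_norml => /andP[H2 _].
  have := Hq w; rewrite ler_norml => /andP[_ H3].
  have := bdif q w; rewrite ler_norml => /andP[H4 _].
  have := SDn w; rewrite ler_norml => /andP[_ H5].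
  have H6 : L * h * nrm s q * nrm s w <= L * (B * nu) * nrm s w.
    by rewrite ler_wpM2r ?nrm_ge0// -mulrA ler_wpM2l.
  have H7 : h^-1 * m (x2 - x1 - (x1 - x0)) w <= h * ((K * U + eta ^+ 2 * U + L * nu) * nrm s w).
    rewrite ler_pdivrMl//; apply: le_trans H5 _.
    by rewrite le_eqVlt; apply/orP; left; apply/eqP; ring.
  have H8 : h * ((K * U + eta ^+ 2 * U + L * nu) * nrm s w) <= (K * U + eta ^+ 2 * U + L) * nu * nrm s w.
    rewrite mulrA ler_wpM2r ?nrm_ge0// mulrDr [leRHS]mulrDl.
    apply: lerD; first by rewrite mulrC ler_wpM2l// addr_ge0// mulr_ge0// sqr_ge0.
    by rewrite mulrCA ler_wpM2l// ler_piMl// ltW.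
  have H9 : h ^+ 2 * nrm s w <= nu * nrm s w.
    rewrite ler_wpM2r ?nrm_ge0// expr2; apply: le_trans hnu.
    by rewrite ler_piMl// ltW.
  have H10 := EM w; clear -H1 H2 H3 H4 H6 H7 H8 H9 H10; lra.
have B1 : (b2 p q - b1 p q) <= th * (b2 q q) + L * (B' * nu) * (B * nu).
  have E1 : b2 p q - b1 p q = (b2 q q - b1 q q) - (b2 (q - p) q - b1 (q - p) q).
    by rewrite !bilinBl//; ring.
  rewrite E1; apply: lerD.
    have G1 := bth q; have G2 := b20 q; have G3 := b10 q.
    have G4 : th * (b2 q q) <= th * ((1 + th) * b1 q q) by rewrite ler_wpM2l.
    (* The increase of the form at [q] is at most [th * b1 q q], but [b2] is wanted on the right. If
       [b2 q q] is the smaller value, the increase is nonpositive. *)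
    have [le12|/ltW le12] := leP (b1 q q) (b2 q q).
      have : th * b1 q q <= th * b2 q q by rewrite ler_wpM2l.
      by clear -G4 le12 G1; lra.
    have : 0 <= th * b2 q q by rewrite mulr_ge0.
    by clear -le12; lra.
  rewrite lerNl; have := bdif (q - p) q; rewrite ler_norml => /andP[+ _].
  apply: le_trans; rewrite lerN2 -!mulrA ler_wpM2l//.
  have : nrm s (q - p) * (h * nrm s q) <= (B' * nu) * (B * nu).
    by rewrite ler_pM ?mulr_ge0 ?nrm_ge0// ltW.
  by rewrite -!mulrA mulrCA.
(* The test vector dual to $x_2-x_0$: the velocity terms give [b2 q q - b1 p p] and a change of form
   at the mixed pair, while [h * b1 v x1] is close to [m x2 x1 - m x1 x0]. *)
pose v := p + q.
have nv : h * nrm s v <= 2 * B * nu.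
  have := ler_wpM2l (ltW h0) (nrmD p q ps); rewrite mulrDr -/v; clear -np nq; lra.
have C1 := Hp v; have C2 := Hq v.
rewrite ler_norml in C1; case/andP: C1 => _ C1.
rewrite ler_norml in C2; case/andP: C2 => C2 _.
have hn v' : 0 <= nrm s v' -> h * nrm s v' <= 2 * B * nu -> h ^+ 2 * nrm s v' <= 2 * B * nu ^+ 2.
  move=> v0 H; rewrite (_ : h ^+ 2 * nrm s v' = h * (h * nrm s v')); last by ring.
  rewrite (_ : 2 * B * nu ^+ 2 = nu * (2 * B * nu)); last by ring.
  by rewrite ler_pM ?mulr_ge0// ltW.
have D1 := hn v (nrm_ge0 _ _) nv.
have S1 := SD v; rewrite ler_norml in S1; case/andP: S1 => S1 _.
have S2 : - (L * nu * (h * nrm s v)) - h * (b1 v x1 - eta ^+ 2 * m v x1) <=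
    h^-1 * m (x2 - x1 - (x1 - x0)) v.
  rewrite ler_pdivlMl// mulrBr mulrN [h * (L * nu * _)]mulrCA [h * (h * nrm s v)]mulrA -expr2.
  rewrite [h * (h * (_ - _))]mulrA -expr2 [L * nu * (_ * _)]mulrCA; clear -S1; lra.
have S3 : L * nu * (h * nrm s v) <= 2 * L * B * nu ^+ 2.
  rewrite (_ : 2 * L * B * nu ^+ 2 = L * nu * (2 * B * nu)); last by ring.
  by rewrite ler_wpM2l// mulr_ge0// ltW.
(* [b1 p x1 ~ m d1 x1] and [b1 q x1 ~ b2 q x1 ~ m d2 x1] *)
have T1 := Hp x1; rewrite ler_norml in T1; case/andP: T1 => _ T1.
have T2 := Hq x1; rewrite ler_norml in T2; case/andP: T2 => _ T2.
have T3 := bdif q x1; rewrite ler_norml in T3; case/andP: T3 => T3 _.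
have h2U : h * (h ^+ 2 * nrm s x1) <= U * nu ^+ 2.
  have E : h ^+ 2 * nrm s x1 <= h ^+ 2 * U by rewrite ler_wpM2l ?sqr_ge0.
  have E2 : h ^+ 2 * U <= nu ^+ 2 * U by rewrite ler_wpM2r// lerXn2r ?nnegrE// ltW.
  have E3 : h * (h ^+ 2 * nrm s x1) <= h ^+ 2 * nrm s x1.
    by rewrite ler_piMl// mulr_ge0 ?sqr_ge0 ?nrm_ge0.
  by clear -E E2 E3; lra.
have LqU : h * (L * h * nrm s q * nrm s x1) <= L * B * U * nu ^+ 2.
  have E : h * (h * nrm s q) * nrm s x1 <= nu * (B * nu) * U.
    by rewrite ler_pM ?mulr_ge0 ?nrm_ge0 ?(ltW h0)// ler_pM ?mulr_ge0 ?nrm_ge0 ?(ltW h0).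
  have := ler_wpM2l L0 E; rewrite expr2; clear; lra.
have T4 : h * b1 v x1 <= m (x2 - x0) x1 + 2 * U * nu ^+ 2 + L * B * U * nu ^+ 2.
  have E1 : h * (h^-1 * m (x1 - x0) x1) = m (x1 - x0) x1 by rewrite mulrA mulfV// mul1r.
  have E2 : h * (h^-1 * m (x2 - x1) x1) = m (x2 - x1) x1 by rewrite mulrA mulfV// mul1r.
  have E3 : m (x2 - x0) x1 = m (x2 - x1) x1 + m (x1 - x0) x1 by rewrite -bilinDl// addrA subrK.
  have F1 : h * b1 p x1 <= h * (h^-1 * m (x1 - x0) x1 + h ^+ 2 * nrm s x1).
    by rewrite ler_wpM2l ?(ltW h0)//; clear -T1; lra.
  have F2 : h * b1 q x1 <=
      h * (h^-1 * m (x2 - x1) x1 + h ^+ 2 * nrm s x1 + L * h * nrm s q * nrm s x1).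
    by rewrite ler_wpM2l ?(ltW h0)//; clear -T2 T3; lra.
  rewrite /v bilinDl// mulrDr E3; move: F1 F2; rewrite !mulrDr E1 E2; clear -h2U LqU; lra.
have amgm z : - (y * (eta ^+ 2 * m z z + m x1 x1)) <= h * (eta ^+ 2 * m z x1).
  have := m0 (eta *: z + x1); rewrite !bilinE// (bilinC x1 z)// => H.
  rewrite -subr_ge0 (_ : _ - _ = y *
    (eta * (eta * m z z) + eta * m z x1 + (eta * m z x1 + m x1 x1))); last first.
    by rewrite /y; field.
  by rewrite mulr_ge0//; lra.
have M1 : m x1 x1 <= m x1 x0 + nu * U.
  have := bndm x1 (x1 - x0); rewrite ler_norml bilinBr// => /andP[_ H].
  have : nrm s x1 * nrm s (x1 - x0) <= U * nu by rewrite ler_pM ?nrm_ge0.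
  by clear -H; lra.
have M2 : m x1 x1 <= m x2 x1 + nu * U.
  have := bndm (x2 - x1) x1; rewrite ler_norml bilinBl// => /andP[H _].
  have : nrm s (x2 - x1) * nrm s x1 <= nu * U by rewrite ler_pM ?nrm_ge0.
  by clear -H; lra.
have A1 : - (y * (b1 p p + m x1 x0)) - y * (b2 q q + m x2 x1) - eta * U * nu ^+ 2 <=
    h * (eta ^+ 2 * m v x1).
  have := amgm p; have := amgm q => G1 G2.
  have G3 := ler_wpM2l y0 (lerD (em1 p) M1); have G4 := ler_wpM2l y0 (lerD (em2 q) M2).
  have G5 : y * (nu * U) * 2 <= eta * U * nu ^+ 2.
    have : eta * h * (nu * U) <= eta * nu * (nu * U).
      by rewrite ler_wpM2r ?mulr_ge0 ?(ltW nu0)// ler_wpM2l.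
    by rewrite /y; clear; lra.
  by rewrite /v bilinDl// !mulrDr; clear -G1 G2 G3 G4 G5; lra.
have thN : - (L * U * nu ^+ 2) <= th * m x2 x1.
  have G : - (nu * U) <= m x2 x1 by have := m0 x1; clear -M2; lra.
  have G2 := ler_wpM2l th0 G.
  have : th * (nu * U) <= L * nu * (nu * U).
    rewrite ler_wpM2r ?mulr_ge0 ?(ltW nu0)//; apply: le_trans thL _; by rewrite ler_wpM2l.
  by clear -G2; lra.
have X1 : b2 q v = b2 q q + b2 p q by rewrite /v bilinDr// (bilinC q p)// addrC.
have X2 : b1 p v = b1 p p + b1 p q by rewrite /v bilinDr.
have X3 : m (x2 - x0) x1 = m x2 x1 - m x1 x0 by rewrite bilinBl// (bilinC x0 x1).
have X4 := EM v.
rewrite X1 in C2; rewrite X2 in C1; rewrite X3 in T4.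
rewrite mulrBr in S2.
have LBB : L * (B' * nu) * (B * nu) = L * B * B' * nu ^+ 2 by ring.
rewrite LBB in B1.
rewrite !mulrDl !mulrDr !mul1r !mulNr; rewrite !mulrDr in A1; clear -A1 B1 C1 C2 D1 S2 S3 T4 thN X4; lra.
Qed.

(** The 2 bounds $1/(1-y)$. All growth factors are at least 1, so each residual may be multiplied by
    the full product. *)
Lemma discrete_gronwall (A th r : nat -> R) (y : R) n :
  0 <= y -> y <= 1 / 2 -> (forall k, 0 <= th k) -> (forall k, 0 <= r k) ->
  (forall k, (k < n)%N -> (1 - y) * A k.+1 <= (1 + th k + y) * A k + r k) ->
  A n <= (\prod_(k < n) ((1 + th k + y) / (1 - y))) * (A 0%N + 2 * \sum_(k < n) r k).
Proof.
move=> y0 y1 th0 r0 H.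
have y2 : 0 < 1 - y by lra.
pose g k := (1 + th k + y) / (1 - y).
have g1 k : 1 <= g k by rewrite ler_pdivlMr// mul1r; have := th0 k; lra.
have rho1 k : 1 <= \prod_(j < k) g j.
  elim: k => [|k IH]; first by rewrite big_ord0.
  by rewrite big_ord_recr/=; apply: mulr_ege1.
suff : forall k, (k <= n)%N -> A k <= (\prod_(j < k) g j) * (A 0%N + 2 * \sum_(j < k) r j).
  by move=> H'; exact: (H' n (leqnn n)).
elim=> [_|k IH kn]; first by rewrite !big_ord0 mulr0 addr0 mul1r.
have {}IH := IH (ltnW kn).
have Hk : A k.+1 <= g k * A k + 2 * r k.
  have := H k kn; rewrite -ler_pdivlMl// => /le_trans; apply.
  rewrite mulrDr mulrA; apply: lerD; first by rewrite /g [_^-1 * _]mulrC.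
  rewrite ler_wpM2r//; rewrite -div1r ler_pdivrMr//; lra.
apply: le_trans Hk _; rewrite !big_ord_recr/=.
set P := \prod_(j < k) g j; set S := \sum_(j < k) r j.
have P1 : 1 <= P by exact: rho1.
rewrite [leRHS](_ : _ = g k * (P * (A 0%N + 2 * S)) + P * g k * (2 * r k)); last by rewrite -/(g k); ring.
apply: lerD; first by rewrite ler_wpM2l// (le_trans ler01).
rewrite -[leLHS]mul1r ler_wpM2r ?mulr_ge0//.
by apply: mulr_ege1.
Qed.

End bilinear_forms.

(** * The space H^1(D) as a module with its bilinear forms *)

Section H1_space.
Context {R : realType} {n : nat}.
Implicit Types D : set 'rV[R]_n.

Definition H1pred D : {pred 'rV[R]_n -> R} := fun f => `[< H1 D f >].

Lemma H1pred_submod D : open D -> GRing.submod_closed (H1pred D).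
Proof.
move=> oD; split; first by apply/asboolP; exact: H1_0.
by move=> a f g /asboolP Hf /asboolP Hg; apply/asboolP; exact: H1_lin.
Qed.

(* The proof of openness is a parameter of the type so that the module
   structure can be inferred. *)
Record H1space D (oD : open D) := MkH1space {
  H1val :> 'rV[R]_n -> R; H1val_subproof : H1val \in H1pred D }.

Section instances.
Context (D : set 'rV[R]_n) (oD : open D).
HB.instance Definition _ := [isSub for @H1val D oD].
HB.instance Definition _ := [Choice of H1space oD by <:].
HB.instance Definition _ := GRing.isSubmodClosed.Build R _ (H1pred D) (H1pred_submod oD).
HB.instance Definition _ := [SubChoice_isSubLmodule of H1space oD by <:].
End instances.

Context (D : set 'rV[R]_n) (oD : open D).
Local Notation V := (H1space oD).

Lemma H1valP (f : V) : H1 D f.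
Proof. by apply/asboolP; exact: H1val_subproof. Qed.

Definition toH1 (f : 'rV[R]_n -> R) : V := insubd 0 f.

Lemma toH1K f : H1 D f -> toH1 f = f :> ('rV[R]_n -> R).
Proof. by move=> Hf; rewrite /toH1 insubdK//; exact/asboolP. Qed.

Lemma H1val_lin (a : R) (f g : V) : H1val (a *: f + g) = (fun x => a * f x + g x).
Proof. by []. Qed.

Lemma H1valB (f g : V) : H1val (f - g) = (fun x => f x - g x).
Proof. by []. Qed.

Lemma bilin_dotL2 : bilin (fun f g : V => dotL2 D f g).
Proof.
split=> [f g|a f g h]; first exact: dotL2C.
exact: (dotL2_linl a (H1_L2 (H1valP f)) (H1_L2 (H1valP g)) (H1_L2 (H1valP h))).
Qed.

Lemma bilin_Aform k : Linfty D k -> bilin (fun f g : V => Aform D k f g).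
Proof.
move=> Lk; split=> [f g|a f g h]; first exact: AformC.
exact: (Aform_lin a oD Lk (H1valP f) (H1valP g) (H1valP h)).
Qed.

Lemma psd_dotL2 : psd (fun f g : V => dotL2 D f g).
Proof. by split; [exact: bilin_dotL2|move=> f; exact: dotL2_ge0]. Qed.

Lemma Aform1_ge0 (f : V) : 0 <= Aform D (cst 1) f f.
Proof.
rewrite /Aform; apply: sumr_ge0 => i _.
rewrite (_ : (fun x => cst 1 x * wpartial D i f x) = wpartial D i f); last first.
  by apply/funext => x /=; rewrite mul1r.
exact: dotL2_ge0.
Qed.

Lemma psd_dotH1 : psd (fun f g : V => dotH1 D f g).
Proof.
have E : (fun f g : V => dotH1 D f g) =
    (fun f g : V => 1 * dotL2 D f g + Aform D (cst 1) f g).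
  by apply/funext => f; apply/funext => g; rewrite dotH1E mul1r.
rewrite E; split; first exact: (bilin_lin 1 bilin_dotL2 (bilin_Aform (Linfty_cst 1 oD))).
by move=> f; rewrite mul1r addr_ge0 ?dotL2_ge0 ?Aform1_ge0.
Qed.

Lemma H1_norm_nrm (f : V) : H1_norm D f = nrm (fun f g : V => dotH1 D f g) f.
Proof. by []. Qed.

End H1_space.

(** * Limits in the grid size and in the shift *)

Section growth_bound.
Context {R : realType}.

(** The 3 is made of 1 from $e^x+y\le e^{x+y}$ and 2 from $1/(1-y)\le e^{2y}$, the latter for
    $y\le1/2$. *)
Lemma gronwall_factor (x : nat -> R) (y : R) n : 0 <= y -> y <= 1 / 2 ->
  (forall k, 0 <= x k) ->
  \prod_(k < n) ((1 + (expR (x k) - 1) + y) / (1 - y)) <=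
  expR (\sum_(k < n) x k + 3 * (n%:R * y)).
Proof.
move=> y0 y1 x0; elim: n => [|n IH].
  by rewrite !big_ord0 mul0r mulr0 addr0 expR0.
rewrite !big_ord_recr/=.
have y2 : 0 < 1 - y by lra.
rewrite [X in _ <= expR X](_ : _ = (\sum_(k < n) x k + 3 * (n%:R * y)) + (x n + y + 2 * y)); last first.
  by rewrite -natr1; ring.
rewrite expRD; apply: ler_pM => //.
- by apply: prodr_ge0 => k _; rewrite divr_ge0 ?(ltW y2)// subrKC addr_ge0// expR_ge0.
- by rewrite divr_ge0 ?(ltW y2)// subrKC addr_ge0// expR_ge0.
rewrite ler_pdivrMr// expRD -mulrA.
have h1 : 1 <= expR (2 * y) * (1 - y).
  have := expR_ge1Dx (2 * y) => h.
  apply: le_trans (_ : (1 + 2 * y) * (1 - y) <= _); first by nra.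
  by rewrite ler_wpM2r// ltW.
apply: le_trans (_ : expR (x n + y) <= _); last by rewrite -[leLHS]mulr1 ler_wpM2l ?expR_ge0.
rewrite expRD subrKC.
apply: le_trans (_ : expR (x n) * (1 + y) <= _).
  by rewrite mulrDr mulr1 lerD2l ler_peMl// -expR0 ler_expR.
by rewrite ler_wpM2l ?expR_ge0// expR_ge1Dx.
Qed.

(** The order of the limits matters: [beta] and [C] depend on [eta], so [n] tends to infinity first,
    with [P] kept away from 0, and only then [eta] tends to 0. *)
Lemma growth_limit (G aT T : R) : 0 < T -> 0 < G ->
  (forall eta, 0 < eta -> eta <= 1 -> exists beta C : R, [/\ 0 < beta, 0 <= C &
     exists n0 : nat, forall n : nat, (n0 <= n)%N -> exists2 P : R, beta <= P &
       G * P <= expR (aT + 3 * (eta * T / 2)) * (P + C / n.+1%:R)]) ->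
  G <= expR aT.
Proof.
move=> T0 G0 H.
have H1 eta : 0 < eta -> eta <= 1 -> G <= expR (aT + 3 * (eta * T / 2)).
  move=> e0 e1; have [beta [C [b0 C0 [n0 Hn]]]] := H eta e0 e1.
  rewrite leNgt; apply/negP; set E := expR _ => EG.
  have [N _ HN] : \forall n \near \oo, E * C / ((G - E) * beta) < n%:R :> R.
    exact: nbhs_infty_gtr.
  have [P bP] := Hn (maxn n0 N) (leq_maxl _ _).
  have GE : 0 < G - E by rewrite subr_gt0.
  have := HN (maxn n0 N).+1 (leq_trans (leq_maxr n0 N) (leqnSn _)).
  pose q : R := (maxn n0 N).+1%:R; rewrite -/q => Hq.
  have q0 : 0 < q by rewrite ltr0n.
  rewrite ltr_pdivrMr ?mulr_gt0// in Hq.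
  rewrite -/q -/E => H2'; clearbody E q; have H2 : (G - E) * P * q <= E * C by rewrite -ler_pdivlMr//; move: H2'; rewrite mulrDr mulrA; lra.
  have H3 : (G - E) * beta * q <= (G - E) * P * q by rewrite ler_pM2r// ler_pM2l.
  by have := le_trans H3 H2; rewrite leNgt => /negP; apply; rewrite [ltRHS]mulrC.
rewrite -[G]lnK ?posrE// ler_expR; apply/ler_addgt0Pr => e e0.
pose eta := Num.min 1 (e / (3 * T / 2)).
have eta0 : 0 < eta by rewrite lt_min ltr01/= divr_gt0// divr_gt0// mulr_gt0.
have eta1 : eta <= 1 by rewrite ge_min lexx.
have etae : eta <= e / (3 * T / 2) by rewrite ge_min lexx orbT.
have : ln G <= aT + 3 * (eta * T / 2) by rewrite -ler_expR lnK ?posrE// H1.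
move=> /le_trans; apply.
rewrite lerD2l (_ : 3 * _ = eta * (3 * T / 2)); last by field.
by rewrite -ler_pdivlMr// divr_gt0// mulr_gt0.
Qed.

End growth_bound.

(** * Growth and decay over one period in an abstract setting *)

Section core.
Context {R : realType} {X : lmodType R}.
Implicit Types (s m : X -> X -> R) (a : R -> X -> X -> R) (u : R -> X) (alpha : R -> R).

Lemma expRB1_le (z : R) : 0 <= z -> z <= 1 / 2 -> expR z - 1 <= 2 * z.
Proof.
move=> z0 zh; have := expR_ge1Dx (- z); rewrite expRN => H.
have E0 := expR_gt0 z.
have H2 : expR z * (1 - z) <= 1 by rewrite mulrC -ler_pdivlMr// div1r.
nra.
Qed.

Lemma lower_bound_step (b x y z w beta : R) : 0 <= b -> - x <= y - w -> x <= z ->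
  z <= beta -> 2 * beta <= w -> beta <= b + y.
Proof. lra. Qed.

Lemma double_sum_bounds (x y : R) : 0 <= x -> 0 <= y ->
  [/\ x <= 2 * (x + y), 2 * x <= 2 * (x + y) & y <= 2 * (x + y)].
Proof. by move=> x0 y0; split; lra. Qed.

(** Here [s] is the product of the energy space, [m] that of the pivot space and [a t] the potential
    energy, coercive only modulo [m] (a Garding inequality). The exponent [alpha] bounds relative
    growth from above only. *)
Definition regular_forms s m a alpha (t0 t1 K L c : R) :=
  [/\ psd s, psd m, forall x, m x x <= s x x,
      forall t, t0 <= t <= t1 -> psd (a t) /\
        forall x, a t x x <= K * s x x /\ c * s x x <= a t x x + m x x
    & forall r t, t0 <= r -> r <= t -> t <= t1 ->
      [/\ forall x, `|a t x x - a r x x| <= L * (t - r) * s x x,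
          forall x, a t x x <= expR (alpha t - alpha r) * a r x x
        & 0 <= alpha t - alpha r <= L * (t - r)]].

(** A leapfrog scheme whose consistency error is measured by the same [nu k] that bounds the
    neighbouring increments; tested with vectors of size [nu k], it becomes quadratic. *)
Definition grid_solution s m a u (t0 h L U : R) (nu : nat -> R) n :=
  let t k := t0 + k%:R * h in
  forall k, (k < n)%N ->
  [/\ forall w, `|m (u (t k.+2) - u (t k.+1) - (u (t k.+1) - u (t k))) w +
          h ^+ 2 * a (t k.+1) w (u (t k.+1))| <= h ^+ 2 * (L * nu k * nrm s w),
      nrm s (u (t k.+1) - u (t k)) <= nu k,
      nrm s (u (t k.+2) - u (t k.+1)) <= nu k,
      h <= nu k
    & nrm s (u (t k)) <= U /\ nrm s (u (t k.+1)) <= U].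

(* [Lam] multiplies by a Floquet multiplier of squared modulus [G]. *)
Definition floquet_multiplier s m a (Lam : X -> X) (t0 T G : R) :=
  [/\ forall x y, s (Lam x) (Lam y) = G * s x y,
      forall x y, m (Lam x) (Lam y) = G * m x y,
      forall t x y, t0 <= t <= t0 + T -> a (t + T) (Lam x) (Lam y) = G * a t x y
    & exists Lam' : X -> X, forall w, Lam (Lam' w) = w].

(** The sum of squares is of order $1/n$ because $\nu_k^2$ is of order $h$ times an integral over a
    few cells. Two consecutive points are compared with their images under [Lam] since the energies
    involve pairs of points, and only up to null vectors of [s]. *)
Definition floquet_grids s m a u Lam (t0 T : R) :=
  exists L U C : R, [/\ 0 <= L, 0 <= U, 0 <= C & exists n0 : nat, forall n : nat, (n0 <= n)%N ->
    let h := T / n.+1%:R in exists nu : nat -> R,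
    [/\ grid_solution s m a u t0 h L U nu n.+1,
        \sum_(k < n.+1) nu k ^+ 2 <= C / n.+1%:R,
        s (u (t0 + T) - Lam (u t0)) (u (t0 + T) - Lam (u t0)) = 0
      & s (u (t0 + T + h) - Lam (u (t0 + h))) (u (t0 + T + h) - Lam (u (t0 + h))) = 0]].

Lemma psd0_bilin s b (K : R) x x' y : psd s -> bilin b -> 0 <= K ->
  (forall x y, `|b x y| <= K * nrm s x * nrm s y) -> s (x - x') (x - x') = 0 -> b x y = b x' y.
Proof.
move=> ps bb K0 bK s0; apply/eqP; rewrite -subr_eq0 -bilinBl// -normr_le0.
by apply: le_trans (bK _ _) _; rewrite /nrm s0 sqrtr0 mulr0 mul0r.
Qed.

Context {s m : X -> X -> R} {a : R -> X -> X -> R} {u : R -> X} {alpha : R -> R}.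
Context {Lam : X -> X} {t0 T K L c G aT : R}.

Let shifted (eta : R) (t : R) : X -> X -> R := fun x y => eta ^+ 2 * m x y + a t x y.

Lemma shifted_props (eta : R) : 0 < eta -> eta <= 1 -> 0 <= K -> 0 < c ->
  regular_forms s m a alpha t0 (t0 + 2 * T) K L c ->
  (forall t, t0 <= t <= t0 + 2 * T ->
    [/\ psd (shifted eta t), forall x, eta ^+ 2 * m x x <= shifted eta t x x,
     forall x, eta ^+ 2 * c * s x x <= shifted eta t x x
    & forall x, shifted eta t x x <= (K + 1) * s x x]) /\
  (forall r t, t0 <= r -> r <= t -> t <= t0 + 2 * T ->
    (forall x, `|shifted eta t x x - shifted eta r x x| <= L * (t - r) * s x x) /\
    (forall x, shifted eta t x x <= expR (alpha t - alpha r) * shifted eta r x x)).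
Proof.
move=> e0 e1 K0 c0 [ps pm ms Ha Har]; have [bs s0] := ps; have [bm m0] := pm.
have e2 : 0 < eta ^+ 2 by rewrite exprn_gt0.
have e21 : eta ^+ 2 <= 1 by rewrite expr_le1// ltW.
split=> [t tT|r t r0 rt tT].
  have [[ba a0] Hb] := Ha t tT; rewrite /shifted; split.
  - split; first exact: bilin_lin.
    by move=> x; rewrite addr_ge0// mulr_ge0// ltW.
  - by move=> x; rewrite lerDl.
  - move=> x; have [_ H] := Hb x; rewrite -mulrA.
    apply: le_trans (ler_wpM2l (ltW e2) H) _; rewrite mulrDr addrC lerD2l.
    by rewrite ler_piMl.
  - move=> x; have [H _] := Hb x; rewrite mulrDl mul1r addrC lerD//.
    by apply: le_trans (ms x); rewrite ler_piMl.
have [H1 H2 /andP[H3 _]] := Har r t r0 rt tT; rewrite /shifted; split=> x.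
  by rewrite opprD addrACA subrr add0r.
rewrite mulrDr; apply: lerD => //.
rewrite -[leLHS]mul1r; apply: ler_wpM2r; first by rewrite mulr_ge0// ltW.
by rewrite -expR0 ler_expR.
Qed.

(** The energy after one period is exactly [G] times the initial one, while Gronwall bounds it by
    $e^{aT+O(\eta)}$ times the initial one plus $O(1/n)$. *)
Theorem core_growth : 0 < T -> 0 <= K -> 0 <= L -> 0 < c -> 0 < G ->
  regular_forms s m a alpha t0 (t0 + 2 * T) K L c ->
  alpha (t0 + T) - alpha t0 = aT ->
  floquet_multiplier s m a Lam t0 T G -> floquet_grids s m a u Lam t0 T ->
  0 < m (u t0) (u t0) -> G <= expR aT.
Proof.
move=> T0 K0 L0 c0 G0 Hreg HaT [Ls Lm La _] [L1 [U [C [L10 U0 C0 [n0 Hn]]]]] mu0.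
apply: (@growth_limit R G aT T T0 G0) => eta e0 e1.
have [ps pm ms Ha Har] := Hreg; have [bs s0] := ps; have [bm m0] := pm.
have [Hsh Hshr] := shifted_props e0 e1 K0 c0 Hreg.
(* One constant for three roles: the Lipschitz bound [L] of the forms, the bound [2 * L * h] of
   $e^x-1$, and the consistency constant [L1]. *)
pose M := 2 * (L + L1); have M0 : 0 <= M by rewrite mulr_ge0// addr_ge0.
pose K1 := K + 1; have K10 : 0 <= K1 by rewrite addr_ge0.
pose CE := 2 * M + M * U + M * K1 * U + eta * K1 * U.
have CE0 : 0 <= CE by rewrite /CE; have eta0 := ltW e0; do ![apply: addr_ge0|apply: mulr_ge0].
have e2 : 0 < eta ^+ 2 by rewrite exprn_gt0.
(* Half of the lower bound of the potential energy at [u t0]; the other half pays for replacing one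
   argument by the next grid point. *)
pose beta := eta ^+ 2 * m (u t0) (u t0) / 2.
have b0 : 0 < beta by rewrite divr_gt0// mulr_gt0.
exists beta, (2 * (CE * C)); split=> //; first by rewrite !mulr_ge0.
have [N1 _ HN1] : \forall n \near \oo, T < n%:R by exact: nbhs_infty_gtr.
(* Beyond [N2], $2Lh+\eta h\le1$, so [y] and all [x k] are at most $1/2$; beyond [N3], the first
   increment is too small to consume [beta]. *)
have [N2 _ HN2] : \forall n \near \oo, T * (2 * L) + eta * T < n%:R by exact: nbhs_infty_gtr.
have [N3 _ HN3] : \forall n \near \oo, C * (K1 * U / beta) ^+ 2 < n%:R by exact: nbhs_infty_gtr.
exists (maxn n0 (maxn N1 (maxn N2 N3))) => n; rewrite !geq_max => /and4P[nn0 nN1 nN2 nN3].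
have {}HN1 := HN1 n.+1 (leq_trans nN1 (leqnSn _)).
have {}HN2 := HN2 n.+1 (leq_trans nN2 (leqnSn _)).
have {}HN3 := HN3 n.+1 (leq_trans nN3 (leqnSn _)).
have [nu [Hg Hs HL1 HL2]] := Hn n nn0; move: Hg Hs HL1 HL2; rewrite -/(T / n.+1%:R).
set h := T / n.+1%:R => Hg Hs HL1 HL2.
have n1 : 0 < n.+1%:R :> R by rewrite ltr0n.
have h0 : 0 < h by rewrite divr_gt0.
have nh : n.+1%:R * h = T by rewrite /h mulrCA mulfV ?mulr1// gt_eqF.
pose t k := t0 + k%:R * h.
have tS k : t k.+1 = t k + h by rewrite /t -natr1 mulrDl mul1r addrA.
have tn : t n.+1 = t0 + T by rewrite /t nh.
have t00 : t 0%N = t0 by rewrite /t mul0r addr0.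
have hT : h <= T by rewrite ler_pdivrMr// ler_peMr ?(ltW T0)// ler1n.
have tlo k : t0 <= t k by rewrite lerDl mulr_ge0// ltW.
have thi k : (k <= n.+1)%N -> t k <= t0 + T.
  by move=> kn; rewrite -tn lerD2l ler_pM2r// ler_nat.
have thi2 k : (k <= n.+1)%N -> t k <= t0 + 2 * T.
  by move=> kn; apply: le_trans (thi k kn) _; rewrite lerD2l mulr_natl mulr2n lerDl ltW.
pose b k := shifted eta (t k).
have Lh : L * h * 2 + eta * h <= 1.
  rewrite (_ : _ + _ = (T * (2 * L) + eta * T) / n.+1%:R); last by rewrite /h; ring.
  by rewrite ler_pdivrMr// mul1r ltW.
pose y := eta * h / 2.
have y0 : 0 <= y by rewrite divr_ge0// mulr_ge0 ?ltW.
have y1 : y <= 1 / 2 by have := mulr_ge0 (mulr_ge0 L0 (ltW h0)) (ler0n R 2); rewrite /y; lra.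
(* The maximum changes nothing within the period; it gives nonnegativity at every index, as the
   Gronwall lemma asks. *)
pose x k := Num.max 0 (alpha (t k.+1) - alpha (t k)).
pose P k := m (u (t k.+1) - u (t k)) (u (t k.+1) - u (t k)) / h ^+ 2 +
  b k (u (t k.+1)) (u (t k)).
have tle k : t k <= t k.+1 by rewrite tS lerDl ltW.
have xE k : (k < n.+1)%N -> x k = alpha (t k.+1) - alpha (t k) /\ x k <= L * h.
  move=> kn; have [_ _ /andP[x0 xL]] := Har (t k) (t k.+1) (tlo k) (tle k) (thi2 _ kn).
  rewrite /x (max_idPr x0); split=> //; apply: le_trans xL _.
  by rewrite tS addrAC subrr add0r.
have expx k : (k < n.+1)%N -> expR (x k) - 1 <= 2 * L * h.
  move=> /xE[_ xL]; have xh : x k <= 1 / 2.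
    by apply: le_trans xL _; have := mulr_ge0 (ltW e0) (ltW h0); lra.
  have x0 : 0 <= x k by rewrite le_max lexx.
  by apply: le_trans (expRB1_le x0 xh) _; rewrite -mulrA ler_pM2l.
have stepP k : (k < n.+1)%N ->
    (1 - y) * P k.+1 <= (1 + (expR (x k) - 1) + y) * P k + CE * nu k ^+ 2.
  move=> kn; have [SD d1 d2 hnu [nk0 nk1]] := Hg k kn.
  have [pb0 em0 _ bK0] := Hsh (t k) (introT andP (conj (tlo k) (thi2 k (ltnW kn)))).
  have [pb1 em1 _ bK1] := Hsh (t k.+1) (introT andP (conj (tlo k.+1) (thi2 k.+1 kn))).
  have [bdif bth] := Hshr (t k) (t k.+1) (tlo k) (tle k) (thi2 _ kn).
  have hE : t k.+1 - t k = h by rewrite tS addrAC subrr add0r.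
  rewrite hE in bdif; have [xk _] := xE k kn.
  have nuk0 : 0 <= nu k by apply: le_trans hnu; exact: ltW.
  apply: (@step_energy _ _ s m (b k) (b k.+1) (u (t k)) (u (t k.+1)) (u (t k.+2)) K1 M U h _ eta (nu k)) => //.
  - exact: ltW.
  - move=> z; apply: le_trans (bdif z) _; rewrite ler_wpM2r// ler_wpM2r ?(ltW h0)//.
    by case: (double_sum_bounds L0 L10).
  - by move=> z; rewrite subrKC xk; exact: bth.
  - by rewrite subr_ge0 -expR0 ler_expR le_max lexx.
  - by apply: le_trans (expx k kn) _; rewrite ler_wpM2r ?(ltW h0)//; case: (double_sum_bounds L0 L10).
  - move=> w; have := SD w.
    rewrite (_ : b k.+1 w _ - _ = a (t k.+1) w (u (t k.+1))); last by rewrite /b /shifted addrAC subrr add0r.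
    move=> /le_trans; apply; rewrite ler_wpM2l ?sqr_ge0// ler_wpM2r ?nrm_ge0// ler_wpM2r//.
    by case: (double_sum_bounds L0 L10).
have x0 k : 0 <= x k by rewrite le_max lexx.
have ex0 k : 0 <= expR (x k) - 1 by rewrite subr_ge0 -expR0 ler_expR.
have r0 k : 0 <= CE * nu k ^+ 2 by rewrite mulr_ge0 ?sqr_ge0.
have GW := discrete_gronwall y0 y1 ex0 r0 stepP.
have FW := gronwall_factor n.+1 y0 y1 x0.
have sumx : \sum_(k < n.+1) x k = aT.
  rewrite -HaT -tn -t00 -(big_mkord xpredT x) (eq_big_nat _ _ (F2 := fun k => alpha (t k.+1) - alpha (t k))).
    by rewrite telescope_sumr.
  by move=> k /andP[_ kn]; have [] := xE k kn.
rewrite sumx (_ : 3 * (_ * y) = 3 * (eta * T / 2)) in FW; last by rewrite -nh /y; ring.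
have bnd k z w : (k <= n.+1)%N -> `|b k z w| <= K1 * nrm s z * nrm s w.
  move=> kn; have [pb _ _ bK] := Hsh (t k) (introT andP (conj (tlo k) (thi2 k kn))).
  exact: psd_bound.
have bndm z w : `|m z w| <= 1 * nrm s z * nrm s w.
  by apply: psd_bound => // v; rewrite mul1r.
have bnds z w : `|s z w| <= 1 * nrm s z * nrm s w by rewrite mul1r; exact: psd_CS.
(* All forms are dominated by [s], hence blind to its null vectors, so the translated points may be
   replaced by their images under [Lam]. *)
have PG : P n.+1 = G * P 0%N.
  have tn1 : t n.+2 = t0 + T + h by rewrite tS tn.
  have t1 : t 1%N = t0 + h by rewrite tS t00.
  have bt k z w : t k = t0 + T -> b k (Lam z) (Lam w) = G * shifted eta t0 z w.
    move=> tk; rewrite /b /shifted tk Lm La; first by ring.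
    by rewrite lexx lerDl ltW.
  have bb k : (k <= n.+1)%N -> bilin (b k).
    by move=> kn; have [[bb _] _ _ _] := Hsh (t k) (introT andP (conj (tlo k) (thi2 k kn))).
  rewrite /P tn tn1 t1 t00.
  set v0 := u t0 in HL1 *; set v1 := u (t0 + h) in HL2 *.
  set w0 := u (t0 + T) in HL1 *; set w1 := u (t0 + T + h) in HL2 *.
  have -> : b n.+1 w1 w0 = G * shifted eta t0 v1 v0.
    rewrite -(bt n.+1)//.
    rewrite (psd0_bilin w0 ps (bb _ (leqnn _)) K10 (fun z w => bnd _ z w (leqnn _)) HL2).
    rewrite bilinC; last exact: bb.
    rewrite (psd0_bilin (Lam v1) ps (bb _ (leqnn _)) K10 (fun z w => bnd _ z w (leqnn _)) HL1).
    by rewrite bilinC//; exact: bb.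
  have mm z w v v' : s (v - Lam z) (v - Lam z) = 0 -> s (v' - Lam w) (v' - Lam w) = 0 ->
      m v v' = G * m z w.
    move=> H1 H2; rewrite -Lm (psd0_bilin v' ps bm ler01 bndm H1) bilinC//.
    by rewrite (psd0_bilin (Lam z) ps bm ler01 bndm H2) bilinC.
  have -> : m (w1 - w0) (w1 - w0) = G * m (v1 - v0) (v1 - v0).
    rewrite !(bilinBl _ _ _ bm) !(bilinBr _ _ _ bm) (mm v1 v1 w1 w1)// (mm v1 v0 w1 w0)// (mm v0 v1 w0 w1)// (mm v0 v0 w0 w0)//; ring.
  by rewrite /b t00; ring.
have Pbeta : beta <= P 0%N.
  rewrite /P tS t00.
  have /= [_ d1 _ _ [nk0 _]] := Hg 0%N (ltn0Sn _).
  rewrite mul0r addr0 mul1r in d1 nk0.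
  have nu0 : 0 <= nu 0%N by apply: le_trans d1; exact: nrm_ge0.
  have nusq : nu 0%N ^+ 2 <= C / n.+1%:R.
    by apply: le_trans Hs; rewrite big_ord_recl lerDl sumr_ge0// => k _; rewrite sqr_ge0.
  have [pb0 em0 _ _] := Hsh t0 (introT andP (conj (lexx t0) (eq_ind _ (fun z => z <= _) (thi2 0%N isT) _ t00))).
  have B1 := em0 (u t0); have [bb0 _] := pb0.
  have := bnd 0%N (u (t0 + h) - u t0) (u t0) isT; rewrite /b t00 bilinBl// ler_norml => /andP[B2 _].
  have B3 : K1 * nrm s (u (t0 + h) - u t0) * nrm s (u t0) <= K1 * nu 0%N * U.
    by rewrite ler_pM ?mulr_ge0 ?nrm_ge0// ler_wpM2l.
  have B4 : K1 * nu 0%N * U <= beta.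
    have b1 := ltW b0; have KU : 0 <= K1 * nu 0%N * U by rewrite !mulr_ge0.
    rewrite -(@ler_pXn2r _ 2)// ?nnegrE//.
    rewrite (_ : (K1 * nu 0%N * U) ^+ 2 = (K1 * U) ^+ 2 * nu 0%N ^+ 2); last by ring.
    apply: le_trans (ler_wpM2l (sqr_ge0 _) nusq) _.
    rewrite mulrA ler_pdivrMr//; move: HN3; rewrite expr_div_n mulrA ltr_pdivrMr ?exprn_gt0// => H.
    by rewrite mulrC [leRHS]mulrC ltW.
  have B5 : 0 <= m (u (t0 + h) - u t0) (u (t0 + h) - u t0) / h ^+ 2.
    by rewrite divr_ge0// sqr_ge0.
  move: B1; rewrite (_ : eta ^+ 2 * _ = 2 * beta); last by rewrite /beta; field.
  by move=> B1; exact: (lower_bound_step B5 B2 B3 B4 B1).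
exists (P 0%N) => //.
have P0 : 0 <= P 0%N + 2 * \sum_(k < n.+1) CE * nu k ^+ 2.
  apply: addr_ge0; first exact: le_trans (ltW b0) Pbeta.
  by apply: mulr_ge0 => //; apply: sumr_ge0 => k _; exact: r0.
rewrite -PG; apply: le_trans GW _.
apply: le_trans (ler_wpM2r P0 FW) _; rewrite ler_wpM2l ?expR_ge0// lerD2l -mulr_sumr.
by rewrite -!mulrA ler_pM2l// ler_wpM2l.
Qed.

(** The dual energy is followed backwards: [F 0] is at most $e^{aT+O(\eta)}$ times [F n.+1] plus
    $O(1/n)$, and [F n.+1] is [G * F 0]. So [growth_limit] applies to $G^{-1}$ with [P] equal to
    [G * F 0]. *)
Theorem core_decay : 0 < T -> 0 <= K -> 0 <= L -> 0 < c -> 0 < G -> G <= 1 ->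
  regular_forms s m a alpha t0 (t0 + 2 * T) K L c ->
  (forall t, t0 <= t <= t0 + T -> alpha (t + T) - alpha t = aT) ->
  floquet_multiplier s m a Lam t0 T G -> floquet_grids s m a u Lam t0 T ->
  0 < m (u t0) (u t0) -> G^-1 <= expR aT.
Proof.
move=> T0 K0 L0 c0 G0 G1 Hreg HaT [Ls Lm La [Lam' LamK]] [L1 [U [C [L10 U0 C0 [n0 Hn]]]]] mu0.
have Gi0 : 0 < G^-1 by rewrite invr_gt0.
apply: (@growth_limit R G^-1 aT T T0 Gi0) => eta e0 e1.
have [ps pm ms Ha Har] := Hreg; have [bs s0] := ps; have [bm m0] := pm.
have [Hsh Hshr] := shifted_props e0 e1 K0 c0 Hreg.
pose M := 2 * (L + L1); have M0 : 0 <= M by rewrite mulr_ge0// addr_ge0.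
pose K1 := K + 1; have K10 : 0 <= K1 by rewrite addr_ge0.
pose ce := eta ^+ 2 * c.
have ce0 : 0 < ce by rewrite mulr_gt0// exprn_gt0.
have [B BE B0] : exists2 B, B = 2 / ce & 0 <= B.
  by exists (2 / ce) => //; rewrite divr_ge0// ltW.
have [B' B'E B'0] : exists2 B', B' = (K1 * U + eta ^+ 2 * U + M + 2 + M * B) / ce & 0 <= B'.
  exists ((K1 * U + eta ^+ 2 * U + M + 2 + M * B) / ce) => //.
  have e20 := sqr_ge0 eta; apply: divr_ge0; last exact: ltW.
  by do ![apply: addr_ge0 => //|apply: mulr_ge0 => //].
pose CE := 4 * B + 2 * M * B + 2 * U + M * B * U + M * B * B' + eta * U + M * U.
have CE0 : 0 <= CE by rewrite /CE; have eta0 := ltW e0; do ![apply: addr_ge0|apply: mulr_ge0].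
have e2 : 0 < eta ^+ 2 by rewrite exprn_gt0.
pose beta := m (u t0) (u t0) / 2.
have b0 : 0 < beta by rewrite divr_gt0.
exists (G * beta), (2 * (CE * C)); split; [by rewrite mulr_gt0|by rewrite !mulr_ge0|].
have [N1 _ HN1] : \forall n \near \oo, T < n%:R by exact: nbhs_infty_gtr.
have [N2 _ HN2] : \forall n \near \oo, T * (2 * L) + eta * T < n%:R by exact: nbhs_infty_gtr.
have [N3 _ HN3] : \forall n \near \oo, C * (U / beta) ^+ 2 < n%:R by exact: nbhs_infty_gtr.
exists (maxn n0 (maxn N1 (maxn N2 N3))) => n; rewrite !geq_max => /and4P[nn0 nN1 nN2 nN3].
have {}HN1 := HN1 n.+1 (leq_trans nN1 (leqnSn _)).
have {}HN2 := HN2 n.+1 (leq_trans nN2 (leqnSn _)).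
have {}HN3 := HN3 n.+1 (leq_trans nN3 (leqnSn _)).
have [nu [Hg Hs HL1 HL2]] := Hn n nn0; move: Hg Hs HL1 HL2; rewrite -/(T / n.+1%:R).
set h := T / n.+1%:R => Hg Hs HL1 HL2.
have n1 : 0 < n.+1%:R :> R by rewrite ltr0n.
have h0 : 0 < h by rewrite divr_gt0.
have nh : n.+1%:R * h = T by rewrite /h mulrCA mulfV ?mulr1// gt_eqF.
pose t k := t0 + k%:R * h.
have tS k : t k.+1 = t k + h by rewrite /t -natr1 mulrDl mul1r addrA.
have tn : t n.+1 = t0 + T by rewrite /t nh.
have t00 : t 0%N = t0 by rewrite /t mul0r addr0.
have h1 : h <= 1 by rewrite ler_pdivrMr// mul1r ltW.
have hT : h <= T by rewrite ler_pdivrMr// ler_peMr ?(ltW T0)// ler1n.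
have tlo k : t0 <= t k by rewrite lerDl mulr_ge0// ltW.
have thi k : (k <= n.+1)%N -> t k <= t0 + T.
  by move=> kn; rewrite -tn lerD2l ler_pM2r// ler_nat.
have thi2 k : (k <= n.+2)%N -> t k <= t0 + 2 * T.
  move=> kn; apply: (@le_trans _ _ (t n.+2)); first by rewrite lerD2l ler_pM2r// ler_nat.
  by rewrite tS tn mulr_natl mulr2n addrA lerD2l.
pose b k := shifted eta (t k).
have Lh : L * h * 2 + eta * h <= 1.
  rewrite (_ : _ + _ = (T * (2 * L) + eta * T) / n.+1%:R); last by rewrite /h; ring.
  by rewrite ler_pdivrMr// mul1r ltW.
pose y := eta * h / 2.
have y0 : 0 <= y by rewrite divr_ge0// mulr_ge0 ?ltW.
have y1 : y <= 1 / 2 by have := mulr_ge0 (mulr_ge0 L0 (ltW h0)) (ler0n R 2); rewrite /y; lra.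
(* The velocity between [t i] and [t i.+1] is represented with the form at [t i.+1], so the
   exponents run from [t 1] to [t n.+2]. This is why the increment of [alpha] over a period must be
   [aT] from every starting point. *)
pose x k := Num.max 0 (alpha (t k.+2) - alpha (t k.+1)).
have tle k : t k <= t k.+1 by rewrite tS lerDl ltW.
have xE k : (k < n.+1)%N -> x k = alpha (t k.+2) - alpha (t k.+1) /\ x k <= L * h.
  move=> kn; have [_ _ /andP[x0 xL]] := Har (t k.+1) (t k.+2) (tlo _) (tle _) (thi2 k.+2 kn).
  rewrite /x (max_idPr x0); split=> //; apply: le_trans xL _.
  by rewrite (tS k.+1) addrAC subrr add0r.
have expx k : (k < n.+1)%N -> expR (x k) - 1 <= 2 * L * h.
  move=> /xE[_ xL]; have xh : x k <= 1 / 2.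
    by apply: le_trans xL _; have := mulr_ge0 (ltW e0) (ltW h0); lra.
  have x0 : 0 <= x k by rewrite le_max lexx.
  by apply: le_trans (expRB1_le x0 xh) _; rewrite -mulrA ler_pM2l.
have bndm z w : `|m z w| <= nrm s z * nrm s w.
  by rewrite -[nrm s z]mul1r; apply: psd_bound => // v; rewrite mul1r.
have bndm1 z w : `|m z w| <= 1 * nrm s z * nrm s w by rewrite mul1r.
have mdiff v v' z z' w : s (v - Lam z) (v - Lam z) = 0 -> s (v' - Lam z') (v' - Lam z') = 0 ->
    m (v - v') w = m (Lam z - Lam z') w.
  move=> H1 H2; rewrite !(bilinBl _ _ _ bm); congr (_ - _).
    exact: psd0_bilin ps bm ler01 bndm1 H1.
  exact: psd0_bilin ps bm ler01 bndm1 H2.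
have t1 : t 1%N = t0 + h by rewrite tS t00.
have tn1 : t n.+2 = t0 + T + h by rewrite tS tn.
have bshift z w : b n.+2 (Lam z) (Lam w) = G * b 1%N z w.
  rewrite /b /shifted tn1 t1 addrAC Lm La; first by ring.
  by rewrite lerDl (ltW h0)/= lerD2l.
have nrmLam z : nrm s (Lam z) = Num.sqrt G * nrm s z.
  by rewrite /nrm Ls sqrtrM// ltW.
have /choice[psi Hpsi] : forall i, exists phi, (i <= n.+1)%N -> forall w,
    `|b i.+1 phi w - h^-1 * m (u (t i.+1) - u (t i)) w| <= h ^+ 2 * nrm s w.
  move=> i; have [lin|ni] := leqP i n.+1; last by exists 0.
  have [[bb b0'] _ bc bK] := Hsh (t i.+1) (introT andP (conj (tlo i.+1) (thi2 i.+1 lin))).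
  pose ell w := h^-1 * m (u (t i.+1) - u (t i)) w.
  have elll (k : R) x' y' : ell (k *: x' + y') = k * ell x' + ell y'.
    by rewrite /ell (bilinDr _ _ _ bm) (bilinZr _ _ _ bm); ring.
  have ellb x' : `|ell x'| <= h^-1 * nrm s (u (t i.+1) - u (t i)) * nrm s x'.
    by rewrite normrM ger0_norm ?invr_ge0 ?(ltW h0)// -mulrA ler_wpM2l ?invr_ge0 ?(ltW h0).
  have [phi Hphi] := approx_Riesz ps bb ce0 K10 (exprn_gt0 2 h0) bc bK elll ellb.
  by exists phi.
(* Approximate representers are not unique. Taking [Lam] of the first one as the last makes the
   energies at the two ends differ by exactly [G]. *)
pose ps' i := if i == n.+1 then Lam (psi 0%N) else psi i.
have Hps' i : (i <= n.+1)%N -> forall w,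
    `|b i.+1 (ps' i) w - h^-1 * m (u (t i.+1) - u (t i)) w| <= h ^+ 2 * nrm s w.
  rewrite leq_eqVlt /ps'; case: eqP => [->|_] /= lin w; last exact: (Hpsi i (ltnW lin)).
  have H := Hpsi 0%N isT (Lam' w); rewrite t1 t00 in H.
  rewrite -[w]LamK bshift nrmLam tn1 tn (mdiff _ _ _ _ _ HL2 HL1).
  rewrite (bilinBl _ _ _ bm) !Lm -mulrBr -(bilinBl _ _ _ bm).
  rewrite mulrCA -mulrBr normrM (ger0_norm (ltW G0)).
  apply: le_trans (ler_wpM2l (ltW G0) H) _.
  rewrite mulrCA ler_wpM2l ?sqr_ge0// ler_wpM2r ?nrm_ge0//.
  (* Here $G\le1$ enters: [Lam] multiplies the error by $G$ but norms by $\sqrt G$ only, and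
     $G\le\sqrt G$. *)
  rewrite -[leLHS](sqr_sqrtr (ltW G0)) expr2 ler_piMr ?sqrtr_ge0//.
  by rewrite -sqrtr1 ler_wsqrtr.
pose F i := b i.+1 (ps' i) (ps' i) + m (u (t i.+1)) (u (t i)).
have stepF k : (k < n.+1)%N ->
    (1 - y) * F k <= (1 + (expR (x k) - 1) + y) * F k.+1 + CE * nu k ^+ 2.
  move=> kn; have [SD d1 d2 hnu [nk0 nk1]] := Hg k kn.
  have [pb0 em0 bc0 bK0] := Hsh (t k.+1) (introT andP (conj (tlo k.+1) (thi2 k.+1 (ltnW kn)))).
  have [pb1 em1 bc1 bK1] := Hsh (t k.+2) (introT andP (conj (tlo k.+2) (thi2 k.+2 kn))).
  have [bdif bth] := Hshr (t k.+1) (t k.+2) (tlo _) (tle _) (thi2 k.+2 kn).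
  have hE : t k.+2 - t k.+1 = h by rewrite (tS k.+1) addrAC subrr add0r.
  rewrite hE in bdif; have [xk _] := xE k kn.
  have nuk0 : 0 <= nu k by apply: le_trans hnu; exact: ltW.
  apply: (@step_dual_energy _ _ s m (b k.+1) (b k.+2) (u (t k)) (u (t k.+1)) (u (t k.+2))
    (ps' k) (ps' k.+1) K1 M U ce B B' h _ eta (nu k)) => //.
  - exact: ltW.
  - move=> z; apply: le_trans (bdif z) _; rewrite ler_wpM2r// ler_wpM2r ?(ltW h0)//.
    by case: (double_sum_bounds L0 L10).
  - by move=> z; rewrite subrKC xk; exact: bth.
  - by rewrite subr_ge0 -expR0 ler_expR le_max lexx.
  - by apply: le_trans (expx k kn) _; rewrite ler_wpM2r ?(ltW h0)//; case: (double_sum_bounds L0 L10).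
  - move=> w; have := SD w.
    rewrite (_ : b k.+1 w _ - _ = a (t k.+1) w (u (t k.+1))); last by rewrite /b /shifted addrAC subrr add0r.
    move=> /le_trans; apply; rewrite ler_wpM2l ?sqr_ge0// ler_wpM2r ?nrm_ge0// ler_wpM2r//.
    by case: (double_sum_bounds L0 L10).
  - exact: Hps' (ltnW kn).
  - exact: Hps' kn.
have x0 k : 0 <= x k by rewrite le_max lexx.
have ex0 k : 0 <= expR (x k) - 1 by rewrite subr_ge0 -expR0 ler_expR.
have r0 k : 0 <= CE * nu k ^+ 2 by rewrite mulr_ge0 ?sqr_ge0.
(* The Gronwall lemma is applied to the sequence read from its end; the product and the sum are then
   reindexed back. *)
have GW : F 0%N <= (\prod_(k < n.+1) ((1 + (expR (x k) - 1) + y) / (1 - y))) *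
    (F n.+1 + 2 * \sum_(k < n.+1) CE * nu k ^+ 2).
  have := @discrete_gronwall _ (fun k => F (n.+1 - k)%N) (fun k => expR (x (n.+1 - k.+1)%N) - 1)
    (fun k => CE * nu (n.+1 - k.+1)%N ^+ 2) y n.+1 y0 y1 (fun k => ex0 _) (fun k => r0 _).
  have rk (k : 'I_n.+1) : (n.+1 - (rev_ord k).+1)%N = k.
    by rewrite /= !subSS subKn// -ltnS.
  rewrite subnn subn0 (reindex_inj rev_ord_inj) [X in _ + 2 * X](reindex_inj rev_ord_inj).
  under eq_bigr do rewrite rk.
  under [X in _ + 2 * X]eq_bigr do rewrite rk.
  apply=> k kn; rewrite (_ : (n.+1 - k)%N = (n.+1 - k.+1).+1); last by rewrite subSS subSn.
  by apply: stepF; rewrite subSS ltnS leq_subr.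
have FW := gronwall_factor n.+1 y0 y1 x0.
have sumx : \sum_(k < n.+1) x k = aT.
  rewrite -(HaT (t 1%N)); last by rewrite tlo thi.
  rewrite (_ : t 1%N + T = t n.+2); last by rewrite t1 tn1 addrAC.
  rewrite -(big_mkord xpredT x).
  rewrite (eq_big_nat _ _ (F2 := fun k => alpha (t k.+2) - alpha (t k.+1))).
    by rewrite (telescope_sumr (fun k => alpha (t k.+1))).
  by move=> k /andP[_ kn]; have [] := xE k kn.
rewrite sumx (_ : 3 * (_ * y) = 3 * (eta * T / 2)) in FW; last by rewrite -nh /y; ring.
have FG : F n.+1 = G * F 0%N.
  have psn : ps' n.+1 = Lam (psi 0%N) by rewrite /ps' eqxx.
  have ps0 : ps' 0%N = psi 0%N by [].
  rewrite /F psn ps0 bshift tn tn1 t1 t00 [RHS]mulrDr; congr (_ + _).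
  rewrite (psd0_bilin _ ps bm ler01 bndm1 HL2) bilinC//.
  by rewrite (psd0_bilin _ ps bm ler01 bndm1 HL1) bilinC// Lm.
have Fbeta : beta <= F 0%N.
  rewrite /F t1 t00.
  have /= [_ d1 _ _ [nk0 _]] := Hg 0%N (ltn0Sn _).
  rewrite mul0r addr0 mul1r in d1 nk0.
  have nu0 : 0 <= nu 0%N by apply: le_trans d1; exact: nrm_ge0.
  have nusq : nu 0%N ^+ 2 <= C / n.+1%:R.
    by apply: le_trans Hs; rewrite big_ord_recl lerDl sumr_ge0// => k _; rewrite sqr_ge0.
  have [[_ b0'] _ _ _] := Hsh (t 1%N) (introT andP (conj (tlo 1%N) (thi2 1%N isT))).
  have B1 := b0' (ps' 0%N).
  have := bndm (u (t0 + h) - u t0) (u t0); rewrite (bilinBl _ _ _ bm) ler_norml => /andP[B2 _].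
  have B3 : nrm s (u (t0 + h) - u t0) * nrm s (u t0) <= nu 0%N * U.
    by rewrite ler_pM ?nrm_ge0.
  have B4 : nu 0%N * U <= beta.
    have b1 := ltW b0; have KU : 0 <= nu 0%N * U by rewrite !mulr_ge0.
    rewrite -(@ler_pXn2r _ 2)// ?nnegrE//.
    rewrite (_ : (nu 0%N * U) ^+ 2 = U ^+ 2 * nu 0%N ^+ 2); last by ring.
    apply: le_trans (ler_wpM2l (sqr_ge0 _) nusq) _.
    rewrite mulrA ler_pdivrMr//; move: HN3; rewrite expr_div_n mulrA ltr_pdivrMr ?exprn_gt0// => H.
    by rewrite mulrC [leRHS]mulrC ltW.
  have B5 : m (u t0) (u t0) = 2 * beta by rewrite /beta; field.
  by apply: (lower_bound_step _ B2 B3 B4); [exact: B1|rewrite B5].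
exists (G * F 0%N); first by rewrite ler_pM2l.
have P0 : 0 <= F n.+1 + 2 * \sum_(k < n.+1) CE * nu k ^+ 2.
  apply: addr_ge0; first by rewrite FG mulr_ge0 ?(ltW G0)// (le_trans (ltW b0)).
  by apply: mulr_ge0 => //; apply: sumr_ge0 => k _; exact: r0.
rewrite mulKf ?gt_eqF// -FG; apply: le_trans GW _.
apply: le_trans (ler_wpM2r P0 FW) _; rewrite ler_wpM2l ?expR_ge0// lerD2l -mulr_sumr.
by rewrite -!mulrA ler_pM2l// ler_wpM2l.
Qed.

End core.

(** * Second differences of weak solutions *)

Section integral_monotone.
Import HBNNSimple.
Context d {T : measurableType d} {R : realType} (mu : {measure set T -> \bar R}).
Local Open Scope ereal_scope.

Lemma aeS (P Q : T -> Prop) : (forall x, P x -> Q x) ->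
  (\forall x \ae mu, P x) -> \forall x \ae mu, Q x.
Proof. by move=> PQ; exact: filterS. Qed.

Lemma ae_and (P Q : T -> Prop) : (\forall x \ae mu, P x) ->
  (\forall x \ae mu, Q x) -> \forall x \ae mu, P x /\ Q x.
Proof. by move=> p q; exact: filterI. Qed.

(* Monotonicity without measurability: the integral of a nonnegative function
   is a supremum over simple functions below it. *)
Lemma ge0_le_integral_ae (f g : T -> \bar R) :
  (forall x, 0 <= f x) -> (forall x, 0 <= g x) ->
  (\forall x \ae mu, f x <= g x) -> \int[mu]_x f x <= \int[mu]_x g x.
Proof.
move=> f0 g0 [N [mN N0 fgN]].
rewrite ge0_integralTE//; apply: ge_ereal_sup => _ [h /= hf <-].
rewrite -integralT_nnsfun.
have -> : \int[mu]_x (h x)%:E = \int[mu]_x ((h x * \1_(~` N) x)%:E).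
  apply: ae_eq_integral => //.
  - by apply/measurable_EFinP; exact: measurable_funPT.
  - apply/measurable_EFinP; apply: measurable_funM; first exact: measurable_funPT.
    by apply: measurable_indic; exact: measurableC.
  exists N; split=> // x /= /not_implyP[_]; apply: contra_notP => xN.
  by rewrite indicE mem_set// mulr1.
have mN' : measurable (~` N) by exact: measurableC.
pose k : {nnsfun T >-> R} := mul_nnsfun h (indic_nnsfun R mN').
rewrite (_ : \int[mu]_x _ = \int[mu]_x (k x)%:E); last first.
  by apply: eq_integral => x _ /=.
rewrite (integralT_nnsfun mu k) [leRHS]ge0_integralTE//.
have kE x : k x = (h x * \1_(~` N) x)%R by [].
apply: ereal_sup_ubound; exists k => // x; rewrite kE.
have [xN|xN] := pselect (N x).
  by rewrite indicE memNset ?mulr0//; apply.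
rewrite indicE mem_set// mulr1; apply: le_trans (hf x) _.
by apply: contra_notT xN => /negP H; apply: fgN.
Qed.

Lemma le_integral_ae (D : set T) (f g : T -> \bar R) :
  (\forall x \ae mu, D x -> f x <= g x) -> \int[mu]_(x in D) f x <= \int[mu]_(x in D) g x.
Proof.
move=> fg; rewrite integral_mkcond [leRHS]integral_mkcond.
have {}fg : \forall x \ae mu, (f \_ D) x <= (g \_ D) x.
  by apply: filterS fg => x H; rewrite !patchE; case: ifPn => //; rewrite inE; exact: H.
rewrite integralE [leRHS]integralE; apply: leeB.
  apply: ge0_le_integral_ae => //; apply: filterS fg => x H.
  by rewrite !funeposE ge_max !le_max H lexx orbT.
apply: ge0_le_integral_ae => //; apply: filterS fg => x H.
by rewrite !funenegE ge_max !le_max leeN2 H lexx orbT.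
Qed.

Lemma le_Rintegral_ae (D : set T) (J f J' : T -> R) : measurable D ->
  mu.-integrable D (EFin \o J) -> mu.-integrable D (EFin \o J') ->
  (\forall x \ae mu, D x -> (J x <= f x <= J' x)%R) ->
  (\int[mu]_(x in D) J x <= \int[mu]_(x in D) f x <= \int[mu]_(x in D) J' x)%R.
Proof.
move=> mD IJ IJ' JfJ'; rewrite /Rintegral.
have fJ := integrable_fin_num mD IJ; have fJ' := integrable_fin_num mD IJ'.
have H1 : \int[mu]_(x in D) (J x)%:E <= \int[mu]_(x in D) (f x)%:E.
  by apply: le_integral_ae; apply: filterS JfJ' => x H /H /andP[? _]; rewrite lee_fin.
have H2 : \int[mu]_(x in D) (f x)%:E <= \int[mu]_(x in D) (J' x)%:E.
  by apply: le_integral_ae; apply: filterS JfJ' => x H /H /andP[_ ?]; rewrite lee_fin.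
have ff : \int[mu]_(x in D) (f x)%:E \is a fin_num.
  by rewrite fin_numE -!ltNye -?ltey (lt_le_trans _ H1) ?(le_lt_trans H2)//
    ?ltNye_eq ?ltey_eq ?fJ ?fJ'.
by apply/andP; split; apply: fine_le.
Qed.

End integral_monotone.

Section line_integrals.
Context {R : realType}.
Local Notation leb := (@lebesgue_measure R).
Implicit Types (f F : R -> R).

Lemma integral_deriv_support f F (A B : R) : A < B -> continuous f ->
  (forall x : R, is_derive x (1:R) F (f x)) -> (forall x, ~~ (A < x < B) -> f x = 0) ->
  leb.-integrable setT (EFin \o f) /\ \int[leb]_x f x = F B - F A.
Proof.
move=> AB cf dF f0.
have fE : f = f \_ `[A, B].
  apply/funext => x; rewrite patchE; case: ifPn => //; rewrite notin_setE/= in_itv/= => H.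
  by apply: f0; apply/negP => /andP[/ltW A1 /ltW B1]; apply: H; rewrite A1 B1.
have iAB : leb.-integrable `[A, B] (EFin \o f) by exact: continuous_integrable_itv.
split.
  have := (@integrable_mkcond _ _ _ leb `[A, B]%classic (EFin \o f) (measurable_itv _)).1 iAB.
  by congr (_.-integrable _ _); rewrite {2}fE; apply/funext => x /=; rewrite !patchE; case: ifP.
rewrite fE -Rintegral_mkcond /Rintegral.
have cF x : {for x, continuous F}.
  by apply/differentiable_continuous/derivable1_diffP; case: (dF x).
rewrite (@continuous_FTC2 _ f F A B)//.
- exact: continuous_subspaceT.
- split; first by move=> x _; case: (dF x).
    by apply: cvg_at_right_filter; exact: cF.
  by apply: cvg_at_left_filter; exact: cF.
- by move=> x _; rewrite derive1E; case: (dF x).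
Qed.

End line_integrals.

Section mollification.
Context {R : realType}.
Local Notation leb := (@lebesgue_measure R).
Implicit Types (f g F : R -> R).

Lemma is_derive_translate F (c x l : R) : is_derive (x + c) (1:R) F l ->
  is_derive x (1:R) (fun y => F (y + c)) l.
Proof.
move=> dF; rewrite -[l]mulr1.
apply: (@is_derive1_comp _ F (fun y => y + c)) => //.
by apply: is_derive_eq; rewrite addr0.
Qed.

Lemma is_derive_dilate F (c x l : R) : is_derive (c * x) (1:R) F l ->
  is_derive x (1:R) (fun y => F (c * y)) (l * c).
Proof.
move=> dF; apply: (@is_derive1_comp _ F (fun y => c * y)) => //.
by apply: is_derive_eq; rewrite /GRing.scale/= mulr1.
Qed.

Lemma smooth_affine f (a b : R) : smooth f -> smooth (fun y => f (a * y + b)).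
Proof.
move=> sf; apply: (@smooth_comp_affine _ _ (fun x => a * x + b)) (sf).
  by move=> x; apply/derivable1_diffP.
move=> v; exists (v * a) => x; rewrite deriveR; last by apply/derivable1_diffP.
by rewrite derive1E derive_val /GRing.scale/= mulr1 addr0.
Qed.

Lemma smooth_shift f (c : R) : smooth f -> smooth (fun y => f (y + c)).
Proof. by move=> /(smooth_affine 1 c); congr smooth; apply/funext => x; rewrite mul1r. Qed.

Lemma smooth_scale f (c : R) : smooth f -> smooth (fun y => f (c * y)).
Proof. by move=> /(smooth_affine c 0); congr smooth; apply/funext => x; rewrite addr0. Qed.

(** [C] does not depend on the width [e]; this uniformity is what Lebesgue points need. *)
Lemma mollifier_scaled : exists2 C : R, 0 < C & forall e : R, 0 < e ->
  exists rho S P : R -> R,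
  [/\ [/\ smooth rho, smooth S & smooth P],
      [/\ (forall x : R, is_derive x (1:R) S (rho x))
        & forall x : R, is_derive x (1:R) P (S x)],
      (forall x, 0 <= rho x <= C / e) /\ (forall x, e <= `|x| -> rho x = 0),
      [/\ (forall x, x <= - e -> S x = 0), (forall x, e <= x -> S x = 1),
        (forall x, 0 <= S x <= 1) & {homo S : x y / x <= y}]
    & forall x, x <= - e -> P x = 0].
Proof.
have [rho [S [P [[srho sS sP] [dS dP] [rho0 rhos] [S0 S1 S01] P0]]]] := @mollifier_exists R.
have [c _ Hc] : exists2 c, c \in `[-1, 1] & forall t, t \in `[-1, 1] -> rho t <= rho c.
  apply: EVT_max; first by lra.
  by apply: continuous_subspaceT; exact: smooth_continuous.
have Hc' t : rho t <= rho c + 1.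
  have [t1|t1] := leP `|t| 1.
    apply: le_trans (Hc t _) _; last by rewrite lerDl.
    by rewrite in_itv/= -ler_norml.
  by rewrite rhos ?ltW// ltr_wpDl.
exists (rho c + 1) => [|e e0]; first by rewrite ltr_wpDl.
have ei0 : 0 < e^-1 by rewrite invr_gt0.
have ee : e^-1 * e = 1 by rewrite mulVf// gt_eqF.
exists (fun x => e^-1 * rho (e^-1 * x)), (fun x => S (e^-1 * x)), (fun x => e * P (e^-1 * x)).
have Sm x y : x <= y -> S x <= S y.
  move=> xy; have [|z _ E] := @MVT_segment R S rho x y xy.
    by apply: continuous_subspaceT; exact: smooth_continuous.
  by rewrite -subr_ge0 E mulr_ge0// subr_ge0.
split.
- by split; [apply: smoothZ|idtac|apply: smoothZ]; exact: smooth_scale.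
- split=> x; first by rewrite mulrC; exact: is_derive_dilate.
  have := @is_deriveZ _ _ _ _ e x 1 _ (@is_derive_dilate P e^-1 x _ (dP _)).
  by rewrite /GRing.scale/= mulrCA mulfV ?mulr1// gt_eqF.
- split=> [x|x ex].
    by rewrite mulr_ge0 ?(ltW ei0)//= [leRHS]mulrC ler_pM2l.
  by rewrite rhos ?mulr0// normrM gtr0_norm// -ee ler_pM2l.
- split=> // [x xe|x xe|x y xy].
  + by rewrite S0// -ee -mulrN ler_pM2l.
  + by rewrite S1// -ee ler_pM2l.
  + by apply: Sm; rewrite ler_pM2l.
- by move=> x xe; rewrite P0 ?mulr0// -ee -mulrN ler_pM2l.
Qed.

Lemma is_derive_comb3 F f (a1 a2 a3 b1 b2 b3 x : R) :
  (forall y : R, is_derive y (1:R) F (f y)) ->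
  is_derive x (1:R) (fun y => a1 * F (y + b1) + a2 * F (y + b2) + a3 * F (y + b3))
    (a1 * f (x + b1) + a2 * f (x + b2) + a3 * f (x + b3)).
Proof.
move=> dF; have D b := is_derive_translate (dF (x + b)).
have H := is_deriveD (is_deriveD (is_deriveZ a1 (D b1)) (is_deriveZ a2 (D b2))) (is_deriveZ a3 (D b3)).
exact: H.
Qed.

(** The test function is a smoothed hat. Its second derivative is a combination of three approximate
    Dirac masses, at $t-h$, $t$ and $t+h$, and its integral is exactly $h^2$. The condition $2h<t$
    keeps its support in positive times. *)
Lemma second_difference f g (t h e2 : R) : 0 < h -> 2 * h < t ->
  (forall phi : R -> R, test_function [set t : R | 0 < t] phi ->
    \int[leb]_(x in `[0, +oo[) (derive1n 2 phi x * g x + phi x * f x) = 0) ->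
  (forall tau, tau \in [:: t - h; t; t + h] -> forall e, 0 < e ->
    exists2 d, 0 < d & \forall x \ae leb, `|x - tau| < d -> `|g x - g tau| <= e) ->
  (\forall x \ae leb, `|x - t| <= 2 * h -> `|f x - f t| <= e2) ->
  `|g (t + h) - 2 * g t + g (t - h) + h ^+ 2 * f t| <= h ^+ 2 * e2.
Proof.
move=> h0 ht weak gc fc.
have [C C0 moll] := mollifier_scaled.
apply/ler_addgt0Pr => e' e'0; pose e := e' / 4.
have e0 : 0 < e by rewrite divr_gt0.
have [d1 d10 gc1] := gc (t - h) (mem_head _ _) _ e0.
have [d2 d20 gc2] : exists2 d, 0 < d & \forall x \ae leb, `|x - t| < d -> `|g x - g t| <= e.
  by apply: gc e0; rewrite !inE eqxx orbT.
have [d3 d30 gc3] : exists2 d, 0 < d & \forall x \ae leb, `|x - (t + h)| < d -> `|g x - g (t + h)| <= e.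
  by apply: gc e0; rewrite !inE eqxx !orbT.
have [d [d0 [dh [dd1 [dd2 dd3]]] dle1]] : exists d, [/\ 0 < d, d <= h /\ d <= d1 /\ d <= d2 /\ d <= d3 & d <= 1].
  exists (Num.min 1 (Num.min h (Num.min d1 (Num.min d2 d3)))).
  by rewrite !lt_min !ge_min !lexx ?orbT ltr01 h0 d10 d20 d30.
have [rho [S [P [[srho sS sP] [dS dP] [rho0 rhos] [S0 S1 S01 Smono] P0]]]] := moll d d0.
have [Q [dQ Q0]] : exists F : R -> R, (forall x : R, is_derive x (1:R) F (P x)) /\
    forall x, x <= - 1 -> F x = 0.
  apply: primitive_exists; first exact: smooth_continuous.
  by move=> x x1; apply: P0; apply: le_trans x1 _; rewrite lerN2.
pose comb3 (F : R -> R) a1 a2 a3 x := a1 * F (x + (- t - h)) + a2 * F (x + - t) + a3 * F (x + (- t + h)).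
have scomb3 F a1 a2 a3 : smooth F -> smooth (comb3 F a1 a2 a3).
  move=> sF; exact: (smoothD (smoothD (smoothZ a1 (smooth_shift (- t - h) sF)) (smoothZ a2 (smooth_shift (- t) sF))) (smoothZ a3 (smooth_shift (- t + h) sF))).
have dcomb3 F F' a1 a2 a3 : (forall y : R, is_derive y (1:R) F (F' y)) ->
    forall x : R, is_derive x (1:R) (comb3 F a1 a2 a3) (comb3 F' a1 a2 a3 x).
  by move=> dF x; exact: is_derive_comb3.
pose phi := comb3 P 1 (- 2) 1.
have [p0 PE] : exists p0, forall x, d <= x -> P x = p0 + (x - d).
  exists (P d) => x dx; have [|c + E] := @MVT_segment R P S d x dx.
    by apply: continuous_subspaceT; exact: smooth_continuous.
  by rewrite in_itv/= => /andP[dc _]; move: E; rewrite S1// mul1r => <-; rewrite subrKC.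
(* Right of the transition zone the primitive of the ramp is a quadratic polynomial with leading
   coefficient $1/2$, whose second difference is $h^2$: the mass of the hat. *)
have [q0 QE] : exists q0, forall x, d <= x -> Q x = q0 + (x - d) * p0 + (x - d) ^+ 2 / 2.
  exists (Q d) => x dx; pose F y := Q y - ((y - d) * p0 + (y - d) ^+ 2 / 2).
  have dF (y : R) : is_derive y (1:R) F (P y - (p0 + (y - d))).
    apply: is_deriveB; apply: is_derive_eq; rewrite /GRing.scale/=.
    by field.
  have cF : {within `[d, x], continuous F}.
    apply: continuous_subspaceT => y; apply/differentiable_continuous/derivable1_diffP.
    by case: (dF y).
  have [c + E] := MVT_segment dx (fun y _ => dF y) cF.
  rewrite in_itv/= => /andP[dc _]; move: E; rewrite PE// subrr mul0r /F.
  by clear; move=> H; lra.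
have phi0 x : h + d <= `|x - t| -> phi x = 0.
  rewrite ler_normr => /orP[H|H]; rewrite /phi /comb3.
    rewrite (PE (x + (- t - h))); last by clear -h0 H; lra.
    rewrite (PE (x + - t)); last by clear -h0 H; lra.
    rewrite (PE (x + (- t + h))); last by clear -h0 H; lra.
    by ring.
  by rewrite !P0; [ring|clear -h0 H; lra..].
(* The ramp [P] is convex, since its derivative [S] is nondecreasing. *)
have phi_ge0 x : 0 <= phi x.
  have step y : exists2 c, y <= c <= y + h & P (y + h) - P y = S c * h.
    have yh : y <= y + h by rewrite lerDl ltW.
    have [|c + E] := @MVT_segment R P S y (y + h) yh.
      by apply: continuous_subspaceT; exact: smooth_continuous.
    by rewrite in_itv/= => cy; exists c => //; rewrite E; congr (_ * _); ring.
  have [c1 /andP[_ c1l] E1] := step (x + (- t - h)).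
  have [c2 /andP[c2l _] E2] := step (x + - t).
  have S12 : S c1 * h <= S c2 * h by rewrite ler_pM2r// Smono//; clear -h0 c1l c2l; lra.
  move: E1 E2; rewrite (_ : x + (- t - h) + h = x + - t); last by ring.
  rewrite (_ : x + - t + h = x + (- t + h)); last by ring.
  by rewrite /phi /comb3; clear -S12; lra.
have sphi : smooth phi by exact: scomb3.
have phi'' x : derive1n 2 phi x = comb3 rho 1 (- 2) 1 x.
  rewrite /= (_ : derive1 phi = comb3 S 1 (- 2) 1).
    by rewrite derive1E; have [_ ->] := dcomb3 _ _ 1 (- 2) 1 dS x.
  by apply/funext => y; rewrite derive1E; have [_ ->] := dcomb3 _ _ 1 (- 2) 1 dP y.
have tphi : test_function [set t : R | 0 < t] phi.
  split=> //; exists `[t - 2 * h, t + 2 * h]%classic; split.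
  - exact: segment_compact.
  - by move=> x /=; rewrite in_itv/= => /andP[]; clear -ht; lra.
  - move=> x /= /negP; rewrite in_itv/= negb_and -!ltNge => H; apply: phi0.
    by rewrite ler_normr; apply/orP; case/orP: H => H; [right|left]; clear -h0 H dh; lra.
pose J (a1 a2 a3 k x : R) := comb3 rho a1 a2 a3 x + k * phi x.
have intJ a1 a2 a3 k : leb.-integrable setT (EFin \o (J a1 a2 a3 k)) /\
    \int[leb]_x J a1 a2 a3 k x = a1 + a2 + a3 + k * h ^+ 2.
  pose F x := comb3 S a1 a2 a3 x + k * comb3 Q 1 (- 2) 1 x.
  have -> : a1 + a2 + a3 + k * h ^+ 2 = F (t + h + 1) - F (t - h - 1).
    have SA : comb3 S a1 a2 a3 (t - h - 1) = 0 by rewrite /comb3 !S0; [ring|clear -h0 dh dle1; lra..].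
    have SB : comb3 S a1 a2 a3 (t + h + 1) = a1 + a2 + a3 by rewrite /comb3 !S1; [ring|clear -h0 dh dle1; lra..].
    have QA : comb3 Q 1 (- 2) 1 (t - h - 1) = 0 by rewrite /comb3 !Q0; [ring|clear -h0 dh dle1; lra..].
    have QB : comb3 Q 1 (- 2) 1 (t + h + 1) = h ^+ 2 by rewrite /comb3 !QE; [by field|clear -h0 dh dle1; lra..].
    by rewrite /F SA SB QA QB; ring.
  apply: (@integral_deriv_support R (J a1 a2 a3 k) F); first by clear -h0; lra.
  - by apply: smooth_continuous; apply: smoothD; [exact: scomb3|exact: smoothZ].
  - move=> x; rewrite negb_and -!leNgt => H.
    rewrite /J phi0; last first.
      by rewrite ler_normr; case/orP: H => H; apply/orP; [right|left]; clear -h0 H dle1; lra.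
    by case/orP: H => H; rewrite /comb3 !rhos ?mulr0 ?addr0// ler_normr; apply/orP;
      (try by right; clear -h0 H dle1; lra); left; clear -h0 H dle1; lra.
(* The integrand is not known to be measurable; it is enclosed between two explicit functions with
   integrals known from [intJ]. *)
have HJ : \forall x \ae leb, setT x ->
    J (g (t + h) - e) (- 2 * g t - 2 * e) (g (t - h) - e) (f t - e2) x <=
    ((fun x => derive1n 2 phi x * g x + phi x * f x) \_ `[0, +oo[) x <=
    J (g (t + h) + e) (- 2 * g t + 2 * e) (g (t - h) + e) (f t + e2) x.
  have H1 a e1 y c : (`|y| < d -> `|c - a| <= e1) -> 
      (a - e1) * rho y <= c * rho y <= (a + e1) * rho y.
    move=> H; have [yd|yd] := ltP `|y| d; last by rewrite rhos// !mulr0 lexx.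
    have /andP[r0 _] := rho0 y; by rewrite !ler_wpM2r//; move: (H yd); rewrite ler_distl; clear; lra.
  have := ae_and (ae_and gc1 gc2) (ae_and gc3 fc); apply: aeS => x [[G1 G2] [G3 Fx]] _.
  rewrite patchE; case: ifPn => [_|]; last first.
    rewrite notin_setE/= in_itv/= andbT => /negP; rewrite -ltNge => x0.
    rewrite /J phi0; last by rewrite ler_normr; apply/orP; right; clear -h0 ht x0 dh; lra.
    by rewrite /comb3 !rhos ?mulr0 ?addr0 ?lexx//; rewrite ler_normr; apply/orP; right; clear -h0 ht x0 dh; lra.
  rewrite phi'' /J /comb3.
  have /andP[A1 A1'] : (g (t + h) - e) * rho (x + (- t - h)) <= g x * rho (x + (- t - h)) <= (g (t + h) + e) * rho (x + (- t - h)).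
    apply: H1 => xd; apply: G3; apply: lt_le_trans dd3.
    by rewrite (_ : x - (t + h) = x + (- t - h))//; ring.
  have /andP[A2 A2'] : (g t - e) * rho (x + - t) <= g x * rho (x + - t) <= (g t + e) * rho (x + - t).
    by apply: H1 => xd; apply: G2; apply: lt_le_trans dd2.
  have /andP[A3 A3'] : (g (t - h) - e) * rho (x + (- t + h)) <= g x * rho (x + (- t + h)) <= (g (t - h) + e) * rho (x + (- t + h)).
    apply: H1 => xd; apply: G1; apply: lt_le_trans dd1.
    by rewrite (_ : x - (t - h) = x + (- t + h))//; ring.
  have /andP[A4 A4'] : (f t - e2) * phi x <= f x * phi x <= (f t + e2) * phi x.
    have [xh|xh] := leP `|x - t| (2 * h); last first.
      by rewrite phi0 ?mulr0 ?lexx//; apply: ltW; apply: le_lt_trans xh; clear -dh; lra.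
    by rewrite !ler_wpM2r//; move: (Fx xh); rewrite ler_distl; clear; lra.
  by apply/andP; split; clear -A1 A1' A2 A2' A3 A3' A4 A4'; lra.
have := weak _ tphi; rewrite Rintegral_mkcond => I0.
have [i1 E1] := intJ (g (t + h) - e) (- 2 * g t - 2 * e) (g (t - h) - e) (f t - e2).
have [i2 E2] := intJ (g (t + h) + e) (- 2 * g t + 2 * e) (g (t - h) + e) (f t + e2).
have := le_Rintegral_ae measurableT i1 i2 HJ.
rewrite I0 E1 E2 => /andP[l1 l2]; rewrite ler_norml.
have e4 : e' = 4 * e by rewrite /e; field.
by rewrite e4; apply/andP; split; clear -l1 l2; lra.
Qed.

End mollification.

(** * Increments and weak time derivatives *)

Section ae_integrals.
Context d {T : measurableType d} {R : realType} (mu : {measure set T -> \bar R}).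

Lemma ae_Rintegral_eq (D : set T) (f g : T -> R) :
  (\forall x \ae mu, f x = g x) -> \int[mu]_(x in D) f x = \int[mu]_(x in D) g x.
Proof.
move=> fg; congr fine; apply/eqP; rewrite eq_le.
by apply/andP; split; apply: le_integral_ae; apply: aeS fg => x -> _.
Qed.

Lemma ae_finite_set (I : choiceType) (A : set I) (P : I -> T -> Prop) : finite_set A ->
  (forall i, A i -> \forall x \ae mu, P i x) -> \forall x \ae mu, forall i, A i -> P i x.
Proof.
move=> /finite_seqP[s ->]; elim: s => [|a s IH] H.
  by apply: aeW => x i.
have H1 := H a (mem_head _ _).
have H2 : \forall x \ae mu, forall i, [set` s] i -> P i x.
  by apply: IH => i /= si; apply: H; rewrite /= inE si orbT.
apply: aeS (ae_and H1 H2) => x [p1 p2] i /=; rewrite inE => /orP[/eqP ->//|si].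
exact: p2.
Qed.

(* Cauchy-Schwarz against the constant function 1. *)
Lemma sqr_Rintegral_le (D : set T) (f : T -> R) (l : R) : measurable D -> mu D = l%:E ->
  mu.-integrable D (EFin \o f) -> mu.-integrable D (EFin \o (fun x => f x ^+ 2)) ->
  (\int[mu]_(x in D) f x) ^+ 2 <= l * \int[mu]_(x in D) (f x ^+ 2).
Proof.
move=> mD muD If If2; rewrite mulrC; apply: quad_nonneg_discr.
  by apply: Rintegral_ge0 => x _; exact: sqr_ge0.
have I1 : mu.-integrable D (EFin \o cst 1).
  apply/integrableP; split; first by apply/measurable_EFinP.
  by under eq_integral do rewrite /= normr1; rewrite integral_cst// muD mul1e ltry.
have E1 : \int[mu]_(x in D) (cst 1 x) = l by rewrite Rintegral_cst// muD mul1r.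
move=> t.
have IA : mu.-integrable D (EFin \o (fun x => t ^+ 2 * f x ^+ 2)).
  by have := integrableZl mD (t ^+ 2) If2; congr (_.-integrable _ _).
have IB : mu.-integrable D (EFin \o (fun x => 2 * t * f x)).
  by have := integrableZl mD (2 * t) If; congr (_.-integrable _ _).
have IAB : mu.-integrable D (EFin \o (fun x => t ^+ 2 * f x ^+ 2 - 2 * t * f x)).
  by have := integrableB mD IA IB; congr (_.-integrable _ _).
rewrite (_ : _ + l = \int[mu]_(x in D) (t ^+ 2 * f x ^+ 2 - 2 * t * f x + cst 1 x)).
  by apply: Rintegral_ge0 => x _ /=; have := sqr_ge0 (t * f x - 1); rewrite sqrrB exprMn; lra.
by rewrite RintegralD// RintegralB// !RintegralZl// E1; ring.
Qed.

End ae_integrals.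

Section mollified_lebesgue_points.
Context {R : realType}.
Local Notation leb := (@lebesgue_measure R).

Lemma lebesgue_pt_ball (g : R -> R) (t e : R) : lebesgue_pt g t -> 0 < e ->
  exists2 h : R, 0 < h & forall r, 0 < r -> r < h ->
    (\int[leb]_(x in ball t r) `|g x - g t|%:E <= (2 * r * e)%:E)%E.
Proof.
move=> gt e0.
have /gt : nbhs (0%E : \bar R) [set y : \bar R | (y < e%:E)%E].
  by apply: (@open_ereal_lt' _ 0%E); rewrite lte_fin.
rewrite /= nbhs_simpl/= => -[h /= h0 H]; exists h => // r r0 rh.
have := H r; rewrite /ball_/= sub0r normrN gtr0_norm// => /(_ rh r0).
rewrite /davg /iavg (lebesgue_measure_ball _ (ltW r0)) => Hlt.
have r20 : 0 < r *+ 2 by rewrite mulrn_wgt0// .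
move: Hlt; rewrite inver ?gt_eqF// lte_pdivrMl// => /ltW.
rewrite mulr2n [2 * r](_ : _ = r + r); last by ring.
by rewrite EFinM; congr (_ <= _)%E; apply: eq_integral => x _ /=.
Qed.

(** A kernel of height at most [c / r] on a ball of length [2 * r] weights the mean deviation [e] by
    at most [2 * c]. *)
Lemma mollified_lebesgue_pt (g rho : R -> R) (t r e c : R) : 0 < r -> 0 <= c -> measurable_fun setT g ->
  continuous rho -> (forall x, 0 <= rho x <= c / r) -> (forall x, r <= `|x| -> rho x = 0) ->
  \int[leb]_x rho (x + - t) = 1 -> leb.-integrable setT (EFin \o (fun x => rho (x + - t))) ->
  leb.-integrable setT (EFin \o (fun x => rho (x + - t) * g x)) ->
  (\int[leb]_(x in ball t r) `|g x - g t|%:E <= (2 * r * e)%:E)%E ->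
  `|\int[leb]_x (rho (x + - t) * g x) - g t| <= 2 * c * e.
Proof.
move=> r0 c0 mg crho rho0 rhos rho1 Irho Irhog Hg.
have Igt : leb.-integrable setT (EFin \o (fun x => g t * rho (x + - t))).
  by have := integrableZl measurableT (g t) Irho; congr (_.-integrable _ _).
have ID : leb.-integrable setT (EFin \o (fun x => rho (x + - t) * g x - g t * rho (x + - t))).
  by have := integrableB measurableT Irhog Igt; congr (_.-integrable _ _).
rewrite (_ : _ - g t = \int[leb]_x (rho (x + - t) * g x - g t * rho (x + - t))); last first.
  by rewrite RintegralB// RintegralZl// rho1 mulr1.
apply: le_trans (le_normr_Rintegral measurableT ID) _.
have cr0 : 0 <= c / r by rewrite divr_ge0// ltW.
rewrite -lee_fin /Rintegral fineK; last first.
  have := integrable_fin_num measurableT (integrable_abse ID).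
  by congr (_ \is a fin_num); apply: eq_integral => x _ /=.
have H : (\int[leb]_x (`|rho (x + - t) * g x - g t * rho (x + - t)|)%:E <=
    \int[leb]_(x in ball t r) ((c / r)%:E * (`|g x - g t|)%:E))%E.
  rewrite [leRHS]integral_mkcond; apply: le_integral_ae; apply: aeW => x _.
  rewrite patchE; case: ifPn => [_|].
    have /andP[rx0 rx1] := rho0 (x + - t).
    rewrite mulrC -mulrBl mulrC normrM ger0_norm// -EFinM lee_fin.
    by rewrite ler_wpM2r.
  rewrite notin_setE /ball/= => /negP; rewrite -leNgt distrC => xr.
  by rewrite rhos// mul0r mulr0 subr0 normr0.
apply: le_trans H _; apply: (@le_trans _ _ ((c / r)%:E * (2 * r * e)%:E)%E).
  have mg' : measurable_fun (ball t r) (fun x => (`|g x - g t|)%:E).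
    apply/measurable_EFinP; apply: measurable_funTS; apply: measurableT_comp => //.
    exact: measurable_funB.
  rewrite ge0_integralZl_EFin//; last exact: measurable_ball.
  by apply: lee_pmul => //; apply: integral_ge0 => x _; rewrite lee_fin.
rewrite -EFinM lee_fin le_eqVlt; apply/orP; left; apply/eqP; field; lra.
Qed.

End mollified_lebesgue_points.

(** * Strongly measurable paths and their scalar modifications *)

Section strong_measurability.
Context {R : realType} {V : lmodType R} (s : V -> V -> R) (ps : psd s).
Local Notation leb := (@lebesgue_measure R).

Definition strongly_meas (p : R -> V) := exists q : nat -> R -> V,
  [/\ forall n, finite_set (range (q n)),
      forall n f, measurable ((q n @^-1` [set f]) : set (measurableTypeR R))
    & {ae leb, forall t, (fun n => nrm s (q n t - p t)) @ \oo --> (0 : R)}].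

Lemma finite_range_measurable (F : V -> R) (q : R -> V) : finite_set (range q) ->
  (forall f, measurable ((q @^-1` [set f]) : set (measurableTypeR R))) ->
  measurable_fun setT (fun t => F (q t)).
Proof.
move=> fq mq _ B mB; rewrite setTI.
rewrite (_ : _ @^-1` B = \bigcup_(f in range q `&` F @^-1` B) (q @^-1` [set f])).
  by apply: fin_bigcup_measurable; [exact: finite_setIl|move=> f _; exact: mq].
apply/seteqP; split=> [t Bt|t [f [_ Bf] /= qf]] /=; last by rewrite qf.
by exists (q t) => //; split=> //; exists t.
Qed.

(** The approximations converge only off a null set, so the composite itself may fail to be
    measurable; setting it to 0 on that set makes it a limit of measurable functions. *)
Lemma strong_modification (p : R -> V) (F : V -> R) : strongly_meas p ->
  (forall (x : V) (a : nat -> V), (fun n => nrm s (a n - x)) @ \oo --> (0 : R) ->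
     (fun n => F (a n)) @ \oo --> F x) ->
  exists2 g : R -> R, measurable_fun setT g & \forall t \ae leb, g t = F (p t).
Proof.
move=> [q [fq mq [N [mN N0 NH]]]] cF.
have off t : ~ N t -> (fun n => nrm s (q n t - p t)) @ \oo --> (0 : R).
  by move=> Nt; apply: contra_notP Nt; exact: NH.
exists (fun t => F (p t) * \1_(~` N) t); last first.
  exists N; split=> // t /= H; apply: contrapT => Nt; apply: H.
  by rewrite indicE mem_set// mulr1.
apply: (@measurable_fun_cvg _ _ _ _ (fun n t => F (q n t) * \1_(~` N) t)).
  move=> n; apply: measurable_funM; first exact: finite_range_measurable.
  by apply: measurable_indic; exact: measurableC.
move=> t _; have [Nt|Nt] := pselect (N t).
  rewrite indicE memNset; last by move=> /(_ Nt).
  by under eq_fun do rewrite mulr0; rewrite mulr0; exact: cvg_cst.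
rewrite indicE mem_set// mulr1; under eq_fun do rewrite mulr1.
exact: (cF _ _ (off _ Nt)).
Qed.

Lemma nrm_continuous (x : V) (a : nat -> V) :
  (fun n => nrm s (a n - x)) @ \oo --> (0 : R) -> (fun n => nrm s (a n)) @ \oo --> nrm s x.
Proof.
move=> ax; apply/cvgrPdist_le => e e0.
have /cvgrPdist_le/(_ e e0) := ax; apply: filterS => n; rewrite sub0r normrN => H.
rewrite ger0_norm ?nrm_ge0// in H; apply: le_trans H; rewrite ler_norml.
have h1 := nrmD (a n - x) x ps; have h2 := nrmD (x - a n) (a n) ps.
rewrite subrK in h1; rewrite subrK in h2.
by rewrite -[x - a n]opprB nrmN// in h2; apply/andP; split; lra.
Qed.

Lemma form_continuous (w x : V) (a : nat -> V) :
  (fun n => nrm s (a n - x)) @ \oo --> (0 : R) -> (fun n => s w (a n)) @ \oo --> s w x.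
Proof.
have [bs s0] := ps.
move=> ax; apply/cvgrPdist_le => e e0.
have e1 : 0 < e / (nrm s w + 1) by rewrite divr_gt0// ltr_wpDl// nrm_ge0.
have /cvgrPdist_le/(_ _ e1) := ax; apply: filterS => n; rewrite sub0r normrN => H.
rewrite distrC -(bilinBr _ _ _ bs); apply: le_trans (psd_CS _ _ ps) _.
rewrite ger0_norm ?nrm_ge0// in H.
rewrite ler_pdivlMr ?ltr_wpDl ?nrm_ge0// in H; apply: le_trans H.
by rewrite mulrC ler_wpM2l ?nrm_ge0// lerDl.
Qed.

Lemma sqr_integrable_itv (f : R -> R) (a b : R) : measurable_fun setT f ->
  (\int[leb]_(t in `[a, b]) (f t ^+ 2)%:E < +oo)%E ->
  leb.-integrable `[a, b] (EFin \o f) /\ leb.-integrable `[a, b] (EFin \o (fun t => f t ^+ 2)).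
Proof.
move=> mf If; have mab : measurable (`[a, b]%classic : set R) by exact: measurable_itv.
have mf' : measurable_fun `[a, b] f by exact: measurable_funTS.
have I2 : leb.-integrable `[a, b] (EFin \o (fun t => f t ^+ 2)).
  apply/integrableP; split; first by apply/measurable_EFinP; exact: measurable_funX.
  by under eq_integral do rewrite /= ger0_norm ?sqr_ge0//.
split=> //.
have I1 : leb.-integrable `[a, b] (EFin \o cst (1:R)).
  by apply: continuous_integrable_itv; exact: cst_continuous.
have := @integrableD _ _ _ leb _ (measurable_itv _) _ _ I1 I2; apply: le_integrable => //; first exact/measurable_EFinP.
move=> t _ /=; rewrite lee_fin [leRHS]ger0_norm ?addr_ge0 ?sqr_ge0//.
rewrite ler_norml; have := sqr_ge0 (f t - 1); have := sqr_ge0 (f t + 1).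
by have := sqr_ge0 (f t); rewrite sqrrB sqrrD; lra.
Qed.

Lemma integrable_bounded_support (k g : R -> R) (c a b : R) : measurable_fun setT k ->
  (forall x, `|k x| <= c) -> (forall x, ~~ (a <= x <= b) -> k x = 0) ->
  measurable_fun setT g -> leb.-integrable `[a, b] (EFin \o g) ->
  leb.-integrable setT (EFin \o (fun x => k x * g x)).
Proof.
move=> mk kc k0 mg Ig; apply/integrableP; split.
  by apply/measurable_EFinP; exact: measurable_funM.
have c0 : 0 <= c by exact: le_trans (kc 0).
have mab : measurable (`[a, b]%classic : set R) by exact: measurable_itv.
have /integrableP[_] := @integrableZl _ _ _ leb _ (measurable_itv _) c _ Ig.
apply: le_lt_trans; rewrite [leRHS]integral_mkcond; apply: le_integral_ae.
apply: aeW => x _; rewrite patchE; case: ifPn => [_|].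
  by rewrite /= lee_fin !normrM ler_wpM2r//; apply: le_trans (kc x) (ler_norm c).
rewrite notin_setE/= in_itv/= => /negP H.
by rewrite /= k0// mul0r normr0.
Qed.

Lemma local_modification (p : R -> V) (F : V -> R) (np : R -> R) (c : R) :
  strongly_meas p -> 
  (forall (x : V) (a : nat -> V), (fun n => nrm s (a n - x)) @ \oo --> (0 : R) ->
     (fun n => F (a n)) @ \oo --> F x) ->
  (forall x, `|F x| <= c * nrm s x) -> 0 <= c ->
  (\forall t \ae leb, np t = nrm s (p t)) ->
  (forall a b, leb.-integrable `[a, b] (EFin \o np)) ->
  exists g : R -> R, [/\ measurable_fun setT g, \forall t \ae leb, g t = F (p t),
    forall a b, leb.-integrable `[a, b] (EFin \o g) & \forall t \ae leb, lebesgue_pt g t].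
Proof.
move=> sp cF Fc c0 npE Inp; have [g mg gE] := strong_modification sp cF.
have Ig a b : leb.-integrable `[a, b] (EFin \o g).
  apply/integrableP; split; first by apply/measurable_EFinP; exact: measurable_funTS.
  have mab : measurable (`[a, b]%classic : set R) by exact: measurable_itv.
  have /integrableP[_] := @integrableZl _ _ _ leb _ (measurable_itv _) c _ (Inp a b).
  apply: le_lt_trans; apply: le_integral_ae.
  apply: aeS (ae_and gE npE) => x [E1 E2] _; rewrite /= E1 E2 lee_fin.
  by apply: le_trans (Fc _) _; exact: ler_norm.
exists g; split=> //; apply: lebesgue_differentiation; split=> //; first exact: openT.
move=> K _ cK; have [M [_ HM]] := compact_bounded cK.
have KM : K `<=` `[- (M + 1), M + 1].
  by move=> x /(HM (M + 1) _) /=; rewrite in_itv/= -ler_norml; apply; rewrite ltrDl.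
have mK : measurable K by apply: closed_measurable; apply: compact_closed => //; exact: Rhausdorff.
have /integrableP[_] := Ig (- (M + 1)) (M + 1); apply: le_lt_trans.
apply: ge0_subset_integral => //.
by apply/measurable_EFinP; apply: measurableT_comp => //; exact: measurable_funTS.
Qed.

End strong_measurability.

(** * Increments of paths with a weak derivative *)

Section weak_derivative.
Context {R : realType} {V : lmodType R} (s : V -> V -> R) (ps : psd s).
Local Notation leb := (@lebesgue_measure R).

Lemma ramp_test (e t t' : R) (rho S : R -> R) : t <= t' -> 0 < e ->
  smooth S -> (forall x : R, is_derive x (1:R) S (rho x)) ->
  (forall x, x <= - e -> S x = 0) -> (forall x, e <= x -> S x = 1) ->
  test_function setT (fun x => S (x + - t) - S (x + - t')) /\
  forall x, derive1 (fun x => S (x + - t) - S (x + - t')) x = rho (x + - t) - rho (x + - t').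
Proof.
move=> tt' e0 sS dS S0 S1; split; last first.
  move=> x; rewrite derive1E.
  have D1 := @is_derive_translate R S (- t) x _ (dS (x + - t)); have D2 := @is_derive_translate R S (- t') x _ (dS (x + - t')).
  by have [_ ->] := @is_deriveB _ _ _ _ _ x 1 _ _ D1 D2.
split.
  have := smoothD (smooth_shift (- t) sS) (smoothZ (- 1) (smooth_shift (- t') sS)).
  by congr smooth; apply/funext => x /=; rewrite mulN1r.
exists `[t - e, t' + e]%classic; split=> //; first exact: segment_compact.
move=> x /= /negP; rewrite in_itv/= negb_and -!ltNge => /orP[H|H].
  by rewrite !S0 ?subrr//; clear -H tt'; lra.
by rewrite !S1 ?subrr//; clear -H tt'; lra.
Qed.

Lemma mollified_integrable (e t C : R) (rho S g : R -> R) : 0 < e ->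
  continuous rho -> (forall x : R, is_derive x (1:R) S (rho x)) ->
  (forall x, 0 <= rho x <= C / e) -> (forall x, e <= `|x| -> rho x = 0) ->
  (forall x, x <= - e -> S x = 0) -> (forall x, e <= x -> S x = 1) ->
  measurable_fun setT g -> (forall a b, leb.-integrable `[a, b] (EFin \o g)) ->
  [/\ leb.-integrable setT (EFin \o (fun x => rho (x + - t))),
      \int[leb]_x rho (x + - t) = 1 &
      leb.-integrable setT (EFin \o (fun x => rho (x + - t) * g x))].
Proof.
move=> e0 crho dS rho0 rhos S0 S1 mg Ig.
have crho' : continuous (fun x => rho (x + - t)).
  move=> x; apply: (@continuous_comp _ _ _ (fun x => x + - t) rho); last exact: crho.
  by apply: cvgD; [exact: cvg_id|exact: cvg_cst].
have dS' (x : R) : is_derive x (1:R) (fun x => S (x + - t)) (rho (x + - t)).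
  exact: is_derive_translate.
have rhos' x : ~~ (t - e < x < t + e) -> rho (x + - t) = 0.
  rewrite negb_and -!leNgt => H; apply: rhos; rewrite ler_normr.
  by apply/orP; case/orP: H => H; [right|left]; clear -H; lra.
have te : t - e < t + e by clear -e0; lra.
have [I1 E1] := integral_deriv_support te crho' dS' rhos'.
split=> //.
  by rewrite E1 S1 ?S0 ?subr0//; clear; lra.
apply: (@integrable_bounded_support R _ _ (C / e) (t - e) (t + e)) => //.
- exact: continuous_measurable_fun.
- by move=> x; have /andP[? ?] := rho0 (x + - t); rewrite ger0_norm.
- by move=> x H; apply: rhos'; apply: contra H => /andP[/ltW -> /ltW ->].
Qed.

Section estimate.
Context (p v : R -> V) (nv : R -> R) (q : nat -> R -> V) (G : V -> R -> R).
Hypothesis weak : forall phi : R -> R, test_function setT phi -> forall w,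
  \int[leb]_t (derive1 phi t * s w (p t)) = - \int[leb]_t (phi t * s w (v t)).
Hypothesis nvE : \forall t \ae leb, nv t = nrm s (v t).
Hypothesis Inv : forall a b, leb.-integrable `[a, b] (EFin \o nv).
Hypothesis mG : forall w, measurable_fun setT (G w).
Hypothesis GE : forall w, \forall t \ae leb, G w t = s w (p t).
Hypothesis IG : forall w a b, leb.-integrable `[a, b] (EFin \o G w).

(** The weak derivative is tested with a smoothed indicator of $[t,t']$: one side becomes a
    difference of mollified values, the other is an integral over an interval enlarged by at most
    [h]. *)
Lemma ramp_bound (w1 w2 : V) (t t' h e : R) (C : R) (rho S : R -> R) : t <= t' -> 0 < e -> e <= h ->
  smooth S -> continuous rho -> (forall x : R, is_derive x (1:R) S (rho x)) ->
  (forall x, 0 <= rho x <= C / e) -> (forall x, e <= `|x| -> rho x = 0) ->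
  (forall x, x <= - e -> S x = 0) -> (forall x, e <= x -> S x = 1) ->
  (forall x, 0 <= S x <= 1) -> {homo S : x y / x <= y} ->
  forall M : V -> R -> R, M = (fun w t => \int[leb]_x (rho (x + - t) * G w x)) ->
  `|M w1 t - M w1 t' - (M w2 t - M w2 t')| <=
    nrm s (w1 - w2) * \int[leb]_(x in `[t - h, t' + h]) nv x.
Proof.
move=> tt' e0 eh sS crho dS rho0 rhos S0 S1 S01 Smono M ME.
have [bs _] := ps.
have [tphi dphi] := ramp_test tt' e0 sS dS S0 S1.
have := weak tphi (w1 - w2).
have I w tau : leb.-integrable setT (EFin \o (fun x => rho (x + - tau) * G w x)).
  by have [] := mollified_integrable tau e0 crho dS rho0 rhos S0 S1 (mG w) (IG w).
rewrite (@ae_Rintegral_eq _ _ _ leb _ _ (fun x => rho (x + - t) * G w1 x - rho (x + - t') * G w1 x -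
   (rho (x + - t) * G w2 x - rho (x + - t') * G w2 x))); last first.
  apply: aeS (ae_and (GE w1) (GE w2)) => x [E1 E2].
  by rewrite dphi (bilinBl _ _ _ bs) E1 E2; ring.
have I2 w : leb.-integrable setT (EFin \o (fun x => rho (x + - t) * G w x - rho (x + - t') * G w x)).
  by have := integrableB measurableT (I w t) (I w t'); congr (_.-integrable _ _).
have EM w tau : \int[leb]_x (rho (x + - tau) * G w x) = M w tau by rewrite ME.
rewrite RintegralB// RintegralB// RintegralB// !EM.
move=> ->; rewrite normrN.
pose J (c x : R) := c * (nv \_ `[t - h, t' + h]) x.
have IJ0 : leb.-integrable setT (EFin \o (nv \_ `[t - h, t' + h])).
  have := (@integrable_mkcond _ _ _ leb `[t - h, t' + h]%classic (EFin \o nv) (measurable_itv _)).1 (Inv _ _).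
  by congr (_.-integrable _ _); apply/funext => x /=; rewrite !patchE; case: ifP.
have IJ c : leb.-integrable setT (EFin \o (J c)).
  by have := integrableZl measurableT c IJ0; congr (_.-integrable _ _).
have EJ c : \int[leb]_x J c x = c * \int[leb]_(x in `[t - h, t' + h]) nv x.
  by rewrite /J RintegralZl// -Rintegral_mkcond.
suff /(le_Rintegral_ae measurableT (IJ (- nrm s (w1 - w2))) (IJ (nrm s (w1 - w2)))) :
    \forall x \ae leb, setT x -> J (- nrm s (w1 - w2)) x <=
      (S (x + - t) - S (x + - t')) * s (w1 - w2) (v x) <= J (nrm s (w1 - w2)) x.
  by rewrite !EJ mulNr -ler_norml.
apply: aeS nvE => x nx _; rewrite /J mulNr -ler_norml normrM patchE.
case: ifPn => [_|].
  rewrite nx; apply: le_trans (_ : 1 * `|s (w1 - w2) (v x)| <= _); last by rewrite mul1r psd_CS.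
  rewrite ler_wpM2r// ler_norml.
  by have := S01 (x + - t); have := S01 (x + - t'); have := Smono (x + - t') (x + - t); lra.
rewrite notin_setE/= in_itv/= => /negP; rewrite negb_and -!ltNge => /orP[H|H].
  by rewrite !S0 ?subrr ?normr0 ?mul0r ?mulr0//; lra.
by rewrite !S1 ?subrr ?normr0 ?mul0r ?mulr0//; lra.
Qed.

(** The limit of [ramp_bound] for vanishing width. Two vectors appear because the modifications
    [G w] are chosen one vector at a time and need not be linear in [w]. *)
Lemma Lebesgue_increment (w1 w2 : V) (t t' h : R) : t <= t' -> 0 < h ->
  (forall w tau, w \in [:: w1; w2] -> tau \in [:: t; t'] -> lebesgue_pt (G w) tau /\ G w tau = s w (p tau)) ->
  `|s (w1 - w2) (p t' - p t)| <= nrm s (w1 - w2) * \int[leb]_(x in `[t - h, t' + h]) nv x.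
Proof.
move=> tt' h0 HL; have [bs _] := ps.
have [C C0 moll] := @mollifier_scaled R.
(* Four mollified values are replaced by their limits, each with an error $2Ce=e'/4$. *)
apply/ler_addgt0Pr => e' e'0; pose e := e' / (8 * C).
have e0 : 0 < e by rewrite divr_gt0// mulr_gt0.
have ball_pt w tau : w \in [:: w1; w2] -> tau \in [:: t; t'] -> exists2 d : R, 0 < d &
    forall r, 0 < r -> r < d ->
    (\int[leb]_(x in ball tau r) `|G w x - G w tau|%:E <= (2 * r * e)%:E)%E.
  by move=> Hw Ht; apply: lebesgue_pt_ball => //; case: (HL w tau Hw Ht).
have [m1 m2] : w1 \in [:: w1; w2] /\ w2 \in [:: w1; w2] by rewrite !inE !eqxx orbT.
have [n1 n2] : t \in [:: t; t'] /\ t' \in [:: t; t'] by rewrite !inE !eqxx orbT.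
have [d1 d10 H1] := ball_pt _ _ m1 n1; have [d2 d20 H2] := ball_pt _ _ m1 n2.
have [d3 d30 H3] := ball_pt _ _ m2 n1; have [d4 d40 H4] := ball_pt _ _ m2 n2.
have [r [r0 rh [r1 r2] [r3 r4]]] : exists r, [/\ 0 < r, r <= h, r < d1 /\ r < d2 & r < d3 /\ r < d4].
  pose m := Num.min h (Num.min d1 (Num.min d2 (Num.min d3 d4))).
  have m0 : 0 < m by rewrite !lt_min h0 d10 d20 d30.
  have mh : m / 2 < m by lra.
  have Hm : m <= h /\ m <= d1 /\ m <= d2 /\ m <= d3 /\ m <= d4 by rewrite !ge_min !lexx ?orbT.
  have [m1' [m2' [m3' [m4' m5']]]] := Hm; exists (m / 2); split.
  - by rewrite divr_gt0.
  - exact: le_trans (ltW mh) m1'.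
  - by split; [exact: lt_le_trans mh m2'|exact: lt_le_trans mh m3'].
  - by split; [exact: lt_le_trans mh m4'|exact: lt_le_trans mh m5'].
have [rho [S [P [[srho sS _] [dS _] [rho0 rhos] [S0 S1 S01 Smono] _]]]] := moll r r0.
have crho := smooth_continuous srho.
have B := ramp_bound w1 w2 tt' r0 rh sS crho dS rho0 rhos S0 S1 S01 Smono erefl.
have approx w tau : w \in [:: w1; w2] -> tau \in [:: t; t'] ->
    (\int[leb]_(x in ball tau r) `|G w x - G w tau|%:E <= (2 * r * e)%:E)%E ->
    `|\int[leb]_x (rho (x + - tau) * G w x) - s w (p tau)| <= e' / 4.
  move=> Hw Ht Hb; have [_ <-] := HL w tau Hw Ht.
  have [I1 E1 I2] := mollified_integrable tau r0 crho dS rho0 rhos S0 S1 (mG w) (IG w).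
  have := mollified_lebesgue_pt r0 (ltW C0) (mG w) crho rho0 rhos E1 I1 I2 Hb.
  by rewrite (_ : 2 * C * e = e' / 4)// /e; field; rewrite gt_eqF.
have A1 := approx _ _ m1 n1 (H1 _ r0 r1); have A2 := approx _ _ m1 n2 (H2 _ r0 r2).
have A3 := approx _ _ m2 n1 (H3 _ r0 r3); have A4 := approx _ _ m2 n2 (H4 _ r0 r4).
move: B A1 A2 A3 A4; rewrite (bilinBl _ _ _ bs) !(bilinBr _ _ _ bs) /=.
move: (\int[leb]_(x in _) nv x) (\int[leb]_x _) (\int[leb]_x _) (\int[leb]_x _) (\int[leb]_x _).
move=> Q M1 M2 M3 M4; move: (nrm s (w1 - w2) * Q) (s w1 _) (s w1 _) (s w2 _) (s w2 _).
move=> Z a b c d; rewrite !ler_norml; lra.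
Qed.

End estimate.

(** Testing with the increment itself would give its norm, but the exceptional null set depends on
    the test vector. The finitely valued approximations of [p] supply countably many vectors, with a
    common null set, and their differences approximate the increment. *)
Lemma weak_derivative_increment (p v : R -> V) :
  strongly_meas s p -> strongly_meas s v ->
  (forall a b : R, (\int[leb]_(t in `[a, b]) (nrm s (p t) ^+ 2)%:E < +oo)%E) ->
  (forall a b : R, (\int[leb]_(t in `[a, b]) (nrm s (v t) ^+ 2)%:E < +oo)%E) ->
  (forall phi : R -> R, test_function setT phi -> forall w,
    \int[leb]_t (derive1 phi t * s w (p t)) = - \int[leb]_t (phi t * s w (v t))) ->
  exists (L : set R) (k : R -> R), [/\ \forall t \ae leb, L t, forall t, 0 <= k t,
    forall a b, leb.-integrable `[a, b] (EFin \o k)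
    & forall t t' h, L t -> L t' -> t <= t' -> 0 < h ->
      nrm s (p t' - p t) ^+ 2 <= (t' - t + 2 * h) * \int[leb]_(x in `[t - h, t' + h]) k x].
Proof.
move=> sp sv fp fv weak; have [bs s0] := ps.
have sqr_mod u : strongly_meas s u ->
    (forall a b : R, (\int[leb]_(t in `[a, b]) (nrm s (u t) ^+ 2)%:E < +oo)%E) ->
    exists f : R -> R, [/\ measurable_fun setT f, forall t, 0 <= f t,
      \forall t \ae leb, f t = nrm s (u t) &
      forall a b, leb.-integrable `[a, b] (EFin \o f) /\
        leb.-integrable `[a, b] (EFin \o (fun t => f t ^+ 2))].
  move=> su fu; have [f mf fE] := strong_modification su (nrm_continuous ps).
  have fE' : \forall t \ae leb, `|f t| = nrm s (u t).
    by apply: aeS fE => t ->; rewrite ger0_norm ?nrm_ge0.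
  exists (fun t => `|f t|); split=> //; first exact: measurableT_comp.
  move=> a b; apply: sqr_integrable_itv; first exact: measurableT_comp.
  by apply: le_lt_trans (fu a b); apply: le_integral_ae; apply: aeS fE' => t ->.
have [np [mnp np0 npE Inp]] := sqr_mod _ sp fp.
have [nv [mnv nv0 nvE Inv]] := sqr_mod _ sv fv.
have [q [fq mq qp]] := sp.
have /choice[G HG] : forall w, exists g : R -> R, [/\ measurable_fun setT g,
    \forall t \ae leb, g t = s w (p t), forall a b, leb.-integrable `[a, b] (EFin \o g) &
    \forall t \ae leb, lebesgue_pt g t].
  move=> w; apply: (@local_modification _ _ s p (s w) np (nrm s w)) => //.
  - exact: form_continuous.
  - by move=> x; exact: psd_CS.
  - exact: nrm_ge0.
  - by move=> a b; case: (Inp a b).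
have mG w : measurable_fun setT (G w) by case: (HG w).
have GE w : \forall t \ae leb, G w t = s w (p t) by case: (HG w).
have IG w a b : leb.-integrable `[a, b] (EFin \o G w) by case: (HG w).
pose L t := (forall n a, range (q n) a -> lebesgue_pt (G a) t /\ G a t = s a (p t)) /\
  (fun n => nrm s (q n t - p t)) @ \oo --> (0 : R).
exists L, (fun t => nv t ^+ 2); split.
- apply: ae_and => //; apply: ae_foralln => n; apply: ae_finite_set => // a _.
  by apply: ae_and; [case: (HG a)|exact: GE].
- by move=> t; exact: sqr_ge0.
- by move=> a b; case: (Inv a b).
move=> t t' h [Lt qt] [Lt' qt'] tt' h0.
set Q := \int[leb]_(x in `[t - h, t' + h]) nv x.
have Q0 : 0 <= Q by apply: Rintegral_ge0.
pose y := p t' - p t; pose W n := q n t' - q n t.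
have Wy n : `|s (W n) y| <= nrm s (W n) * Q.
  have Inv1 a b : leb.-integrable `[a, b] (EFin \o nv) by case: (Inv a b).
  apply: (Lebesgue_increment weak nvE Inv1 mG GE IG) => //.
  move=> w tau Hw Ht; have Hw' : range (q n) w.
    by move: Hw; rewrite !inE => /orP[] /eqP ->; [exists t'|exists t].
  by move: Ht; rewrite !inE => /orP[] /eqP ->; [exact: (Lt n w Hw')|exact: (Lt' n w Hw')].
have ny0 := nrm_ge0 s y.
(* Limit of [Wy], since [W n] tends to [y]. *)
have yy : nrm s y ^+ 2 <= nrm s y * Q.
  apply/ler_addgt0Pr => e e0; pose d := e / (Q + nrm s y + 1).
  have d0 : 0 < d by rewrite divr_gt0// ltr_wpDl// addr_ge0.
  have d2 : 0 < d / 2 by rewrite divr_gt0.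
  have /cvgrPdist_le/(_ _ d2)[n1 _ H1] := qt; have /cvgrPdist_le/(_ _ d2)[n2 _ H2] := qt'.
  pose n := maxn n1 n2.
  have := H1 n (leq_maxl _ _); have := H2 n (leq_maxr _ _).
  rewrite /= !sub0r !normrN !(ger0_norm (nrm_ge0 _ _)) => A2 A1.
  have WyE : nrm s (W n - y) <= d.
    rewrite (_ : W n - y = (q n t' - p t') - (q n t - p t)); last first.
      by rewrite /W /y !opprB [LHS]addrACA [RHS]addrACA; congr (_ + _); rewrite addrC.
    by apply: le_trans (nrmB _ _ ps) _; rewrite (splitr d) lerD.
  have B1 : nrm s (W n) <= nrm s y + d.
    have := nrmD (W n - y) y ps; rewrite subrK => H; apply: le_trans H _.
    by rewrite addrC lerD2l.
  have B2 : `|s (W n - y) y| <= d * nrm s y.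
    by apply: le_trans (psd_CS _ _ ps) _; rewrite ler_wpM2r.
  have B3 : nrm s (W n) * Q <= (nrm s y + d) * Q by rewrite ler_wpM2r.
  have de : d * (Q + nrm s y + 1) = e by rewrite /d divfK// gt_eqF// ltr_wpDl// addr_ge0.
  move: (Wy n) B2; rewrite (bilinBl _ _ _ bs) sqr_nrm// !ler_norml.
  move: B3 de d0; move: (s (W n) y) (s y y) (nrm s (W n) * Q) (nrm s y) => z1 z2 z3 z4.
  by move=> B3 de d0 /andP[_ C1] /andP[C2 _]; lra.
have yQ : nrm s y <= Q.
  have [y0|yn0] := eqVneq (nrm s y) 0; first by rewrite y0.
  by move: yy; rewrite expr2 ler_pM2l// lt_neqAle eq_sym yn0.
apply: le_trans (_ : Q ^+ 2 <= _); first by rewrite lerXn2r ?nnegrE.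
have [I1 I2] := Inv (t - h) (t' + h).
have muE : leb `[t - h, t' + h]%classic = (t' - t + 2 * h)%:E.
  rewrite lebesgue_measure_itv/= lte_fin ifT; last lra.
  by rewrite -EFinB; congr (_%:E); ring.
exact: (@sqr_Rintegral_le _ _ _ leb _ nv _ (measurable_itv _) muE I1 I2).
Qed.

End weak_derivative.

(** * The modulated coefficient *)

HB.instance Definition _ (R : realType) (n : nat) := Measure_isSigmaFinite.Build _ _ _
  (@lebesgue_rV R n) (@lebesgue_rV_sigma_finite R n).

(* The inverse is a limit of continuous functions, also at 0 where it is 0. *)
Lemma measurable_inverse (R : realType) : measurable_fun setT (fun x : R => x^-1).
Proof.
have q0 (x : R) m : 0 < x ^+ 2 + m.+1%:R^-1 by rewrite ltr_wpDl ?sqr_ge0 ?invr_gt0.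
apply: (@measurable_fun_cvg _ _ _ _ (fun (m : nat) (x : R) => x / (x ^+ 2 + m.+1%:R^-1))).
  move=> m; apply: continuous_measurable_fun => x; apply: cvgM; first exact: cvg_id.
  apply: cvgV; first by rewrite gt_eqF.
  by apply: cvgD; [exact: exprn_continuous|exact: cvg_cst].
move=> x _; have [->|x0] := eqVneq x 0.
  by under eq_fun do rewrite mul0r; rewrite invr0; exact: cvg_cst.
have E : x^-1 = x / (x ^+ 2 + 0) by rewrite addr0; field.
rewrite [X in _ --> X]E; apply: cvgM; first exact: cvg_cst.
apply: cvgV; first by rewrite addr0 sqrf_eq0.
by apply: cvgD; [exact: cvg_cst|exact: cvg_harmonic].
Qed.

Section coefficient.
Context {R : realType} {n : nat} (D : set 'rV[R]_n) (oD : open D).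
Local Notation mu := (@lebesgue_rV R n).
Local Notation leb := (@lebesgue_measure R).
Implicit Types (k : 'rV[R]_n -> R).

Definition supnorm k : R := fine (Linfty_norm D k).

Lemma supnormE k : Linfty D k -> Linfty_norm D k = (supnorm k)%:E.
Proof.
move=> /sub_Lfun_finLfun; rewrite inE/= => kfin.
have k0 : (0 <= Linfty_norm D k)%E by exact: Lnorm_ge0.
by rewrite /supnorm fineK// ge0_fin_numE.
Qed.

Lemma supnorm_ge0 k : 0 <= supnorm k.
Proof. by apply: fine_ge0; exact: Lnorm_ge0. Qed.

Lemma supnorm_ae k : Linfty D k -> ae_on D (fun x => `|k x| <= supnorm k).
Proof.
move=> Lk; apply: (ae_onI _ (Linfty_norm_ae D k)) => x + xD.
by rewrite patchE mem_set// supnormE// lee_fin.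
Qed.

Lemma supnorm_le k (M : R) : measurable_fun setT (k \_ D) -> 0 <= M ->
  ae_on D (fun x => `|k x| <= M) -> Linfty D k /\ supnorm k <= M.
Proof.
move=> mk M0 kM.
have kM' : \forall x \ae mu, `|(k \_ D) x| <= M.
  apply: ae_onS kM => x H; rewrite patchE; case: ifPn; last by rewrite normr0.
  by rewrite inE => /H.
have [Lk] := Linfty_intro mk kM'; rewrite supnormE// lee_fin.
by move/max_idPl : M0 => ->.
Qed.

Lemma ae_on_and (P Q : 'rV[R]_n -> Prop) : ae_on D P -> ae_on D Q ->
  ae_on D (fun x => P x /\ Q x).
Proof.
move=> HP HQ; apply: ae_onI (ae_and HP HQ) => x [p q] xD.
by split; [exact: p|exact: q].
Qed.

Lemma ae_on_weaken (P Q : 'rV[R]_n -> Prop) : (forall x, D x -> P x -> Q x) ->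
  ae_on D P -> ae_on D Q.
Proof. by move=> PQ HP; apply: aeS HP => x p xD; exact: PQ (p xD). Qed.

(** Fubini's theorem for null sets: almost all time slices of a null set of the cylinder are
    null. *)
Lemma ess_inf_cylinder_slices (T : R) (kappa : R -> 'rV[R]_n -> R) :
  (0 < ess_inf_cylinder D T kappa)%E -> exists2 c, 0 < c &
  \forall t \ae leb, t \in `[0, T] -> ae_on D (fun x => c <= kappa t x).
Proof.
move=> H; have [c c0 cH] : exists2 c : R, 0 < c & (c%:E <= ess_inf_cylinder D T kappa)%E.
  move: H; case: (ess_inf_cylinder D T kappa) => [r|_|//].
    by rewrite lte_fin => r0; exists r.
  by exists 1; rewrite ?ltr01// leey.
exists c => //; move/ess_infP : cH => [N [mN N0 NH]].
(* The product measure is integrated over space first; its uniqueness, which rests on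
   sigma-finiteness, identifies it with the one integrated over time. *)
have ker : (\int[leb]_t (mu (ysection N t)) = 0)%E.
  rewrite -[LHS]/((mu \x^ leb)%E N) -N0; apply/esym.
  by apply: product_measure_unique => //= A B mA mB; rewrite product_measure2E.
have mphi : measurable_fun setT (fun t : measurableTypeR R => mu (ysection N t)).
  exact: measurable_fun_ysection.
have /(ae_eq_integral_abs leb measurableT mphi) :
    (\int[leb]_t `|mu (ysection N t)| = 0)%E.
  by rewrite -[RHS]ker; apply: eq_integral => t _; rewrite gee0_abs.
move=> [Z [mZ Z0 ZH]]; exists Z; split=> // t /= Ht; apply: ZH => /= Hz; apply: Ht => tT.
exists (ysection N t); split; [exact: measurable_ysection|exact: Hz|].
move=> x /= Hx; rewrite ysectionE/=; apply: NH => /= Hc; apply: Hx => xD.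
by move: Hc; rewrite /patch mem_set// lee_fin.
Qed.

Section regular_coefficient.
Context (T : R) (kappa kappa' : R -> 'rV[R]_n -> R) (T0 : 0 < T).
Hypothesis C1 : C1per_Linfty D T kappa kappa'.
Hypothesis inf0 : (0 < ess_inf_cylinder D T kappa)%E.

Let Lk t : Linfty D (kappa t). Proof. by have [H _ _ _] := C1; case: (H t). Qed.
Let Lk' t : Linfty D (kappa' t). Proof. by have [H _ _ _] := C1; case: (H t). Qed.

Lemma cvge0_lt (X : Type) (F : set_system X) (FF : Filter F) (f : X -> \bar R) (e : R) : 0 < e ->
  f @ F --> (0%E : \bar R) -> \forall x \near F, (f x < e%:E)%E.
Proof.
move=> e0 f0; have /f0 : nbhs (0%E : \bar R) [set y : \bar R | (y < e%:E)%E].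
  by apply: (@open_ereal_lt' _ 0%E); rewrite lte_fin.
by [].
Qed.

Let quot t h : 'rV[R]_n -> R := fun x => h^-1 * (kappa (t + h) x - kappa t x) - kappa' t x.

Let Lquot t h : Linfty D (quot t h).
Proof.
have := Linfty_lin (- 1) (Lk' t) (Linfty_lin h^-1 (Linfty_lin (- 1) (Lk t) (Lk (t + h))) (Linfty_cst 0 oD)).
congr (Linfty D); apply/funext => x; rewrite /quot /=; ring.
Qed.

Lemma quot_small t (e : R) : 0 < e -> exists2 d, 0 < d &
  forall h, h != 0 -> `|h| < d -> supnorm (quot t h) <= e.
Proof.
move=> e0; have [_ _ /(_ t) H _] := C1.
have [d /= d0 Hd] := cvge0_lt _ e0 H; exists d => // h h0 hd.
have := Hd h; rewrite /ball_/= sub0r normrN => /(_ hd h0).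
by rewrite -/(quot t h) supnormE// lte_fin => /ltW.
Qed.

Lemma kappa_continuous t (e : R) : 0 < e -> exists2 d, 0 < d &
  forall h, `|h| < d -> ae_on D (fun x => `|kappa (t + h) x - kappa t x| <= e).
Proof.
move=> e0; have [d1 d10 H] := quot_small t ltr01.
pose B := supnorm (kappa' t) + 1.
have B0 : 0 < B by rewrite ltr_wpDl// supnorm_ge0.
exists (Num.min d1 (e / B)); first by rewrite lt_min d10 divr_gt0.
move=> h; rewrite lt_min => /andP[hd he].
have [->|h0] := eqVneq h 0.
  by apply: aeW => x _; rewrite addr0 subrr normr0 ltW.
have A1 := supnorm_ae (Lquot t h); have A2 := supnorm_ae (Lk' t).
apply: ae_on_weaken (ae_on_and A1 A2) => x _ [E1 E2].
have -> : kappa (t + h) x - kappa t x = h * (quot t h x + kappa' t x).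
  by rewrite /quot; field.
rewrite normrM; apply: le_trans (_ : `|h| * B <= _); last first.
  by rewrite ltr_pdivlMr// in he; exact: ltW.
rewrite ler_wpM2l//; apply: le_trans (ler_normD _ _) _; rewrite addrC lerD//.
by apply: le_trans E1 (H _ h0 hd).
Qed.

Lemma kappa'_continuous t (e : R) : 0 < e -> exists2 d, 0 < d &
  forall r, `|r - t| < d -> ae_on D (fun x => `|kappa' r x - kappa' t x| <= e).
Proof.
move=> e0; have [_ _ _ /(_ t) H] := C1.
have [d /= d0 Hd] := cvge0_lt _ e0 H; exists d => // r rd.
have := Hd r; rewrite /ball_/= distrC => /(_ rd) => Hr.
have L : Linfty D (fun x => kappa' r x - kappa' t x).
  have := Linfty_lin (- 1) (Lk' t) (Lk' r).
  by congr (Linfty D); apply/funext => x; rewrite mulN1r addrC.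
apply: ae_on_weaken (supnorm_ae L) => x _ Hx; apply: le_trans Hx _.
by move: Hr; rewrite supnormE// lte_fin => /ltW.
Qed.

Lemma periodic_shift (P : R -> Prop) : (forall t, P (t + T) <-> P t) ->
  (forall t, 0 <= t < T -> P t) -> forall t, P t.
Proof.
move=> PT P0.
have PN t (m : nat) : P (t + m%:R * T) <-> P t.
  elim: m => [|m IH]; first by rewrite mul0r addr0.
  have E : t + m.+1%:R * T = t + m%:R * T + T by rewrite -natr1; ring.
  by rewrite E; split=> [/PT/IH|/IH/PT].
have Ppos t : 0 <= t -> P t.
  move=> t0; pose m := Num.truncn (t / T).
  have /andP[m1 m2] : (m%:R <= t / T < m.+1%:R).
    by apply: truncn_itv; rewrite divr_ge0// ltW.
  have -> : t = (t - m%:R * T) + m%:R * T by rewrite subrK.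
  apply/PN; apply: P0; rewrite subr_ge0 -ler_pdivlMr// m1/= ltrBlDl.
  by rewrite -{2}[T]mul1r -mulrDl natr1 -ltr_pdivrMr.
move=> t; apply/(PN t (Num.truncn (`|t| / T)).+1); apply: Ppos.
have /andP[_ m2] : ((Num.truncn (`|t| / T))%:R <= `|t| / T < (Num.truncn (`|t| / T)).+1%:R).
  by apply: truncn_itv; rewrite divr_ge0// ltW.
by rewrite ltr_pdivrMr// in m2; have := ler_norm (- t); rewrite normrN; lra.
Qed.

(** The essential infimum controls almost every time in $[0,T]$; continuity in time reaches all of
    $[0,T[$, and periodicity all times. *)
Lemma kappa_lower : exists2 c, 0 < c & forall t, ae_on D (fun x => c <= kappa t x).
Proof.
have [c c0 Hc] := ess_inf_cylinder_slices inf0; exists (c / 2); first by rewrite divr_gt0.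
apply: periodic_shift => [t|t /andP[t0 tT]].
  have [_ /(_ t) E _ _] := C1.
  by split=> H; apply: ae_on_weaken (ae_on_and E H) => x _ [->].
have c20 : 0 < c / 2 by rewrite divr_gt0.
have [d d0 Hd] := kappa_continuous t c20.
pose b := Num.min (t + d) T.
have tb : t < b by rewrite lt_min tT ltrDl d0.
(* An interval of positive length contains a good time; moving from it to [t] costs half of [c]. *)
have [r rtb Hr] : exists2 r, r \in `]t, b[ & ae_on D (fun x => c <= kappa r x).
  apply: contrapT => Hn; have [N [mN N0 NH]] := Hc.
  have : (leb `]t, b[%classic <= leb N)%E.
    have mI : measurable (`]t, b[%classic : set (measurableTypeR R)) by exact: measurable_itv.
    apply: le_measure; [exact/mem_set|exact/mem_set|].
    move=> r /= rtb; apply: NH => /= Hr; apply: Hn; exists r => //; apply: Hr.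
    move: rtb; rewrite !in_itv/= lt_min => /andP[tr /andP[_ rT]].
    by rewrite (le_trans t0 (ltW tr)) ltW.
  by rewrite [X in (_ <= X)%E]N0 lebesgue_measure_itv/= lte_fin tb -EFinB lee_fin leNgt subr_gt0 tb.
move: rtb; rewrite in_itv/= lt_min => /andP[tr /andP[rd _]].
have rd' : `|r - t| < d by rewrite gtr0_norm ?subr_gt0// ltrBlDl.
have := Hd _ rd'; rewrite subrKC => Hk.
apply: ae_on_weaken (ae_on_and Hr Hk) => x _ [h1]; rewrite ler_norml => /andP[h2 h3]; lra.
Qed.

Lemma supnorm_dist k1 k2 (e : R) : Linfty D k1 -> Linfty D k2 -> 0 <= e ->
  ae_on D (fun x => `|k1 x - k2 x| <= e) -> `|supnorm k1 - supnorm k2| <= e.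
Proof.
move=> L1 L2 e0 H; have A1 := supnorm_ae L1; have A2 := supnorm_ae L2.
have B1 : supnorm k1 <= supnorm k2 + e.
  apply: (supnorm_le (Linfty_measurable L1) _ _).2; first by rewrite addr_ge0// supnorm_ge0.
  apply: ae_on_weaken (ae_on_and H A2) => x _ [h1 h2].
  have -> : k1 x = k2 x + (k1 x - k2 x) by ring.
  by apply: le_trans (ler_normD _ _) _; rewrite lerD.
have B2 : supnorm k2 <= supnorm k1 + e.
  apply: (supnorm_le (Linfty_measurable L2) _ _).2; first by rewrite addr_ge0// supnorm_ge0.
  apply: ae_on_weaken (ae_on_and H A1) => x _ [h1 h2].
  have -> : k2 x = k1 x - (k1 x - k2 x) by ring.
  by apply: le_trans (ler_normB _ _) _; rewrite lerD.
by rewrite ler_norml; apply/andP; split; lra.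
Qed.

Definition ratio t : 'rV[R]_n -> R := fun x => Num.max (kappa' t x) 0 / kappa t x.

Lemma Linfty_ratio t : Linfty D (ratio t).
Proof.
have [c c0 Hc] := kappa_lower.
have mr : measurable_fun setT (ratio t \_ D).
  have -> : ratio t \_ D = (fun x => Num.max ((kappa' t \_ D) x) 0 * ((kappa t \_ D) x)^-1).
    by apply/funext => x; rewrite !patchE; case: ifPn => // _; rewrite maxxx mul0r.
  apply: measurable_funM.
    by apply: measurable_maxr; [exact: Linfty_measurable|exact: measurable_cst].
  by apply: (measurableT_comp (@measurable_inverse R)); exact: Linfty_measurable.
have M0 : 0 <= supnorm (kappa' t) / c by rewrite divr_ge0 ?supnorm_ge0// ltW.
apply: (supnorm_le mr M0 _).1.
apply: ae_on_weaken (ae_on_and (Hc t) (supnorm_ae (Lk' t))) => x _ [h1 h2].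
have k0 : 0 < kappa t x by exact: lt_le_trans h1.
rewrite /ratio normrM normfV (gtr0_norm k0) ler_pM ?invr_ge0 ?(ltW k0)//.
  apply: le_trans h2; rewrite ger0_norm ?le_max ?lexx ?orbT// ge_max normr_ge0 andbT.
  exact: ler_norm.
by rewrite lef_pV2.
Qed.

Lemma quotient_dist (a b k l c d1 d2 B : R) : 0 < c -> c <= k -> c <= l -> `|a - b| <= d1 ->
  `|k - l| <= d2 -> `|b| <= B ->
  `|Num.max a 0 / k - Num.max b 0 / l| <= d1 / c + B * d2 / c ^+ 2.
Proof.
move=> c0 ck cl abd kld bB.
have k0 : 0 < k by exact: lt_le_trans ck. have l0 : 0 < l by exact: lt_le_trans cl.
have mx : `|Num.max a 0 - Num.max b 0| <= d1.
  have abd0 := abd; move: abd0; rewrite !ler_norml /Num.max; case: (ltrP a 0) => a0; case: (ltrP b 0) => b0; lra.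
have mb : 0 <= Num.max b 0 <= B.
  rewrite le_max lexx orbT/= ge_max (le_trans (normr_ge0 b))// andbT.
  exact: le_trans (ler_norm b) _.
rewrite (_ : _ - _ = (Num.max a 0 - Num.max b 0) / k + Num.max b 0 * (l - k) / (k * l)); last first.
  by field; rewrite !gt_eqF.
apply: le_trans (ler_normD _ _) _; apply: lerD.
  rewrite normrM normfV (gtr0_norm k0) ler_pM ?invr_ge0 ?(ltW k0)//.
  by rewrite lef_pV2.
have /andP[mb0 mb1] := mb.
rewrite normrM normfV normrM (ger0_norm mb0) (gtr0_norm (mulr_gt0 k0 l0)).
rewrite ler_pM ?invr_ge0 ?mulr_ge0 ?(ltW k0) ?(ltW l0)//.
  by rewrite ler_pM// distrC.
by rewrite lef_pV2 ?posrE ?mulr_gt0 ?exprn_gt0// expr2 ler_pM// ltW.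
Qed.

Lemma ratio_dist t r (c d1 d2 : R) : 0 < c -> (forall t, ae_on D (fun x => c <= kappa t x)) ->
  0 <= d1 -> 0 <= d2 ->
  ae_on D (fun x => `|kappa' r x - kappa' t x| <= d1) ->
  ae_on D (fun x => `|kappa r x - kappa t x| <= d2) ->
  `|supnorm (ratio r) - supnorm (ratio t)| <= d1 / c + supnorm (kappa' t) * d2 / c ^+ 2.
Proof.
move=> c0 Hc d10 d20 H1 H2; apply: supnorm_dist; [exact: Linfty_ratio|exact: Linfty_ratio| |].
  by rewrite addr_ge0// divr_ge0 ?mulr_ge0 ?supnorm_ge0 ?exprn_ge0 ?(ltW c0).
have A := ae_on_and (ae_on_and (Hc r) (Hc t)) (ae_on_and (ae_on_and H1 H2) (supnorm_ae (Lk' t))).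
by apply: ae_on_weaken A => x _ [[h1 h2] [[h3 h4] h5]]; exact: quotient_dist.
Qed.

Lemma supnorm_ratio_continuous : continuous (fun t => supnorm (ratio t)).
Proof.
move=> t; have [c c0 Hc] := kappa_lower.
apply/cvgrPdist_le => e e0.
pose B := supnorm (kappa' t) + 1; have B0 : 0 < B by rewrite ltr_wpDl ?supnorm_ge0.
have e1 : 0 < e * c / 2 by rewrite divr_gt0 ?mulr_gt0.
have e2 : 0 < e * c ^+ 2 / (2 * B) by rewrite divr_gt0 ?mulr_gt0 ?exprn_gt0.
have [d1 d10 H1] := kappa'_continuous t e1; have [d2 d20 H2] := kappa_continuous t e2.
exists (Num.min d1 d2); first by rewrite /= lt_min d10.
move=> r /=; rewrite lt_min distrC => /andP[r1 r2].
have := H2 _ r2; rewrite subrKC => H2'.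
rewrite distrC; apply: le_trans (ratio_dist c0 Hc (ltW e1) (ltW e2) (H1 _ r1) H2') _.
apply: (@le_trans _ _ (e * c / 2 / c + B * (e * c ^+ 2 / (2 * B)) / c ^+ 2)).
  rewrite lerD2l ler_wpM2r ?invr_ge0 ?exprn_ge0 ?(ltW c0)//.
  by rewrite ler_wpM2r ?(ltW e2)// lerDl.
by rewrite le_eqVlt; apply/orP; left; apply/eqP; field; rewrite !gt_eqF.
Qed.

(** Periodicity is assumed of [kappa]; [kappa'] inherits it because its values at [t] and [t + T]
    are limits of difference quotients that agree almost everywhere. *)
Lemma supnorm_ratio_periodic t : supnorm (ratio (t + T)) = supnorm (ratio t).
Proof.
have [c c0 Hc] := kappa_lower; have [_ per _ _] := C1.
apply/eqP; rewrite -subr_eq0 -normr_le0; apply/ler_addgt0Pr => e e0; rewrite add0r.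
have e1 : 0 < e * c / 2 by rewrite divr_gt0 ?mulr_gt0.
have [d1 d10 H1] := quot_small t e1; have [d2 d20 H2] := quot_small (t + T) e1.
pose h := Num.min d1 d2 / 2.
have h0 : 0 < h by rewrite divr_gt0// lt_min d10.
have [h1 h2] : `|h| < d1 /\ `|h| < d2.
  have : h < Num.min d1 d2 by rewrite /h ltr_pdivrMr// ltr_pMr ?ltr1n// lt_min d10.
  by rewrite gtr0_norm// lt_min => /andP[].
have HN1 := H1 h (lt0r_neq0 h0) h1; have HN2 := H2 h (lt0r_neq0 h0) h2.
have P1 := per t; have P2 := per (t + h).
have A1 := ae_on_and P1 P2.
have A2 := ae_on_and (supnorm_ae (Lquot t h)) (supnorm_ae (Lquot (t + T) h)).
have H' : ae_on D (fun x => `|kappa' (t + T) x - kappa' t x| <= e * c).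
  apply: ae_on_weaken (ae_on_and A1 A2) => x _ [[E1 E2] [Q1 Q2]].
  have -> : kappa' (t + T) x - kappa' t x = quot t h x - quot (t + T) h x.
    by rewrite /quot E1 [t + T + h]addrAC E2; ring.
  apply: le_trans (ler_normB _ _) _; rewrite (splitr (e * c)).
  by apply: lerD; [exact: le_trans Q1 HN1|exact: le_trans Q2 HN2].
have P0 : ae_on D (fun x => `|kappa (t + T) x - kappa t x| <= 0).
  by apply: ae_on_weaken P1 => x _ ->; rewrite subrr normr0.
have ec0 : 0 <= e * c by rewrite mulr_ge0 ?ltW.
apply: le_trans (ratio_dist c0 Hc ec0 (lexx 0) H' P0) _.
by rewrite mulr0 mul0r addr0 mulfK// gt_eqF.
Qed.

Lemma is_derive_intro (f : R -> R) (x l : R) :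
  (forall e, 0 < e -> exists2 d, 0 < d & forall h, h != 0 -> `|h| < d ->
     `|h^-1 * (f (x + h) - f x) - l| <= e) -> is_derive x (1:R) f l.
Proof.
move=> H.
have C : (fun h : R => h^-1 *: (f (h *: (1:R) + x) - f x)) @ 0^' --> l.
  apply/cvgrPdist_le => e e0; have [d d0 Hd] := H e e0; exists d => // h /=.
  rewrite sub0r normrN => hd h0; rewrite distrC /GRing.scale/= mulr1 [h + x]addrC.
  exact: Hd.
have D1 : derivable f x 1 by apply/cvg_ex; exists l.
by apply: DeriveDef => //; exact: cvg_lim.
Qed.

Lemma energy_derive t (w : 'rV[R]_n -> R) : H1 D w ->
  is_derive t (1:R) (fun t => Aform D (kappa t) w w) (Aform D (kappa' t) w w).
Proof.
move=> Hw; set A := Aform D (cst 1) w w.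
have A0 : 0 <= A by have := Aform1_ge0 (toH1 oD w); rewrite toH1K.
apply: is_derive_intro => e e0.
have e1 : 0 < e / (A + 1) by rewrite divr_gt0// ltr_wpDl.
have [d d0 Hd] := quot_small t e1; exists d => // h h0 hd.
have E : h^-1 * (Aform D (kappa (t + h)) w w - Aform D (kappa t) w w) - Aform D (kappa' t) w w =
    Aform D (quot t h) w w.
  have L1 := Linfty_lin (- 1) (Lk t) (Lk (t + h)).
  have L2 := Linfty_lin h^-1 L1 (Linfty_lin (- 1 - 1) (Lk' t) (Lk' t)).
  rewrite (_ : quot t h = fun x => h^-1 * ((- 1) * kappa t x + kappa (t + h) x) +
     ((- 1 - 1) * kappa' t x + kappa' t x)); last first.
    by apply/funext => x; rewrite /quot; ring.
  by rewrite !Aform_linK//; [ring|exact: Linfty_lin].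
rewrite E; have Q := Lquot t h.
apply: le_trans (Aform_bound (M := e / (A + 1)) oD Q Hw _) _.
  by rewrite supnormE// lee_fin; exact: Hd.
rewrite -/A mulrAC ler_pdivrMr ?ltr_wpDl//.
by rewrite ler_wpM2l ?(ltW e0)// lerDl.
Qed.

Lemma Aform_scale (a : R) k (w : 'rV[R]_n -> R) : Linfty D k -> H1 D w ->
  Aform D (fun x => a * k x) w w = a * Aform D k w w.
Proof.
move=> L Hw; rewrite (_ : (fun x => a * k x) = (fun x => (a - 1) * k x + k x)).
  by rewrite Aform_linK//; ring.
by apply/funext => x; ring.
Qed.

(** Pointwise, $\kappa'\le\kappa'_+=(\kappa'_+/\kappa)\,\kappa$, and the ratio is at most its
    norm. *)
Lemma energy_rate t (w : 'rV[R]_n -> R) : H1 D w ->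
  Aform D (kappa' t) w w <= supnorm (ratio t) * Aform D (kappa t) w w.
Proof.
move=> Hw; have [c c0 Hc] := kappa_lower; rewrite -Aform_scale//.
have L : Linfty D (fun x => supnorm (ratio t) * kappa t x).
  have := Linfty_lin (supnorm (ratio t)) (Lk t) (Linfty_cst 0 oD).
  by congr (Linfty D); apply/funext => x; rewrite addr0.
apply: Aform_le => //.
apply: ae_on_weaken (ae_on_and (Hc t) (supnorm_ae (Linfty_ratio t))) => x _ [h1 h2].
have k0 : 0 < kappa t x by exact: lt_le_trans h1.
have := le_trans (ler_norm _) h2; rewrite /ratio ler_pdivrMr//; apply: le_trans.
by rewrite le_max lexx.
Qed.

Lemma continuous_bounded_itv (f : R -> R) (B : R) : 0 <= B -> continuous f ->
  exists2 M, 0 <= M & forall t, 0 <= t <= B -> f t <= M.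
Proof.
move=> B0 cf; have [c _ Hc] := @EVT_max R f 0 B B0 (continuous_subspaceT cf).
exists (Num.max 0 (f c)); first by rewrite le_max lexx.
by move=> t tB; rewrite le_max Hc ?orbT.
Qed.

Lemma kappa_forms (B : R) : 0 <= B -> exists (alpha : R -> R) (K L c : R),
  [/\ 0 <= K /\ 0 <= L, 0 < c, forall t, 0 <= t -> alpha (t + T) - alpha t = alpha T - alpha 0,
      (\int[leb]_(s in `[0%R, T]) Linfty_norm D (ratio s))%E = (alpha T - alpha 0)%:E &
      (forall t w, 0 <= t <= B -> H1 D w -> 
        [/\ 0 <= Aform D (kappa t) w w, Aform D (kappa t) w w <= K * dotH1 D w w &
         c * dotH1 D w w <= Aform D (kappa t) w w + dotL2 D w w]) /\
      (forall r t w, 0 <= r -> r <= t -> t <= B -> H1 D w ->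
        [/\ `|Aform D (kappa t) w w - Aform D (kappa r) w w| <= L * (t - r) * dotH1 D w w,
           Aform D (kappa t) w w <= expR (alpha t - alpha r) * Aform D (kappa r) w w
         & 0 <= alpha t - alpha r <= L * (t - r)])].
Proof.
move=> B0; have [c c0 Hc] := kappa_lower.
pose ra t := supnorm (ratio t); have cra : continuous ra := supnorm_ratio_continuous.
have [alpha dalpha] : exists alpha : R -> R, forall t : R, 0 <= t -> is_derive t (1:R) alpha (ra t).
  have [rho [S [P [[_ sS _] _ _ [S0 S1 _] _]]]] := @mollifier_exists R.
  (* The cut-off is 1 for $x\ge0$ and 0 for $x\le-1$, as [primitive_exists] requires. *)
  have cg : continuous (fun x : R => S (2 * x + 1) * ra x).
    move=> x; apply: cvgM; last exact: cra.
    exact: (smooth_continuous (smooth_affine 2 1 sS)).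
  have [|F [dF _]] := primitive_exists cg.
    by move=> x x1; rewrite S0 ?mul0r//; lra.
  by exists F => t t0; have := dF t; rewrite S1 ?mul1r//; lra.
have ccont (f : R -> R) t l : is_derive t (1:R) f l -> {for t, continuous f}.
  by move=> [df _]; apply/differentiable_continuous/derivable1_diffP.
have mvt (f f' : R -> R) r t : 0 <= r -> r <= t -> (forall x : R, 0 <= x -> is_derive x (1:R) f (f' x)) ->
    exists2 z, 0 <= z <= t & f t - f r = f' z * (t - r).
  move=> r0 rt df; have [||z] := @MVT_segment R f f' r t rt.
  - by move=> x /=; rewrite in_itv/= => /andP[rx _]; apply: df; rewrite (le_trans r0)// ltW.
  - apply: continuous_in_subspaceT => x; rewrite inE/= in_itv/= => /andP[rx _].
    by apply: ccont; apply: df; exact: le_trans rx.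
  by rewrite in_itv/= => /andP[z1 z2] E; exists z => //; rewrite z2 (le_trans r0).
have ck : continuous (fun t => supnorm (kappa t)).
  move=> t; apply/cvgrPdist_le => e e0; have [d d0 Hd] := kappa_continuous t e0.
  exists d => // r /=; rewrite distrC => rd; rewrite distrC; apply: supnorm_dist => //; first exact: ltW.
  by have := Hd _ rd; rewrite subrKC.
have ck' : continuous (fun t => supnorm (kappa' t)).
  move=> t; apply/cvgrPdist_le => e e0; have [d d0 Hd] := kappa'_continuous t e0.
  exists d => // r /=; rewrite distrC => rd; rewrite distrC; apply: supnorm_dist => //; first exact: ltW.
  exact: Hd _ rd.
have [K K0 HK] := continuous_bounded_itv B0 ck.
have [L1 L10 HL1] := continuous_bounded_itv B0 ck'.
have [L2 L20 HL2] := continuous_bounded_itv B0 cra.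
have A1 w : H1 D w -> 0 <= Aform D (cst 1) w w.
  by move=> Hw; have := Aform1_ge0 (toH1 oD w); rewrite toH1K.
have A1s w : H1 D w -> Aform D (cst 1) w w <= dotH1 D w w.
  by move=> Hw; rewrite dotH1E lerDr dotL2_ge0.
have Apos t w : H1 D w -> c * Aform D (cst 1) w w <= Aform D (kappa t) w w.
  move=> Hw; rewrite -Aform_scale//; last exact: Linfty_cst.
  apply: Aform_le => //; last by apply: ae_on_weaken (Hc t) => x _; rewrite mulr1.
  have := Linfty_cst c oD; congr (Linfty D); apply/funext => x; by rewrite /= mulr1.
exists alpha, K, (Num.max L1 L2), (Num.min c 1); split.
- by rewrite K0 le_max L10.
- by rewrite lt_min c0 ltr01.
- move=> t t0.
  have dd (x : R) : 0 <= x -> is_derive x (1:R) (fun x => alpha (x + T) - alpha x) (ra (x + T) - ra x).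
    move=> x0; apply: is_deriveB; last exact: dalpha.
    by apply: is_derive_translate; apply: dalpha; rewrite addr_ge0// ltW.
  have [z _] := mvt _ _ 0 t (lexx 0) t0 dd.
  by rewrite /ra supnorm_ratio_periodic subrr mul0r add0r => /eqP; rewrite subr_eq0 => /eqP.
- under eq_integral do rewrite (supnormE (Linfty_ratio _)) -/(ra _).
  rewrite (@continuous_FTC2 _ ra alpha 0 T)//.
  + exact: continuous_subspaceT.
  + split.
    * by move=> x; rewrite in_itv/= => /andP[/ltW/dalpha[]].
    * by apply: cvg_at_right_filter; apply: ccont; exact: dalpha.
    * by apply: cvg_at_left_filter; apply: ccont; apply: dalpha; exact: ltW.
  + by move=> x; rewrite in_itv/= => /andP[/ltW/dalpha[_ E] _]; rewrite derive1E.
split=> [t w tB Hw|r t w r0 rt tB Hw].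
  have c1 : Num.min c 1 <= c by rewrite ge_min lexx.
  have c2 : Num.min c 1 <= 1 by rewrite ge_min lexx orbT.
  have h1 := Apos t w Hw; have h2 := A1 w Hw; have h3 := dotL2_ge0 D w.
  split.
  - by apply: le_trans h1; rewrite mulr_ge0// ltW.
  - apply: le_trans (ler_norm _) _; apply: le_trans (Aform_bound (M := K) oD (Lk t) Hw _) _.
      by rewrite supnormE// lee_fin; exact: HK.
    by rewrite ler_wpM2l// A1s.
  - rewrite dotH1E mulrDr addrC lerD//.
      by apply: le_trans h1; rewrite ler_wpM2r.
    by rewrite -[leRHS]mul1r ler_wpM2r.
have t0 : 0 <= t by exact: le_trans rt.
have tr : 0 <= t - r by rewrite subr_ge0.
split.
- have [z /andP[z0 zt] ->] := mvt _ _ r t r0 rt (fun x _ => energy_derive x Hw).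
  rewrite normrM (ger0_norm tr) mulrAC; rewrite ler_wpM2r//.
  have zB : 0 <= z <= B by rewrite z0 (le_trans zt).
  apply: le_trans (Aform_bound (M := Num.max L1 L2) oD (Lk' z) Hw _) _.
    by rewrite supnormE// lee_fin le_max HL1.
  by rewrite ler_wpM2l ?A1s// le_max L10.
(* Gronwall with an integrating factor: by [energy_rate] the derivative of [F] is nonpositive. *)
- pose F x := expR (- alpha x) * Aform D (kappa x) w w.
  have dF (x : R) : 0 <= x -> is_derive x (1:R) F
      (expR (- alpha x) * (Aform D (kappa' x) w w - ra x * Aform D (kappa x) w w)).
    move=> x0; have da := dalpha x x0.
    have de : is_derive x (1:R) (fun x => expR (- alpha x)) (expR (- alpha x) * (- ra x)).
      by apply: (@is_derive1_comp _ expR (fun x => - alpha x)); exact: is_deriveN.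
    have := @is_deriveM _ _ _ _ x 1 _ _ de (energy_derive x Hw); congr (is_derive _ _ _ _).
    by rewrite /GRing.scale/=; ring.
  have [z /andP[z0 _] Ez] := mvt _ _ r t r0 rt dF.
  have : F t - F r <= 0.
    rewrite Ez mulr_le0_ge0// mulr_ge0_le0 ?expR_ge0// subr_le0.
    exact: energy_rate.
  rewrite subr_le0 /F => H.
  have := ler_wpM2l (expR_ge0 (alpha t)) H; rewrite !mulrA -!expRD subrr expR0 mul1r.
  by [].
- have [z /andP[z0 zt] ->] := mvt _ _ r t r0 rt dalpha.
  rewrite mulr_ge0 ?supnorm_ge0//= ler_wpM2r// le_max HL2 ?orbT// z0.
  exact: le_trans tB.
Qed.

End regular_coefficient.

End coefficient.

(** * Solutions on time grids *)

Section translation.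
Context {R : realType}.
Local Notation leb := (@lebesgue_measure R).

Lemma lebesgue_translate (c : R) (N : set R) : measurable (N : set (measurableTypeR R)) ->
  leb ((fun x => x + c) @^-1` N) = leb N.
Proof.
move=> mN.
have mc : measurable_fun setT (fun x : measurableTypeR R => (x + c : measurableTypeR R)).
  by apply: measurable_funD; [exact: measurable_id|exact: measurable_cst].
pose nu := pushforward leb (fun x : measurableTypeR R => (x + c : measurableTypeR R)).
pose mnu : {measure set (measurableTypeR R) -> \bar R} :=
  measure_function_pushforward__canonical__measure_function_Measure leb mc.
rewrite -[LHS]/(mnu N); apply/esym; apply: lebesgue_measure_unique => // X [[a b] _ <-].
rewrite /= -[RHS]/(leb ((fun x => x + c) @^-1` `]a, b]%classic)).
rewrite (_ : _ @^-1` _ = `]a - c, b - c]%classic); last first.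
  by apply/seteqP; split=> x /=; rewrite !in_itv/= ltrBlDr lerBrDr.
rewrite !lebesgue_measure_itv/= !lte_fin ltrD2r; case: ifPn => // _.
by rewrite -!EFinB; congr (_%:E); ring.
Qed.

Lemma ae_translate (c : R) (P : R -> Prop) : (\forall x \ae leb, P x) ->
  \forall x \ae leb, P (x + c).
Proof.
move=> [N [mN N0 NH]]; exists ((fun x => x + c) @^-1` N); split.
- have mc : measurable_fun setT (fun x : measurableTypeR R => (x + c : measurableTypeR R)).
    by apply: measurable_funD; [exact: measurable_id|exact: measurable_cst].
  by rewrite -[X in measurable X]setTI; exact: mc.
- by rewrite lebesgue_translate.
- by move=> x /= Hx; exact: NH.
Qed.

End translation.

Section sums.
Context {R : realType}.

(** Windows of [m] cells cover each cell at most [m] times. *)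
Lemma sum_window (f : nat -> R) (m N : nat) : {homo f : i j / (i <= j)%N >-> i <= j} ->
  \sum_(k < N) (f (k + m)%N - f k) <= m%:R * (f (N + m)%N - f 0%N).
Proof.
move=> fm; elim: m => [|m IH].
  by rewrite mul0r big1// => k _; rewrite addn0 subrr.
have -> : \sum_(k < N) (f (k + m.+1)%N - f k) =
    \sum_(k < N) (f (k + m)%N - f k) + \sum_(k < N) (f (k + m).+1 - f (k + m)%N).
  by rewrite -big_split/=; apply: eq_bigr => k _; rewrite addnS; ring.
have -> : \sum_(k < N) (f (k + m).+1 - f (k + m)%N) = f (N + m)%N - f m.
  elim: N {IH} => [|N IHN]; first by rewrite big_ord0 add0n subrr.
  by rewrite big_ord_recr/= IHN addSn; ring.
have h1 : f (N + m)%N <= f (N + m.+1)%N by apply: fm; rewrite leq_add2l.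
have h2 : f 0%N <= f m by exact: fm.
have h3 : m%:R * (f (N + m)%N - f 0%N) <= m%:R * (f (N + m.+1)%N - f 0%N).
  by rewrite ler_wpM2l// lerD2r.
by rewrite -natr1 mulrDl mul1r; lra.
Qed.

End sums.

Section primitive.
Context {R : realType}.
Local Notation leb := (@lebesgue_measure R).

(** Integrals over windows become differences of a single function, which are easy to compare and to
    sum. *)
Lemma monotone_primitive (k : R -> R) (A : R) : (forall t, 0 <= k t) ->
  (forall a b, leb.-integrable `[a, b] (EFin \o k)) ->
  exists Q : R -> R, forall x y, A <= x -> x <= y -> 
    0 <= \int[leb]_(t in `[x, y]) k t <= Q y - Q x.
Proof.
move=> k0 Ik; exists (fun x => \int[leb]_(t in `[A, x]) k t) => x y Ax xy.
rewrite Rintegral_ge0//= Rintegral_itvB ?bnd_simp//.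
rewrite Rintegral_itv_obnd_cbnd//.
have := Ik x y; apply: integrableS; [exact: measurable_itv|exact: measurable_itv|].
by apply: subset_itvr; rewrite bnd_simp.
Qed.

End primitive.

Section modulus.
Context {R : realType} {V : lmodType R} (s : V -> V -> R) (ps : psd s).

Lemma Lipschitz_itv (f f' : R -> R) (B : R) : 0 <= B ->
  (forall x : R, is_derive x (1:R) f (f' x)) -> continuous f' ->
  exists2 M, 0 <= M & forall t, 0 <= t <= B -> `|f t| <= M /\
    forall r, 0 <= r <= B -> `|f t - f r| <= M * `|t - r|.
Proof.
move=> B0 df cf'.
have cf : continuous f.
  by move=> x; apply/differentiable_continuous/derivable1_diffP; case: (df x).
have bnd (g : R -> R) : continuous g -> exists2 M, 0 <= M & forall t, 0 <= t <= B -> `|g t| <= M.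
  move=> cg; have cg' : continuous (fun x => `|g x|).
    by move=> x; apply: continuous_comp; [exact: cg|exact: norm_continuous].
  have [c _ Hc] := @EVT_max R _ 0 B B0 (continuous_subspaceT cg').
  by exists `|g c| => // t tB; apply: Hc.
have [M1 M10 H1] := bnd _ cf; have [M2 M20 H2] := bnd _ cf'.
exists (M1 + M2); first by rewrite addr_ge0.
have lip r t : 0 <= r -> r <= t -> t <= B -> `|f t - f r| <= (M1 + M2) * `|t - r|.
  move=> r0 rt tB; have [z] := @MVT_segment R f f' r t rt (fun x _ => df x) (continuous_subspaceT cf).
  rewrite in_itv/= => /andP[rz zt] ->; rewrite normrM ler_wpM2r//.
  by apply: (@le_trans _ _ M2); [apply: H2; rewrite (le_trans r0)//= (le_trans zt)|rewrite lerDr].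
move=> t tB; split; first by apply: le_trans (H1 t tB) _; rewrite lerDl.
move=> r rB; have /andP[t0 t1] := tB; have /andP[r0 r1] := rB.
have [rt|/ltW tr] := leP r t; first exact: lip.
by rewrite distrC [`|t - r|]distrC; exact: lip.
Qed.

Lemma increment_combination (P1 P2 : R -> V) (a b : R -> R) (M W t t' ell q : R) :
  0 <= M -> 0 <= W -> 0 <= ell -> `|t' - t| <= ell -> 0 <= q ->
  `|a t| <= M -> `|b t| <= M ->
  `|a t' - a t| <= M * `|t' - t| -> `|b t' - b t| <= M * `|t' - t| ->
  nrm s (P1 t') <= W -> nrm s (P2 t') <= W ->
  nrm s (P1 t' - P1 t) ^+ 2 <= ell * q -> nrm s (P2 t' - P2 t) ^+ 2 <= ell * q ->
  nrm s (a t' *: P1 t' + b t' *: P2 t' - (a t *: P1 t + b t *: P2 t)) ^+ 2 <=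
    12 * M ^+ 2 * (W ^+ 2 + 1) * (ell * (ell + q)).
Proof.
move=> M0 W0 l0 tl q0 at_ bt at' bt' W1 W2 D1 D2.
have n0 := nrm_ge0 s.
have E : a t' *: P1 t' + b t' *: P2 t' - (a t *: P1 t + b t *: P2 t) =
   (a t' - a t) *: P1 t' + (b t' - b t) *: P2 t' + (a t *: (P1 t' - P1 t) + b t *: (P2 t' - P2 t)).
  rewrite !scalerBl !scalerBr opprD [RHS]addrACA.
  by rewrite !subrKA [LHS]addrACA.
have N1 : nrm s ((a t' - a t) *: P1 t') <= M * ell * W.
  by rewrite nrmZ// ler_pM// (le_trans at')// ler_wpM2l.
have N2 : nrm s ((b t' - b t) *: P2 t') <= M * ell * W.
  by rewrite nrmZ// ler_pM// (le_trans bt')// ler_wpM2l.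
have N3 : nrm s (a t *: (P1 t' - P1 t)) <= M * nrm s (P1 t' - P1 t).
  by rewrite nrmZ// ler_wpM2r.
have N4 : nrm s (b t *: (P2 t' - P2 t)) <= M * nrm s (P2 t' - P2 t).
  by rewrite nrmZ// ler_wpM2r.
rewrite E; set d1 := nrm s (P1 t' - P1 t) in N3 D1 *; set d2 := nrm s (P2 t' - P2 t) in N4 D2 *.
have NN : nrm s ((a t' - a t) *: P1 t' + (b t' - b t) *: P2 t' + (a t *: (P1 t' - P1 t) + b t *: (P2 t' - P2 t)))
   <= 2 * (M * ell * W) + M * d1 + M * d2.
  apply: le_trans (nrmD _ _ ps) _; apply: le_trans (lerD (nrmD _ _ ps) (nrmD _ _ ps)) _.
  by move: N1 N2 N3 N4; clear; lra.
have d10 : 0 <= d1 by exact: n0.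
have d20 : 0 <= d2 by exact: n0.
have R0 : 0 <= 2 * (M * ell * W) + M * d1 + M * d2 by rewrite !addr_ge0 ?mulr_ge0.
apply: le_trans (_ : (2 * (M * ell * W) + M * d1 + M * d2) ^+ 2 <= _).
  by rewrite lerXn2r ?nnegrE ?n0.
(* $(x+y+z)^2\le3(x^2+y^2+z^2)$; the 4 is the square of the 2 in the first term, and $3\cdot4$ gives
   the 12. *)
apply: (@le_trans _ _ (3 * M ^+ 2 * (4 * ell ^+ 2 * W ^+ 2 + d1 ^+ 2 + d2 ^+ 2))).
  have := sqr_ge0 (2 * (M * ell * W) - M * d1); have := sqr_ge0 (2 * (M * ell * W) - M * d2).
  by have := sqr_ge0 (M * d1 - M * d2); rewrite !sqrrB !sqrrD !exprMn; clear; lra.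
rewrite [leRHS](_ : _ = 3 * M ^+ 2 * (4 * (W ^+ 2 + 1) * (ell * (ell + q)))); last by ring.
rewrite ler_wpM2l ?mulr_ge0 ?sqr_ge0//.
have h1 : 0 <= ell * q by rewrite mulr_ge0.
have h2 : 0 <= W ^+ 2 * (ell * q) by rewrite mulr_ge0 ?sqr_ge0.
have h3 := sqr_ge0 ell.
by move: D1 D2 h1 h2 h3; clear; lra.
Qed.

End modulus.

Lemma window_product (R : realType) (tau d qa qb qc qd : R) : 0 < d -> d <= 1 ->
  qa <= qb -> qb <= qc -> qc <= qd ->
  (tau + d - (tau - d)) * (tau + d - (tau - d) + (qc - qb)) <= 2 * d * (2 + (qd - qa)).
Proof. by move=> d0 d1 ab bc cd; apply: ler_pM; lra. Qed.

Section trajectory.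
Context {R : realType} {V : lmodType R} (s m : V -> V -> R) (ps : psd s) (pm : psd m).
Hypothesis ms : forall x, m x x <= s x x.
Local Notation leb := (@lebesgue_measure R).
Context (Lam : set R) (k Q : R -> R).
Hypothesis HQ : forall x y, - 1 <= x -> x <= y -> 0 <= \int[leb]_(t in `[x, y]) k t <= Q y - Q x.

Definition increments (P : R -> V) := forall t t' h, Lam t -> Lam t' -> t <= t' -> 0 < h ->
  nrm s (P t' - P t) ^+ 2 <= (t' - t + 2 * h) * \int[leb]_(x in `[t - h, t' + h]) k x.

(** Increments are measured by an open window around both times, not by their distance: for such
    windows [Q] can be summed along a grid. The term without [Q] comes from the smooth coefficients
    in [modulus_exists]. *)
Definition modulus (B C U : R) (Z : R -> V) :=
  (forall t, Lam t -> 0 <= t <= B -> nrm s (Z t) <= U) /\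
  forall t t' a b, Lam t -> Lam t' -> 0 <= t <= B -> 0 <= t' <= B -> - 1 <= a ->
    a < t < b -> a < t' < b ->
    nrm s (Z t' - Z t) ^+ 2 <= C * ((b - a) * (b - a + (Q b - Q a))).

Lemma Q_mono x y : - 1 <= x -> x <= y -> Q x <= Q y.
Proof. by move=> x1 xy; have := HQ x1 xy; lra. Qed.

Lemma increments_le (P : R -> V) t t' a b : increments P -> Lam t -> Lam t' -> t <= t' ->
  - 1 <= a -> a < t -> t' < b -> nrm s (P t' - P t) ^+ 2 <= (b - a) * (Q b - Q a).
Proof.
move=> iP Lt Lt' tt' a1 at_ bt'; pose h := Num.min (t - a) (b - t').
have h0 : 0 < h by rewrite lt_min !subr_gt0 at_ bt'.
have [h1 h2] : h <= t - a /\ h <= b - t' by rewrite !ge_min !lexx orbT.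
apply: le_trans (iP t t' h Lt Lt' tt' h0) _.
have x1 : - 1 <= t - h by lra.
have xy : t - h <= t' + h by lra.
have /andP[I0 I1] := HQ x1 xy.
have q1 : Q a <= Q (t - h) by apply: Q_mono => //; lra.
have q2 : Q (t' + h) <= Q b by apply: Q_mono; lra.
by apply: ler_pM => //; lra.
Qed.

Lemma increments_bounded (P : R -> V) (B : R) : increments P ->
  exists2 W, 0 <= W & forall t, Lam t -> 0 <= t <= B -> nrm s (P t) <= W.
Proof.
(* A good time serves as base point; if there is none, the claim is vacuous. *)
move=> iP; have [[tau [Lt tB]]|none] := pselect (exists t, Lam t /\ 0 <= t <= B); last first.
  by exists 0 => // t Lt tB; exfalso; apply: none; exists t.
pose E := (B + 1 - - 1) * (Q (B + 1) - Q (- 1)).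
have W0 : 0 <= nrm s (P tau) by exact: nrm_ge0.
have E0 : 0 <= E.
  by rewrite mulr_ge0// ?subr_ge0 ?Q_mono//; lra.
have sq (x : R) : 0 <= x -> x ^+ 2 <= E -> x <= E + 1.
  by move=> x0 xE; rewrite leNgt; apply/negP => xE1; nra.
exists (nrm s (P tau) + (E + 1)) => [|t Lt' tB']; first by rewrite !addr_ge0.
have H : nrm s (P t - P tau) <= E + 1.
  apply: sq; first exact: nrm_ge0.
  have [tt|/ltW tt] := leP tau t.
    by apply: increments_le => //; lra.
  by rewrite -nrmN// opprB; apply: increments_le => //; lra.
rewrite -[P t](subrKC (P tau)); apply: le_trans (nrmD _ _ ps) _; by rewrite lerD2l.
Qed.

Lemma modulus_exists (P1 P2 : R -> V) (a b a' b' : R -> R) (B : R) : 0 <= B ->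
  increments P1 -> increments P2 ->
  (forall x : R, is_derive x (1:R) a (a' x)) -> continuous a' ->
  (forall x : R, is_derive x (1:R) b (b' x)) -> continuous b' ->
  exists C U, [/\ 0 <= C, 0 <= U & modulus B C U (fun t => a t *: P1 t + b t *: P2 t)].
Proof.
move=> B0 i1 i2 da ca db cb.
have [Ma Ma0 Ha] := Lipschitz_itv B0 da ca; have [Mb Mb0 Hb] := Lipschitz_itv B0 db cb.
have [W1 W10 HW1] := increments_bounded B i1; have [W2 W20 HW2] := increments_bounded B i2.
pose M := Ma + Mb; pose W := W1 + W2.
have M0 : 0 <= M by rewrite addr_ge0.
have W0 : 0 <= W by rewrite addr_ge0.
have MaM : Ma <= M by rewrite lerDl.
have MbM : Mb <= M by rewrite lerDr.
have W1W : W1 <= W by rewrite lerDl.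
have W2W : W2 <= W by rewrite lerDr.
have aM t : 0 <= t <= B -> `|a t| <= M by move=> /Ha[h _]; exact: le_trans h MaM.
have bM t : 0 <= t <= B -> `|b t| <= M by move=> /Hb[h _]; exact: le_trans h MbM.
exists (12 * M ^+ 2 * (W ^+ 2 + 1)), (M * W + M * W); split.
- by rewrite !mulr_ge0 ?sqr_ge0// addr_ge0 ?sqr_ge0.
- by rewrite addr_ge0 ?mulr_ge0.
split=> [t Lt tB|].
  apply: le_trans (nrmD _ _ ps) _; rewrite !nrmZ//.
  apply: lerD; apply: ler_pM; rewrite ?nrm_ge0//.
  - exact: aM. - exact: le_trans (HW1 t Lt tB) W1W.
  - exact: bM. - exact: le_trans (HW2 t Lt tB) W2W.
have main t t' x y : Lam t -> Lam t' -> 0 <= t <= B -> 0 <= t' <= B -> - 1 <= x ->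
    t <= t' -> x < t -> t' < y ->
    nrm s (a t' *: P1 t' + b t' *: P2 t' - (a t *: P1 t + b t *: P2 t)) ^+ 2 <=
    12 * M ^+ 2 * (W ^+ 2 + 1) * ((y - x) * (y - x + (Q y - Q x))).
  move=> Lt Lt' tB tB' x1 tt' xt ty.
  have [_ /(_ t' tB') At] := Ha t tB; have [_ /(_ t' tB') Bt] := Hb t tB.
  apply: increment_combination => //; rewrite ?subr_ge0.
  - lra.
  - by rewrite ger0_norm; lra.
  - by apply: Q_mono => //; lra.
  - exact: aM.
  - exact: bM.
  - by rewrite distrC [`|t' - t|]distrC; apply: le_trans At _; rewrite ler_wpM2r.
  - by rewrite distrC [`|t' - t|]distrC; apply: le_trans Bt _; rewrite ler_wpM2r.
  - exact: le_trans (HW1 t' Lt' tB') W1W.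
  - exact: le_trans (HW2 t' Lt' tB') W2W.
  - exact: increments_le.
  - exact: increments_le.
move=> t t' x y Lt Lt' tB tB' x1 /andP[xt ty] /andP[xt' ty'].
have [tt|/ltW tt] := leP t t'; first exact: main.
by rewrite -nrmN// opprB; exact: main.
Qed.

Context (A : R -> V -> V -> R) (bA : forall t, bilin (A t)).

(** On $[t-2h,t+2h]$ the potential term varies by the change of form, at most $2hL\le L\nu$, and by
    the increment of [Z], at most [nu]. The window $t\pm3h$ strictly contains that interval. *)
Lemma grid_equation (Z : R -> V) (B C U K L t h nu : R) :
  (\forall t \ae leb, Lam t) -> 0 <= K -> 0 <= L -> 0 <= C -> 0 <= U -> modulus B C U Z ->
  (forall t w, 0 <= t <= B -> `|A t w w| <= K * s w w) ->
  (forall r t w, 0 <= r <= B -> 0 <= t <= B -> `|A t w w - A r w w| <= L * `|t - r| * s w w) ->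
  (forall w phi, test_function [set t : R | 0 < t] phi ->
     \int[leb]_(x in `[0%R, +oo[) (derive1n 2 phi x * m w (Z x) + phi x * A x w (Z x)) = 0) ->
  0 < h -> h <= 1 -> 2 * h < t -> t + 3 * h <= B ->
  Lam (t - h) -> Lam t -> Lam (t + h) -> 0 <= nu -> 2 * h <= nu ->
  C * (6 * h * (6 * h + (Q (t + 3 * h) - Q (t - 3 * h)))) <= nu ^+ 2 ->
  forall w, `|m w (Z (t + h)) - 2 * m w (Z t) + m w (Z (t - h)) + h ^+ 2 * A t w (Z t)| <=
    h ^+ 2 * ((L * U + K) * nu * nrm s w).
Proof.
move=> LamF K0 L0 C0 U0 [ZU ZC] AK AL weak h0 h1 ht tB Lm Lt Lp nu0 nuh nuC w.
have [bs s0] := ps; have [bm _] := pm.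
have t_in : 0 <= t <= B by apply/andP; split; lra.
apply: (@second_difference R (fun x => A x w (Z x)) (fun x => m w (Z x))) => //.
- by move=> phi tphi; exact: weak.
- move=> tau Htau e e0.
  have [Ltau /andP[tau1 tau2]] : Lam tau /\ t - h <= tau <= t + h.
    by move: Htau; rewrite !inE => /orP[/eqP->|/orP[/eqP->|/eqP->]]; split=> //; apply/andP; split; lra.
  pose E := C * (2 * (2 + (Q B - Q (- 1)))).
  have QB : Q (- 1) <= Q B by apply: Q_mono; lra.
  have E0 : 0 <= E by rewrite mulr_ge0//; lra.
  pose e1 := e / (nrm s w + 1).
  have nw1 : 0 < nrm s w + 1 by rewrite ltr_wpDl ?nrm_ge0.
  have e10 : 0 < e1 by rewrite divr_gt0.
  pose d := Num.min h (e1 ^+ 2 / (E + 1)).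
  have d0 : 0 < d by rewrite lt_min h0 divr_gt0 ?exprn_gt0 ?ltr_wpDl.
  have dh : d <= h by rewrite ge_min lexx.
  have dE : d * E <= e1 ^+ 2.
    have : d <= e1 ^+ 2 / (E + 1) by rewrite ge_min lexx orbT.
    rewrite ler_pdivlMr ?ltr_wpDl//; apply: le_trans.
    by rewrite ler_wpM2l ?(ltW d0)// lerDl.
  exists d => //; apply: aeS LamF => x Lx; rewrite ltr_norml => /andP[x1 x2].
  have H : nrm s (Z x - Z tau) <= e1.
    rewrite -(@ler_pXn2r _ 2)// ?nnegrE ?nrm_ge0 ?(ltW e10)//; apply: le_trans dE.
    have tau_in : 0 <= tau <= B by apply/andP; split; lra.
    have x_in : 0 <= x <= B by apply/andP; split; lra.
    have a1 : - 1 <= tau - d by lra.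
    have i1 : tau - d < tau < tau + d by apply/andP; split; lra.
    have i2 : tau - d < x < tau + d by apply/andP; split; lra.
    apply: le_trans (ZC _ _ _ _ Ltau Lx tau_in x_in a1 i1 i2) _.
    rewrite /E [leRHS]mulrCA ler_wpM2l// [leRHS](_ : _ = 2 * d * (2 + (Q B - Q (- 1)))); last by ring.
    have q1 : Q (- 1) <= Q (tau - d) by apply: Q_mono.
    have q2 : Q (tau + d) <= Q B by apply: Q_mono; lra.
    have q3 : Q (tau - d) <= Q (tau + d) by apply: Q_mono; lra.
    exact: (window_product tau d0 (le_trans dh h1) q1 q3 q2).
  rewrite -(bilinBr _ _ _ bm); apply: le_trans (psd_CS _ _ pm) _.
  apply: (@le_trans _ _ (nrm s w * e1)).
    by apply: ler_pM; rewrite ?nrm_ge0//; [exact: nrm_dom|exact: le_trans (nrm_dom _ ps pm ms) H].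
  rewrite /e1 mulrA ler_pdivrMr// mulrC ler_wpM2l ?(ltW e0)//.
  by rewrite lerDl.
apply: aeS LamF => x Lx; rewrite ler_norml => /andP[x1 x2].
have x_in : 0 <= x <= B by apply/andP; split; lra.
have H : nrm s (Z x - Z t) <= nu.
  rewrite -(@ler_pXn2r _ 2)// ?nnegrE ?nrm_ge0//; apply: le_trans nuC.
  have a1 : - 1 <= t - 3 * h by lra.
  have i1 : t - 3 * h < t < t + 3 * h by apply/andP; split; lra.
  have i2 : t - 3 * h < x < t + 3 * h by apply/andP; split; lra.
  apply: le_trans (ZC _ _ _ _ Lt Lx t_in x_in a1 i1 i2) _.
  by rewrite (_ : t + 3 * h - (t - 3 * h) = 6 * h)//; ring.
have B1 : `|A x w (Z x) - A t w (Z x)| <= L * (2 * h) * nrm s w * nrm s (Z x).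
  have bD : bilin (fun y z => - 1 * A t y z + A x y z) by exact: bilin_lin.
  have := @bilin_bound _ _ _ s (L * (2 * h)) w (Z x) bD ps _ _.
  rewrite mulN1r addrC; apply; first by rewrite !mulr_ge0// ltW.
  move=> y; rewrite mulN1r addrC; apply: le_trans (AL _ _ _ t_in x_in) _.
  by rewrite ler_wpM2r// ler_wpM2l// ler_norml x1.
have B2 : `|A t w (Z x) - A t w (Z t)| <= K * nrm s w * nrm s (Z x - Z t).
  by rewrite -(bilinBr _ _ _ (bA t)); apply: bilin_bound => // y; exact: AK.
rewrite (_ : A x w (Z x) - A t w (Z t) =
  (A x w (Z x) - A t w (Z x)) + (A t w (Z x) - A t w (Z t))); last by ring.
apply: le_trans (ler_normD _ _) _; rewrite [leRHS](_ : _ =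
  L * nu * nrm s w * U + K * nrm s w * nu); last by ring.
apply: lerD; [apply: le_trans B1 _|apply: le_trans B2 _]; last first.
  by rewrite ler_wpM2l// mulr_ge0 ?nrm_ge0.
apply: ler_pM; rewrite ?nrm_ge0 ?mulr_ge0 ?nrm_ge0 ?(ltW h0)//; last exact: ZU.
by rewrite ler_wpM2r ?nrm_ge0// ler_wpM2l.
Qed.

End trajectory.

(** * Complexification by pairs *)

Section pair_forms.
Context {R : realType} {V : lmodType R}.
Implicit Types (b s : V -> V -> R) (x y w : V * V).

Definition pairf b x y := b x.1 y.1 + b x.2 y.2.

Lemma bilin_pairf b : bilin b -> bilin (pairf b).
Proof.
move=> [bC bl]; split=> [x y|a x y z]; first by rewrite /pairf bC [b x.2 _]bC.
by rewrite /pairf /= !bl; ring.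
Qed.

Lemma psd_pairf s : psd s -> psd (pairf s).
Proof. by move=> [bs s0]; split; [exact: bilin_pairf|move=> x; rewrite addr_ge0]. Qed.

Lemma sqr_nrm_pairf s x : psd s -> nrm (pairf s) x ^+ 2 = nrm s x.1 ^+ 2 + nrm s x.2 ^+ 2.
Proof. by move=> ps; rewrite !sqr_nrm//; exact: psd_pairf. Qed.

Lemma nrm_pairf1 s x : psd s -> nrm s x.1 <= nrm (pairf s) x.
Proof. by move=> [_ s0]; rewrite /nrm ler_wsqrtr// lerDl. Qed.

Lemma nrm_pairf2 s x : psd s -> nrm s x.2 <= nrm (pairf s) x.
Proof. by move=> [_ s0]; rewrite /nrm ler_wsqrtr// lerDr. Qed.

Lemma nrm_pairf_le s x : psd s -> nrm (pairf s) x <= nrm s x.1 + nrm s x.2.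
Proof.
move=> ps; rewrite -(@ler_pXn2r _ 2)// ?nnegrE ?addr_ge0 ?nrm_ge0//.
by rewrite sqr_nrm_pairf// sqrrD lerD2r lerDl mulrn_wge0// mulr_ge0 ?nrm_ge0.
Qed.

(* Multiplication by [l1 + i l2], a pair being a real and an imaginary part. *)
Definition mulc (l1 l2 : R) x : V * V := (l1 *: x.1 - l2 *: x.2, l2 *: x.1 + l1 *: x.2).

Lemma pairf_mulc b l1 l2 x y : bilin b ->
  pairf b (mulc l1 l2 x) (mulc l1 l2 y) = (l1 ^+ 2 + l2 ^+ 2) * pairf b x y.
Proof.
move=> bb; rewrite /pairf /mulc /= !(bilinBl _ _ _ bb) !(bilinDl _ _ _ bb) !(bilinBr _ _ _ bb).
rewrite !(bilinDr _ _ _ bb) !(bilinZl _ _ _ bb) !(bilinZr _ _ _ bb); ring.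
Qed.

Lemma mulc_surj l1 l2 : 0 < l1 ^+ 2 + l2 ^+ 2 -> forall w, 
  mulc l1 l2 ((l1 ^+ 2 + l2 ^+ 2)^-1 *: mulc l1 (- l2) w) = w.
Proof.
move=> G0 [w1 w2]; rewrite /mulc /=; set g := (_ + _)^-1.
have E (a b c d : R) (u v : V) : a *: (g *: (b *: u + c *: v)) = (g * (a * b)) *: u + (g * (a * c)) *: v.
  by rewrite !scalerDr !scalerA [a * g]mulrC -!mulrA.
rewrite -[- (- l2 *: w2)]scaleNr opprK.
have gE : g * (l1 ^+ 2 + l2 ^+ 2) = 1 by rewrite mulVf// gt_eqF.
congr pair.
  rewrite -[- (l2 *: _)]scaleNr !E// addrACA -!scalerDl.
  transitivity (1 *: w1 + 0 *: w2); last by rewrite scale1r scale0r addr0.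
  by congr (_ *: _ + _ *: _); [rewrite -gE|]; ring.
rewrite !E// addrACA -!scalerDl.
transitivity (0 *: w1 + 1 *: w2); last by rewrite scale1r scale0r add0r.
by congr (_ *: _ + _ *: _); [|rewrite -gE]; ring.
Qed.

End pair_forms.

Lemma grid_point_bounds (R : realType) (t0 T h tk tl : R) : 0 < t0 -> 0 < T -> 0 < h ->
  h <= T -> tk <= tl -> tl <= tk + h + h -> tl <= t0 + T + 2 * h -> t0 <= tl ->
  0 <= tl <= t0 + 6 * T /\ tk + h - 3 * h < tl < tk + h + 3 * h.
Proof. by move=> *; split; apply/andP; split; lra. Qed.

Section second_differences.
Context {R : realType} {V : lmodType R} (s m : V -> V -> R) (ps : psd s) (pm : psd m).
Context (A : R -> V -> V -> R) (bA : forall t, bilin (A t)).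

Definition near_solution (Z : R -> V) (t h e : R) := forall w,
  `|m w (Z (t + h)) - 2 * m w (Z t) + m w (Z (t - h)) + h ^+ 2 * A t w (Z t)| <= h ^+ 2 * (e * nrm s w).

Lemma near_solution0 t h e : 0 <= e -> near_solution (fun=> 0) t h e.
Proof.
move=> e0 w; have [bm _] := pm.
have z b : bilin b -> b w 0 = 0 by move=> bb; rewrite bilinC// bilin0l.
by rewrite !z// !mulr0 !subr0 !addr0 normr0 mulr_ge0 ?sqr_ge0// mulr_ge0 ?nrm_ge0.
Qed.

Lemma near_solution_shift (Z1 Z2 : R -> V) (l1 l2 T t h e : R) : l2 != 0 ->
  (forall t x y, A (t + T) x y = A t x y) ->
  (forall r, m (Z1 (r + T) - (l1 *: Z1 r - l2 *: Z2 r)) (Z1 (r + T) - (l1 *: Z1 r - l2 *: Z2 r)) = 0) ->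
  (forall r w, A t w (Z1 (r + T)) = A t w (l1 *: Z1 r - l2 *: Z2 r)) ->
  near_solution Z1 t h e -> near_solution Z1 (t + T) h e ->
  near_solution Z2 t h (e * ((`|l1| + 1) / `|l2|)).
Proof.
move=> l20 AT mT AZ N1 N2 w; have [bm m0] := pm.
have mE r : m w (Z2 r) = (l1 * m w (Z1 r) - m w (Z1 (r + T))) / l2.
  have : m w (Z1 (r + T) - (l1 *: Z1 r - l2 *: Z2 r)) = 0.
    apply/eqP; rewrite -normr_le0; apply: le_trans (psd_CS _ _ pm) _.
    by rewrite [nrm m (_ - _)]/nrm mT sqrtr0 mulr0.
  rewrite !(bilinBr _ _ _ bm) !(bilinZr _ _ _ bm) => E.
  apply: (mulfI l20); rewrite mulrCA mulfV// mulr1; move: E; lra.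
have AE : A t w (Z2 t) = (l1 * A t w (Z1 t) - A t w (Z1 (t + T))) / l2.
  rewrite AZ (bilinBr _ _ _ (bA t)) !(bilinZr _ _ _ (bA t)).
  by field.
have := N1 w; have := N2 w; rewrite AT.
rewrite [t + T + h]addrAC [t + T - h]addrAC !mE AE => H2 H1.
set X1 := (X in `|X| <= _) in H1; set X2 := (X in `|X| <= _) in H2.
rewrite [X in `|X|](_ : _ = (l1 * X1 - X2) / l2); last by rewrite /X1 /X2; field.
rewrite normrM normfV ler_pdivrMr ?normr_gt0//.
have l2n : `|l2| != 0 by rewrite normr_eq0.
rewrite [leRHS](_ : _ = `|l1| * (h ^+ 2 * (e * nrm s w)) + h ^+ 2 * (e * nrm s w)); last by field.
apply: le_trans (ler_normB _ _) _; rewrite normrM; apply: lerD => //.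
by rewrite ler_wpM2l.
Qed.

Lemma near_solution_pair (Za Zb : R -> V) (t h e1 e2 : R) : 0 <= e1 -> 0 <= e2 ->
  near_solution Za t h e1 -> near_solution Zb t h e2 ->
  let u x := (Za x, Zb x) in
  forall w : V * V, `|pairf m (u (t + h) - u t - (u t - u (t - h))) w + h ^+ 2 * pairf (A t) w (u t)| <=
    h ^+ 2 * ((e1 + e2) * nrm (pairf s) w).
Proof.
move=> e10 e20 Na Nb u w; have [bm _] := pm.
have E (Z : R -> V) (x : V) : m (Z (t + h) - Z t - (Z t - Z (t - h))) x =
    m x (Z (t + h)) - 2 * m x (Z t) + m x (Z (t - h)).
  by rewrite bilinC// !(bilinBr _ _ _ bm); ring.
rewrite /pairf /= !E mulrDr addrACA; apply: le_trans (ler_normD _ _) _.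
rewrite [leRHS](_ : _ = h ^+ 2 * (e1 * nrm (pairf s) w) + h ^+ 2 * (e2 * nrm (pairf s) w)); last by ring.
apply: lerD; [apply: le_trans (Na _) _|apply: le_trans (Nb _) _].
  by rewrite ler_wpM2l ?sqr_ge0// ler_wpM2l// nrm_pairf1.
by rewrite ler_wpM2l ?sqr_ge0// ler_wpM2l// nrm_pairf2.
Qed.

End second_differences.

(** * The complex Floquet solution on the grids *)

Section floquet.
Context {R : realType} {V : lmodType R} (s m : V -> V -> R) (ps : psd s) (pm : psd m).
Hypothesis ms : forall x, m x x <= s x x.
Local Notation leb := (@lebesgue_measure R).
Context (A : R -> V -> V -> R) (bA : forall t, bilin (A t)).
Context (P1 P2 : R -> V) (gam rho T : R) (T0 : 0 < T).
Hypothesis AT : forall t x y, A (t + T) x y = A t x y.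
Hypothesis P1T : forall t, nrm s (P1 (t + T) - P1 t) = 0.
Hypothesis P2T : forall t, nrm s (P2 (t + T) - P2 t) = 0.

Let c1 t := expR (gam * t) * cos (rho * t).
Let c2 t := expR (gam * t) * sin (rho * t).
(** [l1] and [l2] are the real and imaginary parts of the multiplier $e^{-iwT}$, whence the sign of
    [l2]. *)
Let l1 := expR (gam * T) * cos (rho * T).
Let l2 := - (expR (gam * T) * sin (rho * T)).

(* Real and imaginary parts of [e^(-iwt) (P1 + i P2)] for [w = rho + i gam]. *)
Definition re_part t := c1 t *: P1 t + c2 t *: P2 t.
Definition im_part t := c1 t *: P2 t + (- c2 t) *: P1 t.

Lemma floquet_modulus : l1 ^+ 2 + l2 ^+ 2 = expR (2 * gam * T).
Proof.
rewrite /l1 /l2 sqrrN !exprMn -mulrDr cos2Dsin2 mulr1 expr2 -expRD; congr expR; ring.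
Qed.

Lemma c1_derive (x : R) : is_derive x (1:R) c1 (gam * c1 x - rho * c2 x).
Proof.
have de := @is_derive_dilate _ expR gam x _ (is_derive_expR _).
have dc := @is_derive_dilate _ cos rho x _ (is_derive_cos _).
have := @is_deriveM _ _ _ _ x 1 _ _ de dc; congr (is_derive _ _ _ _).
by rewrite /GRing.scale/= /c1 /c2; ring.
Qed.

Lemma c2_derive (x : R) : is_derive x (1:R) c2 (gam * c2 x + rho * c1 x).
Proof.
have de := @is_derive_dilate _ expR gam x _ (is_derive_expR _).
have dc := @is_derive_dilate _ sin rho x _ (is_derive_sin _).
have := @is_deriveM _ _ _ _ x 1 _ _ de dc; congr (is_derive _ _ _ _).
by rewrite /GRing.scale/= /c1 /c2; ring.
Qed.

Lemma c1_shift t : c1 (t + T) = l1 * c1 t + l2 * c2 t.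
Proof. by rewrite /c1 /c2 /l1 /l2 !mulrDr expRD cosD; ring. Qed.

Lemma c2_shift t : c2 (t + T) = l1 * c2 t - l2 * c1 t.
Proof. by rewrite /c1 /c2 /l1 /l2 !mulrDr expRD sinD; ring. Qed.

Lemma nrm0D x y : nrm s x = 0 -> nrm s y = 0 -> nrm s (x + y) = 0.
Proof.
move=> x0 y0; apply/eqP; rewrite eq_le nrm_ge0 andbT.
by apply: le_trans (nrmD _ _ ps) _; rewrite x0 y0 addr0.
Qed.

Lemma nrm0Z a x : nrm s x = 0 -> nrm s (a *: x) = 0.
Proof. by move=> x0; rewrite nrmZ// x0 mulr0. Qed.

Lemma module_rearrange (a b l k c d : R) (x y x' y' : V) : a = l * c + k * d -> b = l * d - k * c ->
  a *: x' + b *: y' - (l *: (c *: x + d *: y) - k *: (c *: y + (- d) *: x)) =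
  a *: (x' - x) + b *: (y' - y).
Proof.
move=> aE bE; have -> : l *: (c *: x + d *: y) - k *: (c *: y + (- d) *: x) = a *: x + b *: y.
  rewrite -scaleNr [c *: y + _]addrC !scalerDr !scalerA addrACA -!scalerDl aE bE.
  by congr (_ *: _ + _ *: _); ring.
by rewrite !scalerBr opprD addrACA.
Qed.

Lemma re_part_shift t : nrm s (re_part (t + T) - (l1 *: re_part t - l2 *: im_part t)) = 0.
Proof.
rewrite /re_part /im_part (module_rearrange _ _ _ _ (c1_shift t) (c2_shift t)).
by apply: nrm0D; exact: nrm0Z.
Qed.

Lemma im_part_shift t : nrm s (im_part (t + T) - (l2 *: re_part t + l1 *: im_part t)) = 0.
Proof.
(* The imaginary part is the real part with [P1] and [P2] exchanged and the signs of [c2] and [l2]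
   reversed, so [module_rearrange] applies again. *)
have E : - c2 (t + T) = l1 * (- c2 t) - (- l2) * c1 t by rewrite c2_shift; ring.
have E1 : c1 (t + T) = l1 * c1 t + (- l2) * (- c2 t) by rewrite c1_shift; ring.
have -> : l2 *: re_part t + l1 *: im_part t =
    l1 *: (c1 t *: P2 t + (- c2 t) *: P1 t) - (- l2) *: (c1 t *: P1 t + (- - c2 t) *: P2 t).
  by rewrite [- - c2 t]opprK [(- l2) *: _]scaleNr opprK addrC.
rewrite /im_part (module_rearrange _ _ _ _ E1 E).
by apply: nrm0D; exact: nrm0Z.
Qed.

Context (Lam : set R) (k Q : R -> R).
Hypothesis LamF : \forall t \ae leb, Lam t.
Hypothesis HQ : forall x y, - 1 <= x -> x <= y -> 0 <= \int[leb]_(t in `[x, y]) k t <= Q y - Q x.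
Hypothesis iP1 : increments s Lam k P1.
Hypothesis iP2 : increments s Lam k P2.
Hypothesis weak : forall w phi, test_function [set t : R | 0 < t] phi ->
  \int[leb]_(x in `[0%R, +oo[) (derive1n 2 phi x * m w (re_part x) + phi x * A x w (re_part x)) = 0.

Context (t0 B : R) (alpha : R -> R) (K L c : R).
Hypothesis t00 : 0 < t0.
Hypothesis Lgrid : forall n j, Lam (t0 + j%:R * (T / n.+1%:R)).
Hypothesis BE : B = t0 + 6 * T.
Hypothesis K0 : 0 <= K.
Hypothesis L0 : 0 <= L.
Hypothesis cpos : 0 < c.
Hypothesis F1 : forall t w, 0 <= t <= B ->
  [/\ 0 <= A t w w, A t w w <= K * s w w & c * s w w <= A t w w + m w w].
Hypothesis F2 : forall r t w, 0 <= r -> r <= t -> t <= B ->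
  [/\ `|A t w w - A r w w| <= L * (t - r) * s w w,
      A t w w <= expR (alpha t - alpha r) * A r w w & 0 <= alpha t - alpha r <= L * (t - r)].

(** Only the real part is given as a solution. If the multiplier is real, translates say nothing
    about the imaginary part; it is replaced by 0, which is compatible with [mulc] because [l2] is
    0. *)
Let im_part' t := if l2 == 0 then 0 else im_part t.
Let u t := (re_part t, im_part' t).

Let AK t w : 0 <= t <= B -> `|A t w w| <= K * s w w.
Proof. by move=> /(F1 w)[a0 aK _]; rewrite ger0_norm. Qed.

Let AL r t w : 0 <= r <= B -> 0 <= t <= B -> `|A t w w - A r w w| <= L * `|t - r| * s w w.
Proof.
move=> /andP[r0 rB] /andP[t0' tB]; have [rt|/ltW tr] := leP r t.
  by have [H _ _] := F2 w r0 rt tB; rewrite [`|t - r|]ger0_norm// subr_ge0.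
have [H _ _] := F2 w t0' tr rB; rewrite distrC [`|t - r|]distrC.
by rewrite [`|r - t|]ger0_norm// subr_ge0.
Qed.

(** The imaginary part is recovered from two translates of the real part, so the conditions on grid
    points and windows are imposed at [t] and at [t + T]. *)
Lemma step_near_solution : exists C U E, [/\ 0 <= C, 0 <= U, 0 <= E,
    modulus s Lam Q B C U re_part /\ modulus s Lam Q B C U im_part' &
    forall t h nu, 0 < h -> h <= 1 -> 2 * h < t -> t + T + 3 * h <= B ->
      Lam (t - h) -> Lam t -> Lam (t + h) -> Lam (t + T - h) -> Lam (t + T) -> Lam (t + T + h) ->
      0 <= nu -> 2 * h <= nu ->
      C * (6 * h * (6 * h + (Q (t + 3 * h) - Q (t - 3 * h)))) <= nu ^+ 2 ->
      C * (6 * h * (6 * h + (Q (t + T + 3 * h) - Q (t + T - 3 * h)))) <= nu ^+ 2 ->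
      near_solution s m A re_part t h (E * nu) /\ near_solution s m A im_part' t h (E * nu)].
Proof.
have T0' := T0; have t00' := t00; have BE' := BE.
have B0 : 0 <= B by rewrite BE addr_ge0 ?mulr_ge0 ?ltW.
have cc1 : continuous c1.
  by move=> x; apply/differentiable_continuous/derivable1_diffP; case: (c1_derive x).
have cc2 : continuous c2.
  by move=> x; apply/differentiable_continuous/derivable1_diffP; case: (c2_derive x).
have cd1 : continuous (fun x => gam * c1 x - rho * c2 x).
  move=> x; apply: cvgB; apply: cvgM; [exact: cvg_cst|exact: cc1|exact: cvg_cst|exact: cc2].
have cd2 : continuous (fun x => gam * c2 x + rho * c1 x).
  move=> x; apply: cvgD; apply: cvgM; [exact: cvg_cst|exact: cc2|exact: cvg_cst|exact: cc1].
have cd2' : continuous (fun x => - (gam * c2 x + rho * c1 x)).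
  by move=> x; apply: cvgN; exact: cd2.
have dn2 (x : R) : is_derive x (1:R) (fun x => - c2 x) (- (gam * c2 x + rho * c1 x)).
  by have := c2_derive x; exact: is_deriveN.
have [Ca [Ua [Ca0 Ua0 [Za1 Za2]]]] := modulus_exists ps HQ B0 iP1 iP2 c1_derive cd1 c2_derive cd2.
have [Cb [Ub [Cb0 Ub0 [Zb1 Zb2]]]] := modulus_exists ps HQ B0 iP2 iP1 c1_derive cd1 dn2 cd2'.
pose C := Ca + Cb; pose U := Ua + Ub.
have qpos t t' a b : - 1 <= a -> a < t < b -> a < t' < b -> 0 <= (b - a) * (b - a + (Q b - Q a)).
  move=> a1 /andP[h1 h2] _; have ab := ltW (lt_trans h1 h2).
  have q := Q_mono HQ a1 ab; apply: mulr_ge0; first by rewrite subr_ge0.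
  by apply: addr_ge0; rewrite subr_ge0.
have imE : im_part' = (if l2 == 0 then fun=> 0 else im_part).
  by apply/funext => t; rewrite /im_part'; case: ifP.
have ma : modulus s Lam Q B C U re_part.
  split=> [t Lt tB|t t' a b Lt Lt' tB tB' a1 i1 i2].
    by apply: le_trans (Za1 t Lt tB) _; rewrite lerDl.
  apply: le_trans (Za2 t t' a b Lt Lt' tB tB' a1 i1 i2) _.
  by rewrite ler_wpM2r ?lerDl//; exact: (qpos t t').
have mb : modulus s Lam Q B C U im_part'.
  rewrite imE; case: ifP => _; split=> [t Lt tB|t t' a b Lt Lt' tB tB' a1 i1 i2].
  - by rewrite /nrm; have [bs _] := ps; rewrite (bilin0l _ bs) sqrtr0 addr_ge0.
  - rewrite subrr /nrm; have [bs _] := ps; rewrite (bilin0l _ bs) sqrtr0 expr0n/=.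
    by rewrite mulr_ge0 ?addr_ge0//; exact: (qpos t t').
  - by apply: le_trans (Zb1 t Lt tB) _; rewrite lerDr.
  - apply: le_trans (Zb2 t t' a b Lt Lt' tB tB' a1 i1 i2) _.
    by rewrite ler_wpM2r ?lerDr//; exact: (qpos t t').
pose r := (`|l1| + 1) / `|l2|.
have r0 : 0 <= r by rewrite divr_ge0// addr_ge0.
have C0 : 0 <= C by rewrite addr_ge0.
have U0 : 0 <= U by rewrite addr_ge0.
have E0 : 0 <= L * U + K by rewrite addr_ge0 ?mulr_ge0.
exists C, U, ((L * U + K) * (1 + r)); split=> //.
  by rewrite mulr_ge0// addr_ge0.
move=> t h nu h0 h1 ht tB L1 L2 L3 L4 L5 L6 nu0 nuh q1 q2.
have tB1 : t + 3 * h <= B by apply: le_trans tB; lra.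
have ht' : 2 * h < t + T by lra.
have N1 : near_solution s m A re_part t h ((L * U + K) * nu).
  exact: (grid_equation ps pm ms HQ bA LamF K0 L0 C0 U0 ma AK AL weak h0 h1 ht tB1).
have N2 : near_solution s m A re_part (t + T) h ((L * U + K) * nu).
  exact: (grid_equation ps pm ms HQ bA LamF K0 L0 C0 U0 ma AK AL weak h0 h1 ht' tB).
have mono e e' Z : e <= e' -> near_solution s m A Z t h e -> near_solution s m A Z t h e'.
  move=> ee H w; apply: le_trans (H w) _; rewrite ler_wpM2l ?sqr_ge0//.
  by rewrite ler_wpM2r// nrm_ge0.
have En0 : 0 <= (L * U + K) * nu by rewrite mulr_ge0.
split; first by apply: mono N1; rewrite mulrAC ler_peMr// lerDl.
rewrite imE; have [_|l20] := eqVneq l2 0.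
  by apply: near_solution0 => //; rewrite !mulr_ge0// addr_ge0.
have tin : 0 <= t <= B by apply/andP; split; lra.
have null r' : s (re_part (r' + T) - (l1 *: re_part r' - l2 *: im_part r'))
    (re_part (r' + T) - (l1 *: re_part r' - l2 *: im_part r')) = 0.
  by rewrite -sqr_nrm// re_part_shift expr0n.
have nullm r' : m (re_part (r' + T) - (l1 *: re_part r' - l2 *: im_part r'))
    (re_part (r' + T) - (l1 *: re_part r' - l2 *: im_part r')) = 0.
  by apply/eqP; rewrite eq_le; have [_ m0] := pm; rewrite m0 andbT -(null r') ms.
have nullA r' w : A t w (re_part (r' + T)) = A t w (l1 *: re_part r' - l2 *: im_part r').
  rewrite !(bilinC w _ (bA t)).
  apply: (psd0_bilin (K := K) w ps (bA t) K0 _ (null r')) => x y.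
  by apply: bilin_bound => // z; exact: AK.
have H := near_solution_shift pm bA l20 AT nullm nullA N1 N2.
by apply: mono H; rewrite -/r [leLHS]mulrAC ler_wpM2r// ler_wpM2l// lerDr.
Qed.

Lemma u_shift t : nrm (pairf s) (u (t + T) - mulc l1 l2 (u t)) = 0.
Proof.
have [bs _] := ps; have n00 : nrm s 0 = 0 by rewrite /nrm (bilin0l _ bs) sqrtr0.
apply/eqP; rewrite eq_le nrm_ge0 andbT; apply: le_trans (nrm_pairf_le _ ps) _ => /=.
rewrite /u /im_part' /mulc; case: (eqVneq l2 0) => [l20|l20] /=.
  have := re_part_shift t; rewrite l20 !scale0r !subr0 scaler0 addr0 subr0 => ->.
  by rewrite n00 addr0.
by rewrite re_part_shift im_part_shift addr0.
Qed.

Lemma floquet_grids_exist :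
  floquet_grids (pairf s) (pairf m) (fun t => pairf (A t)) u (mulc l1 l2) t0 T.
Proof.
have T0' := T0; have t00' := t00; have BE' := BE.
have [C [U [E [C0 U0 E0 [Ma Mb] SD]]]] := step_near_solution.
have QB : 0 <= Q B - Q (- 1) by rewrite subr_ge0; apply: (Q_mono HQ) => //; rewrite BE; lra.
(* 72 is 36, from the factor 6 on both [h], times 2, for the two components of the pair; the 4
   provides [2 * h <= nu j]. *)
pose D := Q B - Q (- 1); pose Cb := 72 * C + 4.
have Cb0 : 0 <= Cb by rewrite addr_ge0 ?mulr_ge0.
exists (E + E), (U + U), (Cb * T * (T + 12 * D)); split; rewrite ?addr_ge0//.
  by rewrite mulr_ge0 ?mulr_ge0 ?(ltW T0)// addr_ge0 ?mulr_ge0 ?(ltW T0).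
(* It forces $h\le1/2$ and $2h\le t_0$, so that the test functions at interior grid points live on
   positive times. *)
pose hm := Num.min 2^-1 (t0 / 2).
have hm0 : 0 < hm by rewrite lt_min invr_gt0 ltr0n divr_gt0.
exists (Num.truncn (T / hm)).+1 => n nn0; set h := T / n.+1%:R.
have n0 : 0 < n.+1%:R :> R by rewrite ltr0n.
have h0 : 0 < h by rewrite divr_gt0.
have nh : n.+1%:R * h = T by rewrite mulrC divfK// gt_eqF.
have hhm : h <= hm.
  rewrite ler_pdivrMr// mulrC -ler_pdivrMr//.
  have := truncn_itv (divr_ge0 (ltW T0) (ltW hm0)) => /andP[_ /ltW H].
  by apply: le_trans H _; rewrite ler_nat ltnW.
have [h12 ht0] : h <= 2^-1 /\ h <= t0 / 2 by split; apply: le_trans hhm _; rewrite ge_min lexx ?orbT.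
have hT : h <= T by rewrite ler_pdivrMr// ler_peMr ?(ltW T0)// ler1n.
pose t j := t0 + j%:R * h.
have Lt j : Lam (t j) by exact: Lgrid.
have tS j : t j.+1 = t j + h by rewrite /t -natr1; ring.
have tT j : t (j + n.+1)%N = t j + T by rewrite /t natrD mulrDl nh addrA.
have tmono i j : (i <= j)%N -> t i <= t j.
  by move=> ij; rewrite lerD2l ler_wpM2r ?(ltW h0)// ler_nat.
have tn j : (j <= n.+3)%N -> t j <= t0 + T + 2 * h.
  by move=> /tmono/le_trans; apply; rewrite !tS (_ : t n = t0 + T - h) ?tS; [lra|rewrite /t -nh -natr1; ring].
have t0E : t 0%N = t0 by rewrite /t mul0r addr0.
have tpos j : t0 <= t j by rewrite -{1}t0E tmono.
(* Six steps from [t j - 2 * h] lead to [t j + 4 * h]: this is the window of radius [3 * h] around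
   [t j.+1], and [g] handles the one a period later. *)
pose f j := Q (t j - 2 * h); pose g j := Q (t j + T - 2 * h).
have fm : {homo f : i j / (i <= j)%N >-> i <= j}.
  move=> i j /tmono tij; have ti := tpos i; apply: (Q_mono HQ); lra.
have gm : {homo g : i j / (i <= j)%N >-> i <= j}.
  move=> i j /tmono tij; have ti := tpos i; apply: (Q_mono HQ); lra.
pose q j := f (j + 6)%N - f j; pose q' j := g (j + 6)%N - g j.
have q0 j : 0 <= q j by rewrite subr_ge0; apply: fm; exact: leq_addr.
have q0' j : 0 <= q' j by rewrite subr_ge0; apply: gm; exact: leq_addr.
have qE j : q j = Q (t j.+1 + 3 * h) - Q (t j.+1 - 3 * h).
  by rewrite /q /f !addnS addn0 !tS; congr (Q _ - Q _); ring.
have qE' j : q' j = Q (t j.+1 + T + 3 * h) - Q (t j.+1 + T - 3 * h).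
  by rewrite /q' /g !addnS addn0 !tS; congr (Q _ - Q _); ring.
have h00 : 0 <= h by exact: ltW.
have hq j : 0 <= h + q j + q' j by apply: addr_ge0 => //; exact: addr_ge0.
have Cbh : 0 <= Cb * h by exact: mulr_ge0.
pose nu j := Num.sqrt (Cb * h * (h + q j + q' j)).
have nu2 j : nu j ^+ 2 = Cb * h * (h + q j + q' j).
  by rewrite sqr_sqrtr// mulr_ge0.
have nu0 j : 0 <= nu j by exact: sqrtr_ge0.
have big (x y : R) j : 0 <= y -> y <= q j + q' j -> x <= 2 * C -> 0 <= x ->
    x * (6 * h * (6 * h + y)) <= nu j ^+ 2.
  move=> y0 yq xC x0; rewrite nu2.
  apply: (@le_trans _ _ (72 * C * (h * (h + q j + q' j)))); last first.
    by rewrite mulrA ler_wpM2r// ler_wpM2r// lerDl.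
  rewrite [leLHS](_ : _ = 36 * x * (h * (h + y / 6))); last by field.
  apply: ler_pM.
  - by rewrite mulr_ge0.
  - by apply: mulr_ge0 => //; apply: addr_ge0 => //; exact: divr_ge0.
  - lra.
  - by rewrite ler_wpM2l//; lra.
have nuh j : 2 * h <= nu j.
  have hn : 2 * h \is Num.nneg by rewrite nnegrE mulr_ge0.
  have nn : nu j \is Num.nneg by rewrite nnegrE.
  rewrite -(ler_pXn2r (ltn0Sn 1) hn nn) nu2 exprMn.
  apply: (@le_trans _ _ (4 * h * h)); first (rewrite expr2; lra).
  apply: ler_pM => //; first exact: mulr_ge0.
    by rewrite ler_wpM2r// lerDr mulr_ge0.
  by rewrite -addrA lerDl addr_ge0.
have q6 j : 0 <= q j <= q j + q' j by rewrite q0/= lerDl q0'.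
have q6' j : 0 <= q' j <= q j + q' j by rewrite q0'/= lerDr q0.
have CC : 0 <= C <= 2 * C by rewrite C0/= ler_peMl// ler1n.
have dU i j k' : (k' < n.+1)%N -> (k' <= i <= k'.+2)%N -> (k' <= j <= k'.+2)%N ->
    nrm (pairf s) (u (t j) - u (t i)) <= nu k'.
  move=> kn /andP[ki1 ki2] /andP[kj1 kj2].
  have HI l : (k' <= l <= k'.+2)%N -> 0 <= t l <= B /\ t k'.+1 - 3 * h < t l < t k'.+1 + 3 * h.
    move=> /andP[l1' l2']; have a1 := tmono _ _ l1'; have a2 := tmono _ _ l2'.
    have a3 : t l <= t0 + T + 2 * h by apply: tn; apply: leq_trans l2' _; rewrite !ltnS; exact: ltnW.
    have a4 := tpos l; move: a1 a2; rewrite !tS => a1 a2.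
    by rewrite BE; exact: (grid_point_bounds t00 T0 h0 hT a1 a2 a3 a4).
  have [iB ii] : 0 <= t i <= B /\ _ := HI i (introT andP (conj ki1 ki2)).
  have [jB jj] : 0 <= t j <= B /\ _ := HI j (introT andP (conj kj1 kj2)).
  have a1 : - 1 <= t k'.+1 - 3 * h by have := tpos k'; rewrite tS; lra.
  have [_ Ma2] := Ma; have [_ Mb2] := Mb.
  have D1 := Ma2 _ _ _ _ (Lt i) (Lt j) iB jB a1 ii jj.
  have D2 := Mb2 _ _ _ _ (Lt i) (Lt j) iB jB a1 ii jj.
  rewrite -(@ler_pXn2r _ 2)// ?nnegrE ?nrm_ge0// sqr_nrm_pairf//=.
  apply: le_trans (lerD D1 D2) _; rewrite -qE -mulrDl (_ : C + C = 2 * C); last by ring.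
  rewrite (_ : t k'.+1 + 3 * h - (t k'.+1 - 3 * h) = 6 * h); last by ring.
  by apply: big => //; [case/andP: (q6 k')|rewrite mulr_ge0].
have dN j : 0 <= t j <= B -> nrm (pairf s) (u (t j)) <= U + U.
  move=> jB; have [Ma1 _] := Ma; have [Mb1 _] := Mb.
  by apply: le_trans (nrm_pairf_le _ ps) _; apply: lerD; [exact: Ma1|exact: Mb1].
have tB j : (j <= n.+3)%N -> 0 <= t j <= B.
  by move=> /tn a; have b := tpos j; apply/andP; split; lra.
exists nu; split.
- move=> k' kn; rewrite -!/(t _).
  have kn2 : (k'.+2 <= n.+3)%N by rewrite !ltnS ltnW.
  have e1 : (k' <= k' <= k'.+2)%N by rewrite leqnn !leqW.
  have e2 : (k' <= k'.+1 <= k'.+2)%N by rewrite !leqnSn.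
  have e3 : (k' <= k'.+2 <= k'.+2)%N by rewrite leqnn andbT !leqW.
  split.
  + move=> w; have t1 := tpos k'.
    have t2 : t k'.+1 <= t0 + T by have := tmono _ _ kn; rewrite -[n.+1]add0n tT t0E.
    have [Na Nb] : near_solution s m A re_part (t k'.+1) h (E * nu k') /\
        near_solution s m A im_part' (t k'.+1) h (E * nu k').
      apply: SD => //.
      * by lra.
      * by rewrite tS; lra.
      * by lra.
      * by rewrite tS addrK.
      * by rewrite -tS.
      * by rewrite (_ : _ - h = t (k' + n.+1)%N)//; rewrite tT tS; ring.
      * by rewrite -tT.
      * by rewrite -tT -tS.
      * by rewrite -qE; case/andP: CC => CC0 CC1; apply: big => //; case/andP: (q6 k').
      * by rewrite -qE'; case/andP: CC => CC0 CC1; apply: big => //; case/andP: (q6' k').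
    have En : 0 <= E * nu k' by rewrite mulr_ge0.
    have := near_solution_pair ps pm En En Na Nb w.
    rewrite /= -(tS k'.+1) (_ : t k'.+1 - h = t k'); last by rewrite tS addrK.
    by rewrite -mulrDl.
  + exact: dU.
  + exact: dU.
  + by apply: le_trans (nuh k'); rewrite ler_peMl ?(ltW h0)// ler1n.
  + by split; apply: dN; apply: tB; apply: leq_trans kn2; [case/andP: e1|case/andP: e2].
- under eq_bigr do rewrite nu2.
  rewrite -mulr_sumr big_split big_split/= sumr_const card_ord -[h *+ _]mulr_natl nh.
  have S1 := sum_window 6 n.+1 fm; have S2 := sum_window 6 n.+1 gm.
  have bf : f (n.+1 + 6)%N - f 0%N <= D.
    rewrite lerB//; apply: (Q_mono HQ).
    * have := tpos (n.+1 + 6)%N; lra.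
    * rewrite addnC tT !tS t0E; lra.
    * by [].
    * rewrite t0E; lra.
  have bg : g (n.+1 + 6)%N - g 0%N <= D.
    rewrite lerB//; apply: (Q_mono HQ).
    * have := tpos (n.+1 + 6)%N; lra.
    * rewrite addnC tT !tS t0E; lra.
    * by [].
    * rewrite t0E; lra.
  rewrite [leRHS](_ : _ = Cb * h * (T + 12 * D)); last by rewrite /h; field; rewrite gt_eqF.
  apply: ler_wpM2l => //.
  have := le_trans S1 (ler_wpM2l (ler0n _ _) bf); have := le_trans S2 (ler_wpM2l (ler0n _ _) bg).
  rewrite /q /q'; lra.
- by rewrite -(sqr_nrm _ (psd_pairf ps)) u_shift expr0n.
- rewrite (_ : t0 + T + h = t0 + h + T); last by ring.
  by rewrite -(sqr_nrm _ (psd_pairf ps)) u_shift expr0n.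
Qed.

(** [core_growth] gives $2\gamma T\le aT$ for either sign of $\gamma$; when $\gamma<0$ the
    multiplier has modulus below 1 and [core_decay] applies. *)
Lemma floquet_exponent_bound (aT : R) :
  (forall t, 0 <= t -> alpha (t + T) - alpha t = aT) ->
  0 < m (re_part t0) (re_part t0) -> `|2 * gam * T| <= aT.
Proof.
move=> alphaT m0; have t00' := t00; have T0' := T0; have BE' := BE.
have [bm m0'] := pm.
have G0 : 0 < l1 ^+ 2 + l2 ^+ 2 by rewrite floquet_modulus expR_gt0.
have RF : regular_forms (pairf s) (pairf m) (fun t => pairf (A t)) alpha t0 (t0 + 2 * T) K L c.
  have tin t : t0 <= t <= t0 + 2 * T -> 0 <= t <= B.
    by move=> /andP[a b]; apply/andP; split; lra.
  split.
  - exact: psd_pairf.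
  - exact: psd_pairf.
  - by move=> x; rewrite lerD.
  - move=> t /tin tB; have F w := F1 w tB; split.
      split; first exact: bilin_pairf.
      by move=> x; rewrite addr_ge0//; [case: (F x.1)|case: (F x.2)].
    move=> x; have [a1 b1 d1] := F x.1; have [a2 b2 d2] := F x.2.
    by rewrite /pairf mulrDr mulrDr addrACA; split; exact: lerD.
  - move=> r t r1 rt tT.
    have r0 : 0 <= r by apply: le_trans r1; exact: ltW.
    have tB : t <= B by lra.
    split=> [x|x|]; last by have [_ _] := F2 0 r0 rt tB.
      have [a1 _ _] := F2 x.1 r0 rt tB; have [a2 _ _] := F2 x.2 r0 rt tB.
      rewrite /pairf opprD addrACA; apply: le_trans (ler_normD _ _) _.
      by rewrite mulrDr lerD.
    have [_ a1 _] := F2 x.1 r0 rt tB; have [_ a2 _] := F2 x.2 r0 rt tB.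
    by rewrite /pairf mulrDr lerD.
have FM : floquet_multiplier (pairf s) (pairf m) (fun t => pairf (A t)) (mulc l1 l2) t0 T (l1 ^+ 2 + l2 ^+ 2).
  have [bs _] := ps; split.
  - by move=> x y; exact: pairf_mulc.
  - by move=> x y; exact: pairf_mulc.
  - move=> t x y _; rewrite -pairf_mulc//.
    by rewrite /pairf !AT.
  - by exists (fun w => (l1 ^+ 2 + l2 ^+ 2)^-1 *: mulc l1 (- l2) w); exact: mulc_surj.
have um : 0 < pairf m (u t0) (u t0) by rewrite /pairf ltr_wpDr.
have t0' : 0 <= t0 by exact: ltW.
have R1 := core_growth T0 K0 L0 cpos G0 RF (alphaT t0 t0') FM floquet_grids_exist um.
have aT0 : 0 <= aT.
  have tB : t0 + T <= B by lra.
  have rt : t0 <= t0 + T by lra.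
  by have [_ _ /andP[]] := F2 0 t0' rt tB; rewrite alphaT.
move: R1; rewrite floquet_modulus ler_expR => R1.
have [g0|g0] := leP 0 (2 * gam * T); first by rewrite ger0_norm.
have G1 : l1 ^+ 2 + l2 ^+ 2 <= 1 by rewrite floquet_modulus -[leRHS]expR0 ler_expR ltW.
have alphaT' t : t0 <= t <= t0 + T -> alpha (t + T) - alpha t = aT.
  by move=> /andP[a _]; apply: alphaT; exact: le_trans a.
have := core_decay T0 K0 L0 cpos G0 G1 RF alphaT' FM floquet_grids_exist um.
by rewrite floquet_modulus -expRN ler_expR ltr0_norm.
Qed.

End floquet.

(** * Floquet exponents *)

Section concrete.
Context {R : realType} {d : nat} (D : set 'rV[R]_d) (oD : open D).
Local Notation leb := (@lebesgue_measure R).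
Local Notation mu := (@lebesgue_rV R d).
Local Notation V := (H1space oD).
Local Notation s := (fun f g : V => dotH1 D f g).
Local Notation m := (fun f g : V => dotL2 D f g).
Implicit Types (p v : R -> 'rV[R]_d -> R).

Lemma Aform_ae (k k' f g : 'rV[R]_d -> R) : Linfty D k -> Linfty D k' -> H1 D f -> H1 D g ->
  ae_on D (fun x => k x = k' x) -> Aform D k f g = Aform D k' f g.
Proof.
move=> Lk Lk' Hf Hg kk; apply: eq_bigr => i _; rewrite dotL2C [RHS]dotL2C.
apply: dotL2_ae; [exact: L2_Linfty_mul (wpartial_L2 i Hg)..|exact: wpartial_L2|].
by apply: ae_on_weaken kk => x _ ->.
Qed.

Lemma dotH1_ae (f g h : V) : ae_on D (fun x => f x = g x) -> dotH1 D f h = dotH1 D g h.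
Proof.
move=> fg; have Hf := H1valP f; have Hg := H1valP g; have Hh := H1valP h.
rewrite /dotH1 (dotL2_ae (H1_L2 Hf) (H1_L2 Hg) (H1_L2 Hh) fg); apply: congr1.
apply: eq_bigr => i _; apply: dotL2_ae; [exact: wpartial_L2..|].
exact: wpartial_ae.
Qed.

Lemma nrm_ae_eq0 (f g : V) : ae_on D (fun x => f x = g x) -> nrm s (f - g) = 0.
Proof.
move=> fg; have [bs _] := psd_dotH1 oD.
by rewrite /nrm (bilinBl _ _ _ bs) (dotH1_ae _ fg) subrr sqrtr0.
Qed.

Definition path_H1 p : R -> V := fun t => toH1 oD (p t).

Lemma path_H1K p t : (forall t, H1 D (p t)) -> path_H1 p t = p t :> ('rV[R]_d -> R).
Proof. by move=> Hp; exact: toH1K. Qed.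

Local Opaque dotH1 dotL2 Aform wpartial.

Lemma strongly_meas_path p : (forall t, H1 D (p t)) -> strongly_measurable_H1 D p ->
  strongly_meas s (path_H1 p).
Proof.
move=> Hp [q [Hq fq mq [N [mN N0 NH]]]]; exists (fun n => path_H1 (q n)); split.
- move=> n; rewrite (_ : range _ = toH1 oD @` range (q n)); first exact: finite_image.
  apply/seteqP; split=> [_ [t _ <-]|_ [_ [t _ <-] <-]]; last by exists t.
  by exists (q n t) => //; exists t.
- move=> n f; rewrite (_ : _ @^-1` _ = q n @^-1` [set H1val f]); first exact: mq.
  apply/seteqP; split=> t /= E; first by rewrite -E path_H1K.
  by apply: val_inj; rewrite /= -E; exact: toH1K.
- exists N; split; [exact: mN|exact: N0|] => t Ht; apply: NH => H; apply: Ht.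
  have E n : nrm s (path_H1 (q n) t - path_H1 p t) = H1_norm D (fun x => q n t x - p t x).
    by rewrite -H1_norm_nrm H1valB !path_H1K.
  have EE : (fun n => nrm s (path_H1 (q n) t - path_H1 p t)) =
      (fun n => H1_norm D (fun x => q n t x - p t x)) by apply/funext => n; exact: E.
  exact: (eq_ind_r (fun F : nat -> R => F @ \oo --> (0 : R)) H EE).
Qed.

Lemma path_increments (T : R) p : H1per_H1 D T p ->
  [/\ forall t, H1 D (p t), forall t, nrm s (path_H1 p (t + T) - path_H1 p t) = 0
  & exists (L : set R) (k : R -> R), [/\ \forall t \ae leb, L t, forall t, 0 <= k t,
      forall a b, leb.-integrable `[a, b] (EFin \o k) & increments s L k (path_H1 p)]].
Proof.
move=> [per [Hp sp fp] [v [Hv sv fv] wd]]; split=> //.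
  by move=> t; apply: nrm_ae_eq0; apply: ae_on_weaken (per t) => x _; rewrite !path_H1K.
have int q : (forall t, H1 D (q t)) ->
    (forall a b : R, (\int[leb]_(t in `[a, b]) (H1_norm D (q t) ^+ 2)%:E < +oo)%E) ->
    forall a b : R, (\int[leb]_(t in `[a, b]) (nrm s (path_H1 q t) ^+ 2)%:E < +oo)%E.
  move=> Hq H a b; have E t : nrm s (path_H1 q t) = H1_norm D (q t).
    by rewrite -H1_norm_nrm path_H1K.
  by under eq_integral do rewrite E; exact: H.
have ps := psd_dotH1 oD.
have [|L [k [H1' H2 H3 H4]]] := weak_derivative_increment ps (strongly_meas_path Hp sp)
  (strongly_meas_path Hv sv) (int _ Hp fp) (int _ Hv fv).
  move=> phi tphi w; have H := wd phi tphi w (H1valP w).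
  have E1 : \int[leb]_t (derive1 phi t * dotH1 D w (path_H1 p t)) =
      \int[leb]_t (derive1 phi t * dotH1 D w (p t)).
    by apply: eq_Rintegral => t _; rewrite path_H1K.
  have E2 : \int[leb]_t (phi t * dotH1 D w (path_H1 v t)) = \int[leb]_t (phi t * dotH1 D w (v t)).
    by apply: eq_Rintegral => t _; rewrite path_H1K.
  exact: (etrans E1 (etrans H (congr1 -%R (esym E2)))).
by exists L, k; split.
Qed.

Lemma Re_cexp_mul (w z : R[i]) (t : R) : complex.Re (cexp (- 'i%C * w * t%:C%C) * z) =
  expR (complex.Im w * t) * cos (complex.Re w * t) * complex.Re z +
  expR (complex.Im w * t) * sin (complex.Re w * t) * complex.Im z.
Proof.
case: w z => a b [x y].
have -> : - 'i%C * (a +i* b)%C * t%:C%C = ((b * t) +i* (- (a * t)))%C :> R[i].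
  by apply/eqP; rewrite eq_complex /=; apply/andP; split; apply/eqP; ring.
by rewrite /cexp /= cosN sinN; ring.
Qed.

End concrete.

Theorem lemma2p3 (R : realType) (d : nat) (D : set 'rV[R]_d) (T : R)
    (kappa kappa' : R -> 'rV[R]_d -> R) (w : R[i]) :
  (0 < d)%N ->
  bounded_lipschitz_domain D ->
  0 < T ->
  C1per_Linfty D T kappa kappa' ->
  (0 < ess_inf_cylinder D T kappa)%E ->
  (ess_sup_cylinder D T kappa < +oo)%E ->
  floquet_exponent D T kappa w ->
  (`|complex.Im w|%:E <=
     (2 / T)%:E * \int[@lebesgue_measure R]_(s in `[0%R, T])
       Linfty_norm D (fun x => Num.max (kappa' s x) 0 / kappa s x)%R)%E.
Proof.
move=> _ [oD _ _ _ _] T0 C1 inf0 _ [uw [per1 per2 sol nontriv]].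
have [Hp1 P1T [L1 [k1 [L1F k10 Ik1 inc1]]]] := path_increments oD per1.
have [Hp2 P2T [L2 [k2 [L2F k20 Ik2 inc2]]]] := path_increments oD per2.
set P1 := path_H1 oD _ in P1T inc1; set P2 := path_H1 oD _ in P2T inc2.
(* One set of good times and one integrable bound for both the real and the imaginary part. *)
pose k t := k1 t + k2 t; pose L t := L1 t /\ L2 t.
have k0 t : 0 <= k t by rewrite addr_ge0.
have Ik a b : (@lebesgue_measure R).-integrable `[a, b] (EFin \o k).
  by have := @integrableD _ _ _ (@lebesgue_measure R) _ (measurable_itv _) _ _ (Ik1 a b) (Ik2 a b).
have LF : \forall t \ae (@lebesgue_measure R), L t by exact: ae_and.
have [Q HQ] := monotone_primitive (- 1) k0 Ik.
pose s := fun f g : H1space oD => dotH1 D f g.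
pose m := fun f g : H1space oD => dotL2 D f g.
have ps : psd s := psd_dotH1 oD; have pm : psd m := psd_dotL2 oD.
have ms x : m x x <= s x x.
  by rewrite /s dotH1E lerDl; exact: Aform1_ge0.
have incl (k' : R -> R) a b : (forall t, 0 <= k' t <= k t) ->
    (forall a b, (@lebesgue_measure R).-integrable `[a, b] (EFin \o k')) ->
    \int[@lebesgue_measure R]_(x in `[a, b]) k' x <= \int[@lebesgue_measure R]_(x in `[a, b]) k x.
  move=> kk Ik'; apply: le_Rintegral => //.
  by move=> x _; case/andP: (kk x).
have iP1 : increments s L k P1.
  move=> t t' h [Lt _] [Lt' _] tt h0; apply: le_trans (inc1 t t' h Lt Lt' tt h0) _.
  apply: ler_wpM2l; first by move: tt h0; clear; lra.
  by apply: incl => // x; rewrite k10 lerDl k20.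
have iP2 : increments s L k P2.
  move=> t t' h [_ Lt] [_ Lt'] tt h0; apply: le_trans (inc2 t t' h Lt Lt' tt h0) _.
  apply: ler_wpM2l; first by move: tt h0; clear; lra.
  by apply: incl => // x; rewrite k20 lerDr k10.
have [HL per _ _] := C1.
pose A t := fun f g : H1space oD => Aform D (kappa t) f g.
have bA t : bilin (A t) by apply: bilin_Aform; case: (HL t).
have AT t x y : A (t + T) x y = A t x y.
  by apply: Aform_ae; [case: (HL (t + T))|case: (HL t)|exact: H1valP|exact: H1valP|exact: per].
pose Z := re_part P1 P2 (complex.Im w) (complex.Re w).
have ZE t : Z t = (fun x => complex.Re (cexp (- 'i%C * w * t%:C%C) * uw t x)) :> ('rV[R]_d -> R).
  apply/funext => x; rewrite Re_cexp_mul /Z /re_part H1val_lin.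
  rewrite -[H1val (_ *: P2 t)]/(fun x => _ * H1val (P2 t) x) /=.
  by rewrite /P1 /P2 !path_H1K.
have weak v phi : test_function [set t : R | 0 < t] phi ->
    \int[@lebesgue_measure R]_(x in `[0%R, +oo[) (derive1n 2 phi x * m v (Z x) + phi x * A x v (Z x)) = 0.
  move=> tphi; rewrite -[RHS](sol (H1val v) (H1valP v) phi tphi).
  by apply: eq_Rintegral => x _; rewrite /m /A /Aform ZE.
(* Almost every time is positive or excluded and has all its grids in [L], a countable family of
   translates. Without such a time of nonzero [Z], the solution would vanish almost everywhere. *)
have [t0 [t00 Lgrid mZ]] : exists t0, [/\ 0 < t0, forall n j, L (t0 + j%:R * (T / n.+1%:R)) & 0 < m (Z t0) (Z t0)].
  apply: contrapT => none; apply: nontriv.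
  have G : \forall t \ae (@lebesgue_measure R), forall n j, L (t + j%:R * (T / n.+1%:R)).
    by apply: ae_foralln => n; apply: ae_foralln => j; exact: ae_translate.
  have N0 : \forall t \ae (@lebesgue_measure R), t != 0.
    exists [set 0]; split; [exact: measurable_set1|exact: lebesgue_measure_set1|].
    by move=> t /= /negP; rewrite negbK => /eqP.
  apply: aeS (ae_and G N0) => t [Gt t0] t_ge0.
  have HZ : H1 D (Z t) := H1valP (Z t).
  suff Z0 : dotL2 D (Z t) (Z t) = 0.
    by apply: ae_on_weaken (dotL2_eq0_ae (H1_L2 HZ) Z0) => x _; rewrite ZE.
  apply/eqP; rewrite eq_le dotL2_ge0 andbT leNgt; apply/negP => mZ; apply: none.
  by exists t; split=> //; rewrite lt_neqAle eq_sym t0.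
(* The furthest time that enters the window sums is $t_0+2T+4h$, and $h\le T$. *)
have B0 : 0 <= t0 + 6 * T by rewrite addr_ge0 ?mulr_ge0 ?ltW.
have [alpha [K [M [c [[K0 M0] c0 aT intE [F1 F2]]]]]] := kappa_forms oD T0 C1 inf0 B0.
have main : `|2 * complex.Im w * T| <= alpha T - alpha 0.
  apply: (@floquet_exponent_bound _ _ s m ps pm ms A bA P1 P2 (complex.Im w) (complex.Re w) T T0 AT
    P1T P2T L k Q LF HQ iP1 iP2 weak t0 (t0 + 6 * T) alpha K M c t00 Lgrid erefl K0 M0 c0) => //.
  - by move=> t v tB; exact: F1 (H1valP v).
  - by move=> r t v r0 rt tB; exact: F2 (H1valP v).
rewrite [X in (_ * X)%E]intE -EFinM lee_fin.
(* With [I] the integral, the goal is $|\mathrm{Im}\,w|\,T\le2I$, while [main] says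
   $2|\mathrm{Im}\,w|\,T\le I$, which is stronger by a factor of 4. *)
rewrite mulrAC ler_pdivlMr// -[`|_| * T](@mulfK _ 2)//.
move: main; rewrite !normrM ger0_norm// (gtr0_norm T0) => main.
have := normr_ge0 (complex.Im w) => n0.
have nT : 0 <= `|complex.Im w| * T by rewrite mulr_ge0// ltW.
by rewrite mulfK//; lra.
Qed.
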